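(* Let $0\to Y\xrightarrow{i} X\xrightarrow{q} Z\to 0$ be a short exact sequence of complex Banach spaces. The following are equivalent: (1) The sequence locally splits. (2) The sequence $\mathcal P_{\mathtt A}$-splits. (3) The sequence $\mathcal P_{\mathtt A}$-lifts. (4) The sequence $\mathcal P_{\mathfrak K}$-splits. (5) The sequence $\mathcal H_{\mathfrak K}$-splits. (6) The sequence $\mathcal P_{\mathfrak W}$-splits. (7) The sequence $\mathcal H_{\mathfrak W}$-splits. If, moreover, $Z$ has the Bounded Approximation Property, then (1)–(7) are also equivalent to: (8) The sequence $\mathcal P_{\mathfrak K}$-lifts. (9) The sequence $\mathcal H_{\mathfrak K}$-lifts.
   Context: A short exact sequence $0\to Y\xrightarrow{i} X\xrightarrow{q} Z\to 0$ consists of Banach spaces and bounded linear operators with $i$ injective, $q$ surjective, $i(Y)=\ker q$. It locally splits if there is $\lambda>0$ such that for every finite-dimensional subspace $E\subset X$ there is a linear $T_E:E\to Y$ with $\|T_E\|\le\lambda$ and $i(T_E(e))=e$ for $e\in E\cap i(Y)$. $\mathcal P(^nX,V)$ denotes continuous $n$-homogeneous polynomials $X\to V$. A polynomial of finite type is one of the form $\sum_{k=1}^m\phi_k(x)^n v_k$ with $\phi_k\in X^*$, $v_k\in V$; $\mathcal P_{\mathtt A}(^nX,V)$ (approximable polynomials) is the norm closure of the finite type polynomials; $\mathcal P_{\mathfrak K}(^nX,V)$ (resp. $\mathcal P_{\mathfrak W}(^nX,V)$) consists of those $P$ mapping the unit ball of $X$ onto a relatively compact (resp. relatively weakly compact)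 set. $\mathcal H_b(X,V)$ denotes holomorphic mappings $X\to V$ bounded on bounded sets; $\mathcal H_{\mathfrak K}(X,V)$ (resp. $\mathcal H_{\mathfrak W}(X,V)$) consists of those $f\in\mathcal H_b(X,V)$ that are compact (resp. weakly compact), i.e. every point has a neighbourhood whose image is relatively compact (resp. relatively weakly compact). For such a class $\mathcal A$ (with polynomial classes taken for every degree $n\ge1$): the sequence $\mathcal A$-splits if for every Banach space $E$ every $t\in\mathcal A(Y,E)$ has $T\in\mathcal A(X,E)$ with $T\circ i=t$; it $\mathcal A$-lifts if for every Banach space $V$ every $t\in\mathcal A(V,Z)$ has $T\in\mathcal A(V,X)$ with $q\circ T=t$. BAP: there is $C>0$ such that for every $\epsilon>0$ and compact $K\subset Z$ there is a finite rank $T$ on $Z$, $\|T\|<C$, $\|Tz-z\|\le\epsilon$ on $K$. *)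

(* Defs.v *)
From HB Require Import structures.
From mathcomp Require Import all_boot all_order all_algebra.
From mathcomp Require Import all_classical all_reals all_analysis.
From mathcomp Require Import complex Rstruct Rstruct_topology.
Import Order.TTheory GRing.Theory Num.Theory.
Import numFieldNormedType.Exports.
Set Implicit Arguments. Unset Strict Implicit. Unset Printing Implicit Defensive.
Local Open Scope classical_set_scope.
Local Open Scope ring_scope.

Definition C : numClosedFieldType := (Rdefinitions.R)[i]%C.

Section Defs.

Definition clinear (X V : normedModType C) (f : X -> V) : Prop :=
  forall (a : C) (x y : X), f (a *: x + y) = a *: f x + f y.

Definition blinear (X V : normedModType C) (f : X -> V) : Prop :=
  clinear f /\ continuous f.

Definition bfunctional (X : normedModType C) (phi : X -> C) : Prop :=
  (forall (a : C) (x y : X), phi (a *: x + y) = a * phi x + phi y) /\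
  continuous phi.

Definition span_of (X : normedModType C) (m : nat) (s : 'I_m -> X) : set X :=
  [set x | exists c : 'I_m -> C, x = \sum_(k < m) c k *: s k].

Definition fin_dim_subspace (X : normedModType C) (E : set X) : Prop :=
  exists (m : nat) (s : 'I_m -> X), E = span_of s.

Definition short_exact (Y X Z : normedModType C) (i : Y -> X) (q : X -> Z) :
  Prop :=
  [/\ blinear i, blinear q, injective i, (forall z : Z, exists x : X, q x = z) &
      forall x : X, q x = 0 <-> exists y : Y, i y = x].

Definition locally_splits (Y X : normedModType C) (i : Y -> X) : Prop :=
  exists lam : C, 0 < lam /\
    forall E : set X, fin_dim_subspace E ->
      exists T : X -> Y,
        [/\ (forall (a : C) (e1 e2 : X), E e1 -> E e2 ->
               T (a *: e1 + e2) = a *: T e1 + T e2),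
            (forall e, E e -> `|T e| <= lam * `|e|) &
            (forall e, E e -> (exists y, i y = e) -> i (T e) = e)].

Definition uball (X : normedModType C) : set X := [set x | `|x| <= 1].

Definition dual (V : normedModType C) := sig (fun phi : V -> C => bfunctional phi).

Definition weak_embed (V : normedModType C) (x : V) : prod_topology (fun _ : dual V => C) :=
  fun phi => proj1_sig phi x.

Definition weakV (V : normedModType C) := initial_topology (@weak_embed V).

Definition rel_wcompact (V : normedModType C) (A : set V) : Prop :=
  @compact (weakV V) (@closure (weakV V) A).

Definition rel_compact (V : normedModType C) (A : set V) : Prop :=
  compact (closure A).

Definition fupd (X : Type) (n : nat) (x : 'I_n -> X) (k : 'I_n) (y : X) :
  'I_n -> X := fun j => if j == k then y else x j.

Definition multilinear (X V : normedModType C) (n : nat)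
  (A : ('I_n -> X) -> V) : Prop :=
  forall (k : 'I_n) (x : 'I_n -> X) (a : C) (y z : X),
    A (fupd x k (a *: y + z)) = a *: A (fupd x k y) + A (fupd x k z).

Definition hpoly (n : nat) (X V : normedModType C) (P : X -> V) : Prop :=
  continuous P /\
  exists A : ('I_n -> X) -> V, multilinear A /\ forall x, P x = A (fun _ => x).

Definition finite_type_poly (n : nat) (X V : normedModType C) (P : X -> V) :
  Prop :=
  exists (m : nat) (phi : 'I_m -> X -> C) (v : 'I_m -> V),
    (forall k, bfunctional (phi k)) /\
    forall x, P x = \sum_(k < m) (phi k x) ^+ n *: v k.

(* P_A(^n X, V): norm closure of finite type polynomials
   (norm of P = sup of |P x| on the unit ball) *)
Definition PA (n : nat) (X V : normedModType C) (P : X -> V) : Prop :=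
  hpoly n P /\
  forall eps : C, 0 < eps -> exists Q : X -> V, finite_type_poly n Q /\
    forall x, `|x| <= 1 -> `|P x - Q x| <= eps.

Definition PK (n : nat) (X V : normedModType C) (P : X -> V) : Prop :=
  hpoly n P /\ rel_compact (P @` @uball X).

Definition PW (n : nat) (X V : normedModType C) (P : X -> V) : Prop :=
  hpoly n P /\ rel_wcompact (P @` @uball X).

(* H_b(X, V): holomorphic (complex Frechet differentiable everywhere) and
   bounded on bounded sets *)
Definition Hb (X V : normedModType C) (f : X -> V) : Prop :=
  (forall x, differentiable f x) /\
  forall r : C, exists M : C, forall x, `|x| <= r -> `|f x| <= M.

Definition HK (X V : normedModType C) (f : X -> V) : Prop :=
  Hb f /\ forall x : X, exists U, nbhs x U /\ rel_compact (f @` U).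

Definition HW (X V : normedModType C) (f : X -> V) : Prop :=
  Hb f /\ forall x : X, exists U, nbhs x U /\ rel_wcompact (f @` U).

Definition poly_splits
  (cls : forall (n : nat) (X V : normedModType C), (X -> V) -> Prop)
  (Y X : normedModType C) (i : Y -> X) : Prop :=
  forall n : nat, (0 < n)%N ->
  forall (E : completeNormedModType C) (t : Y -> E),
    cls n Y E t -> exists T : X -> E, cls n X E T /\ T \o i = t.

Definition poly_lifts
  (cls : forall (n : nat) (X V : normedModType C), (X -> V) -> Prop)
  (X Z : normedModType C) (q : X -> Z) : Prop :=
  forall n : nat, (0 < n)%N ->
  forall (V : completeNormedModType C) (t : V -> Z),
    cls n V Z t -> exists T : V -> X, cls n V X T /\ q \o T = t.

Definition hol_splits
  (cls : forall (X V : normedModType C), (X -> V) -> Prop)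
  (Y X : normedModType C) (i : Y -> X) : Prop :=
  forall (E : completeNormedModType C) (t : Y -> E),
    cls Y E t -> exists T : X -> E, cls X E T /\ T \o i = t.

Definition hol_lifts
  (cls : forall (X V : normedModType C), (X -> V) -> Prop)
  (X Z : normedModType C) (q : X -> Z) : Prop :=
  forall (V : completeNormedModType C) (t : V -> Z),
    cls V Z t -> exists T : V -> X, cls V X T /\ q \o T = t.

Definition finite_rank (Z : normedModType C) (T : Z -> Z) : Prop :=
  exists E : set Z, fin_dim_subspace E /\ range T `<=` E.

Definition opnorm_lt (Z : normedModType C) (T : Z -> Z) (c0 : C) : Prop :=
  exists c : C, c < c0 /\ forall z, `|T z| <= c * `|z|.

Definition BAP (Z : normedModType C) : Prop :=
  exists c0 : C, 0 < c0 /\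
    forall eps : C, 0 < eps -> forall K : set Z, compact K ->
      exists T : Z -> Z,
        [/\ blinear T, finite_rank T, opnorm_lt T c0 &
            forall z, K z -> `|T z - z| <= eps].

End Defs.

(* Main.v *)
Require Import Defs.
From HB Require Import structures.
From mathcomp Require Import all_boot all_order all_algebra.
From mathcomp Require Import all_classical all_reals all_analysis.
From mathcomp Require Import complex Rstruct Rstruct_topology.
From mathcomp Require Import ring lra zify.
Import Order.TTheory GRing.Theory Num.Theory.
Import numFieldNormedType.Exports.
Local Open Scope classical_set_scope.
Local Open Scope ring_scope.
Set Implicit Arguments. Unset Strict Implicit. Unset Printing Implicit Defensive.

(** Suppose that [i] locally splits. The retractions of finite-dimensional subspaces form a net
    [T_s], eventually linear at any given vectors, and for a (weakly) compact map [t] on [Y] the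
    (weak) ultrafilter limit of [t (T_s x)] defines an extension of [t] to [X]. Such limits are again
    polynomials, because the polar form of a polynomial is a finite combination of its values, and
    again holomorphic, because holomorphy is equivalent to a Cauchy estimate on second differences.
    As for liftings, finite families of vectors of [Z] lift to [X] in such a way that the norms of
    all combinations with coefficients in a given box grow by at most a fixed factor; hence limits
    of finite sums of scalar functions times vectors lift. With the approximation property every
    compact map into [Z] is such a limit.

    Conversely, in degree one, or by differentiating at the origin, each extension property yields
    the extension of approximable linear maps from [Y], and each lifting property their lifting to
    [X]. Gluing countably many finite-rank maps into one approximable map makes the constants
    uniform. Lifting the inclusion of [q E] then produces the retraction of [E]; in the case of
    extensions it is produced by Helly's argument from extension operators defined on
    finite-dimensional spaces of functionals on [Y]. *)

(** The retractions supplied by local splitting are linear only on their own finite-dimensional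
    domains and are unrelated to one another, so what is to survive their limit must be expressed by
    finitely many values of the map. Remainders of derivatives do not qualify, being limits
    themselves; norm inequalities between finite combinations do, even in weak limits, because
    closed balls are weakly closed. Completeness of the target then recovers the derivative. The
    estimates come from a discrete Cauchy formula, in which means over roots of unity and Goursat's
    bisection take the place of contour integrals of vector-valued maps.

    In the converse, extending each single map gives no common constant, and bounds on the extended
    functionals one by one would not suffice for Helly's argument: the extensions must also satisfy
    all linear relations between the given functionals. These relations are therefore built into the
    target space of the glued map. *)

Notation RR := Rdefinitions.R.

(** * Norms with real values *)

(** The norm takes values in [C], whose order is only partial. Its real part loses nothing, by
    [rnE], and lives in an ordered field, where [lra] and [nra] apply. *)
Definition rn (V : normedModType C) (x : V) : RR := complex.Re `|x|.

Definition cR (r : RR) : C := (r%:C)%C.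

Lemma rnE (V : normedModType C) (x : V) : `|x| = cR (rn x).
Proof.
have /ger0_Im h : (0 : C) <= `|x| by [].
by rewrite /cR /rn; case: (`|x|) h => a b /= ->.
Qed.

Lemma cR_le (a b : RR) : (cR a <= cR b) = (a <= b).
Proof. exact: lecR. Qed.
Lemma cR_lt (a b : RR) : (cR a < cR b) = (a < b).
Proof. exact: ltcR. Qed.

Lemma cRD a b : cR (a + b) = cR a + cR b.
Proof. by rewrite /cR rmorphD. Qed.
Lemma cRB a b : cR (a - b) = cR a - cR b.
Proof. by rewrite /cR rmorphB. Qed.
Lemma cRM a b : cR (a * b) = cR a * cR b.
Proof. by rewrite /cR rmorphM. Qed.
Lemma cRV a : cR (a^-1) = (cR a)^-1.
Proof. by rewrite /cR fmorphV. Qed.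
Lemma cR1 : cR 1 = 1.
Proof. by []. Qed.
Lemma cR0 : cR 0 = 0.
Proof. by []. Qed.
Lemma cR_inj : injective cR.
Proof. by move=> a b []. Qed.

Lemma gt0_cR (e : C) : 0 < e -> exists2 r : RR, 0 < r & e = cR r.
Proof.
move=> e0; have := ger0_Im (ltW e0); case: e e0 => a b /= e0 b0.
by exists a; [move: e0; rewrite b0 ltcR | rewrite b0].
Qed.

Lemma le_cR (a : RR) (c : C) : cR a <= c -> exists2 r, c = cR r & a <= r.
Proof.
move=> h; exists (complex.Re c); last by move: h; rewrite lecE /= => /andP[].
by move: h; rewrite lecE /= => /andP[/eqP + _]; case: c => u v /= ->.
Qed.

Section RealNorm.
Variable V : normedModType C.
Implicit Types x y : V.

Lemma rn_ge0 x : 0 <= rn x.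
Proof. by rewrite -cR_le -rnE cR0. Qed.
Lemma rn0 : rn (0 : V) = 0.
Proof. by apply: cR_inj; rewrite -rnE normr0. Qed.
Lemma rnD x y : rn (x + y) <= rn x + rn y.
Proof. by rewrite -cR_le cRD -!rnE ler_normD. Qed.
Lemma rnN x : rn (- x) = rn x.
Proof. by rewrite /rn normrN. Qed.
Lemma rnB x y : rn (x - y) = rn (y - x).
Proof. by rewrite /rn distrC. Qed.
Lemma rnZ (a : C) x : rn (a *: x) = rn a * rn x.
Proof. by apply: cR_inj; rewrite cRM -!rnE normrZ. Qed.
Lemma rn0_eq0 x : rn x = 0 -> x = 0.
Proof. by move=> h; apply/eqP; rewrite -normr_eq0 rnE h. Qed.
Lemma rn_gt0 x : x != 0 -> 0 < rn x.
Proof. by rewrite -cR_lt -rnE normr_gt0. Qed.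
Lemma rn_le0 x : rn x <= 0 -> x = 0.
Proof. by move=> h; apply: rn0_eq0; apply: le_anti; rewrite h rn_ge0. Qed.
Lemma rnBD x y : rn (x - y) <= rn x + rn y.
Proof. by rewrite -(rnN y) rnD. Qed.
Lemma rn_tri z x y : rn (x - y) <= rn (x - z) + rn (z - y).
Proof. by rewrite (_ : x - y = (x - z) + (z - y)) ?rnD // addrA subrK. Qed.
Lemma rn_leB x y : rn x - rn y <= rn (x - y).
Proof. by have := rnD (x - y) y; rewrite subrK => h; lra. Qed.
Lemma rn_sum (I : Type) (r : seq I) (P : pred I) (F : I -> V) :
  rn (\sum_(i <- r | P i) F i) <= \sum_(i <- r | P i) rn (F i).
Proof.
elim/big_rec2: _ => [|i u v _ h]; first by rewrite rn0.
by apply: le_trans (rnD _ _) _; rewrite lerD2l.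
Qed.

Lemma rn_eps0 x : (forall e : RR, 0 < e -> rn x <= e) -> x = 0.
Proof.
move=> h; apply: rn_le0; rewrite leNgt; apply/negP => h0.
have := h (rn x / 2); lra.
Qed.

Lemma rn_nbhs x (A : set V) :
  nbhs x A <-> exists2 e : RR, 0 < e & forall y, rn (y - x) < e -> A y.
Proof.
rewrite -nbhs_ballE; split.
  case=> e /= /gt0_cR [r r0 ->] h; exists r => // y hy; apply: h.
  by rewrite -ball_normE /ball_ /= rnE cR_lt rnB.
case=> e e0 h; exists (cR e); first by rewrite /= cR_lt.
by move=> y; rewrite -ball_normE /ball_ /= rnE cR_lt rnB; apply: h.
Qed.

Lemma rn_cvgP (I : Type) (F : set_system I) (u : I -> V) (l : V) : Filter F ->
  u @ F --> l <-> forall e : RR, 0 < e -> \forall s \near F, rn (u s - l) < e.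
Proof.
move=> FF; split.
  move=> h e e0; apply: (h (fun y => rn (y - l) < e)).
  by apply/rn_nbhs; exists e.
move=> h A /rn_nbhs [e e0 hA]; have := h e e0; apply: filterS => s; exact: hA.
Qed.
End RealNorm.

Lemma rnM (a b : C) : rn (a * b) = rn a * rn b.
Proof. exact: (rnZ a (b : C)). Qed.
Lemma rn1 : rn (1 : C) = 1.
Proof. by apply: cR_inj; rewrite -rnE normr1. Qed.
Lemma rnV (a : C) : rn (a^-1) = (rn a)^-1.
Proof. by apply: cR_inj; rewrite cRV -!rnE normfV. Qed.
Lemma rn_cR (a : RR) : rn (cR a) = `|a|.
Proof. by rewrite /rn normc_def /= expr0n /= addr0 sqrtr_sqr. Qed.
Lemma rnX (a : C) n : rn (a ^+ n) = rn a ^+ n.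
Proof. by elim: n => [|n h]; rewrite ?expr0 ?rn1 // !exprS rnM h. Qed.
Lemma rn_nat n : rn (n%:R : C) = n%:R.
Proof.
by rewrite (_ : n%:R = cR n%:R) ?rn_cR ?ger0_norm // /cR rmorph_nat.
Qed.

(** * Identities in modules by reflection *)

Inductive mexp (K : Type) : Type :=
| MVar of nat | MZero | MAdd of mexp K & mexp K | MOpp of mexp K
| MScale of K & mexp K.
Arguments MVar {K}. Arguments MZero {K}.

Fixpoint meval (K : pzRingType) (V : lmodType K) (env : seq V) (e : mexp K) : V :=
  match e with
  | MVar i => nth 0 env i
  | MZero => 0
  | MAdd a b => meval env a + meval env b
  | MOpp a => - meval env a
  | MScale k a => k *: meval env a
  end.

(** [Nat.eqb] instead of [==] lets [cbn] compute the coefficients of a reified goal, so that only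
    ring equations are left. *)
Fixpoint mcoef (K : pzRingType) (e : mexp K) (i : nat) : K :=
  match e with
  | MVar j => if Nat.eqb i j then 1 else 0
  | MZero => 0
  | MAdd a b => mcoef a i + mcoef b i
  | MOpp a => - mcoef a i
  | MScale k a => k * mcoef a i
  end.

Fixpoint mcoefs_eq (K : pzRingType) (n : nat) (a b : mexp K) : Prop :=
  match n with
  | O => True
  | n'.+1 => mcoef a n' = mcoef b n' /\ mcoefs_eq n' a b
  end.

Lemma mevalE (K : pzRingType) (V : lmodType K) (env : seq V) (e : mexp K) :
  meval env e = \sum_(i < size env) mcoef e i *: nth 0 env i.
Proof.
elim: e => [j| |a iha b ihb|a iha|k a iha] /=; rewrite ?iha ?ihb.
- have h (i : nat) : Nat.eqb i j = (i == j) by apply/PeanoNat.Nat.eqb_spec/eqP.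
  have [ltj|gej] := ltnP j (size env).
    rewrite (bigD1 (Ordinal ltj)) //= h eqxx scale1r big1 ?addr0 // => i.
    by rewrite -val_eqE /= h => /negPf ->; rewrite scale0r.
  rewrite nth_default // big1 // => i _; rewrite h; case: eqP => [e|_].
    by move: (ltn_ord i); rewrite e ltnNge gej.
  by rewrite scale0r.
- by rewrite big1 // => i _; rewrite scale0r.
- by rewrite -big_split /=; apply: eq_bigr => i _; rewrite scalerDl.
- by rewrite -sumrN; apply: eq_bigr => i _; rewrite scaleNr.
- by rewrite scaler_sumr; apply: eq_bigr => i _; rewrite scalerA.
Qed.

Lemma meval_eq (K : pzRingType) (V : lmodType K) (env : seq V) (a b : mexp K) :
  mcoefs_eq (size env) a b -> meval env a = meval env b.
Proof.
move=> h; rewrite !mevalE; apply: eq_bigr => -[i hi] _ /=; congr (_ *: _).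
elim: (size env) h hi => //= n ih [e1 h]; rewrite ltnS leq_eqVlt.
by case/orP => [/eqP -> //|]; exact: ih.
Qed.

Ltac mmem x l :=
  lazymatch l with
  | nil => constr:(false)
  | cons ?y ?l' => let r := match constr:(tt) with
      | _ => let _ := match constr:(tt) with _ => constr_eq x y end in constr:(true)
      | _ => mmem x l' end in r
  end.
Ltac mvars l t :=
  lazymatch t with
  | GRing.add ?a ?b => let l1 := mvars l a in mvars l1 b
  | GRing.opp ?a => mvars l a
  | GRing.scale _ ?a => mvars l a
  | GRing.zero => l
  | _ => let b := mmem t l in
         lazymatch b with true => l | false => constr:(cons t l) end
  end.
Ltac mindex x l :=
  lazymatch l with
  | cons ?y ?l' => match constr:(tt) with
      | _ => let _ := match constr:(tt) with _ => constr_eq x y end in constr:(O)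
      | _ => let n := mindex x l' in constr:(S n) end
  end.
Ltac mreify K l t :=
  lazymatch t with
  | GRing.add ?a ?b => let u := mreify K l a in let v := mreify K l b in
                       constr:(@MAdd K u v)
  | GRing.opp ?a => let u := mreify K l a in constr:(@MOpp K u)
  | GRing.scale ?k ?a => let u := mreify K l a in constr:(@MScale K k u)
  | GRing.zero => constr:(@MZero K)
  | _ => let n := mindex t l in constr:(@MVar K n)
  end.
Ltac module_core K :=
  match goal with |- @eq ?T ?a ?b =>
    let l0 := constr:(@nil T) in
    let l1 := mvars l0 a in let l := mvars l1 b in
    let u := mreify K l a in let v := mreify K l b in
    refine (@meval_eq _ _ l u v _); cbn [mcoefs_eq size mcoef Nat.eqb];
    repeat (split; [|]); try exact I
  end.
(** Decides linear identities in modules over [C]: coefficients are compared by [ring]. *)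
Ltac module := module_core (GRing.PzRing.sort (C : pzRingType)); try ring.

(** * Goursat's lemma and Cauchy estimates *)

(** Differentiability at the single point [p], with nothing said about continuity of the derivative:
    the generality of Goursat's lemma. *)
Definition cdiff (V : normedModType C) (H : C -> V) (p : C) : Prop :=
  exists D : V, forall e : RR, 0 < e -> exists2 d : RR, 0 < d &
    forall w : C, rn (w - p) < d -> rn (H w - H p - (w - p) *: D) <= e * rn (w - p).

Section Goursat.
Variables (V : normedModType C) (H : C -> V).

(** Twice the trapezoid rule on the segment from [p] to [q]. *)
Definition trap (p q : C) : V := (q - p) *: (H p + H q).

(** Composite rule with [2 ^ m] pieces, defined by halving the interval so that quartering a square
    lowers [m] by exactly one. *)
Fixpoint edge (g : RR -> C) (m : nat) (a h : RR) : V :=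
  if m is m'.+1 then edge g m' a (h / 2) + edge g m' (a + h / 2) (h / 2)
  else trap (g a) (g (a + h)).

Variable z : RR -> RR -> C.

(* Dyadic trapezoid sums along the image under [z] of the boundary of a square: a substitute for
   the contour integral to which Goursat's bisection argument applies. *)
Definition bdry (m : nat) (s t h : RR) : V :=
  edge (z ^~ t) m s h + edge (z (s + h)) m t h
  - edge (z ^~ (t + h)) m s h - edge (z s) m t h.

(** Each inner edge belongs to two quarters, which traverse it in opposite directions; the outer
    edges at depth [m.+1] are sums of their halves at depth [m]. *)
Lemma bdryS m s t h : bdry m.+1 s t h =
  bdry m s t (h / 2) + bdry m (s + h / 2) t (h / 2)
  + bdry m s (t + h / 2) (h / 2) + bdry m (s + h / 2) (t + h / 2) (h / 2).
Proof.
have e (x : RR) : x + h / 2 + h / 2 = x + h by rewrite -addrA -splitr.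
rewrite /bdry /= !e; module.
Qed.

(* The trapezoid rule is exact on affine functions, so only the deviation [r] of
   [H] from an affine function contributes. *)
Definition prim (p : C) (D : V) (w : C) : V :=
  (2 * w) *: H p + (w ^+ 2 - 2 * p * w) *: D.

(** The bound does not depend on the depth: each piece errs by at most its length times [2 * M], and
    the lengths add up to at most [L * h]. *)
Lemma edge_affine (g : RR -> C) (p : C) (D : V) (L M lo hi : RR) :
  (forall x y : RR, lo <= x <= hi -> lo <= y <= hi ->
    rn (g x - g y) <= L * `|x - y|) ->
  (forall x : RR, lo <= x <= hi -> rn (H (g x) - H p - (g x - p) *: D) <= M) ->
  forall m (a h : RR), 0 <= h -> lo <= a -> a + h <= hi ->
  rn (edge g m a h - (prim p D (g (a + h)) - prim p D (g a))) <= L * h * (2 * M).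
Proof.
move=> gL gM m; elim: m => [|m ih] a h h0 la ha /=.
  rewrite /trap.
  set r1 := H (g a) - H p - (g a - p) *: D.
  set r2 := H (g (a + h)) - H p - (g (a + h) - p) *: D.
  rewrite (_ : _ - _ = (g (a + h) - g a) *: (r1 + r2)); last first.
    by rewrite /r1 /r2 /prim; module.
  rewrite rnZ; apply: ler_pM; rewrite ?rn_ge0 //.
    by have := gL (a + h) a; rewrite addrAC subrr add0r ger0_norm //; apply; lra.
  have := rnD r1 r2; have := gM a ltac:(lra); have := gM (a + h) ltac:(lra).
  rewrite -/r1 -/r2; lra.
have h1 := ih a (h / 2) ltac:(lra) ltac:(lra) ltac:(lra).
have h2 := ih (a + h / 2) (h / 2) ltac:(lra) ltac:(lra) ltac:(lra).
rewrite -(addrA a) -splitr in h2.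
rewrite (_ : _ - _ =
   (edge g m a (h / 2) - (prim p D (g (a + h / 2)) - prim p D (g a))) +
   (edge g m (a + h / 2) (h / 2) - (prim p D (g (a + h)) - prim p D (g (a + h / 2)))));
  last by module.
apply: le_trans (rnD _ _) _; apply: le_trans (lerD h1 h2) _; lra.
Qed.

(** Around the closed boundary the differences of [prim] cancel; only the four edge errors
    remain. *)
Lemma bdry_affine p D L M s t h :
  0 <= h ->
  (forall s1 t1 s2 t2 : RR, s <= s1 <= s + h -> t <= t1 <= t + h ->
     s <= s2 <= s + h -> t <= t2 <= t + h ->
     rn (z s1 t1 - z s2 t2) <= L * (`|s1 - s2| + `|t1 - t2|)) ->
  (forall s1 t1 : RR, s <= s1 <= s + h -> t <= t1 <= t + h ->
     rn (H (z s1 t1) - H p - (z s1 t1 - p) *: D) <= M) ->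
  forall m, rn (bdry m s t h) <= 4 * (L * h * (2 * M)).
Proof.
move=> h0 zL zM m.
have E1 : forall t1, t <= t1 <= t + h -> rn (edge (z ^~ t1) m s h -
    (prim p D (z (s + h) t1) - prim p D (z s t1))) <= L * h * (2 * M).
  move=> t1 ht; apply: (@edge_affine (z ^~ t1) p D L M s (s + h)) => //; try lra.
    by move=> x y hx hy /=; have := zL x t1 y t1 hx ht hy ht; rewrite subrr normr0 addr0.
  by move=> x hx; apply: zM.
have E2 : forall s1, s <= s1 <= s + h -> rn (edge (z s1) m t h -
    (prim p D (z s1 (t + h)) - prim p D (z s1 t))) <= L * h * (2 * M).
  move=> s1 hs; apply: (@edge_affine (z s1) p D L M t (t + h)) => //; try lra.
    by move=> x y hx hy /=; have := zL s1 x s1 y hs hx hs hy; rewrite subrr normr0 add0r.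
  by move=> x hx; apply: zM.
have e1 := E1 t ltac:(lra); have e2 := E2 (s + h) ltac:(lra).
have e3 := E1 (t + h) ltac:(lra); have e4 := E2 s ltac:(lra).
set F1 := edge _ _ _ _ - _ in e1; set F2 := edge _ _ _ _ - _ in e2.
set F3 := edge _ _ _ _ - _ in e3; set F4 := edge _ _ _ _ - _ in e4.
rewrite (_ : bdry m s t h = F1 + F2 - F3 - F4); last first.
  by rewrite /bdry /F1 /F2 /F3 /F4; module.
have := rnBD (F1 + F2 - F3) F4; have := rnBD (F1 + F2) F3; have := rnD F1 F2; lra.
Qed.

(** Convergence of the sums as [m] grows is never established. Excess at arbitrarily large depths is
    the property that one of the four quarters inherits. *)
Definition bad (e s t h : RR) : Prop :=
  forall m0, exists2 m, (m0 <= m)%N & e < rn (bdry m s t h).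

Lemma bad_child e s t h : bad e s t h -> exists s' t',
  [/\ s' = s \/ s' = s + h / 2, t' = t \/ t' = t + h / 2 & bad (e / 4) s' t' (h / 2)].
Proof.
move=> hb; apply/not_existsP => hn.
have {hn} good s' t' : (s' = s \/ s' = s + h / 2) -> (t' = t \/ t' = t + h / 2) ->
    exists m0, forall m, (m0 <= m)%N -> rn (bdry m s' t' (h / 2)) <= e / 4.
  move=> hs ht; have : ~ bad (e / 4) s' t' (h / 2).
    by move=> h1; apply: (hn s'); exists t'.
  move=> /existsNP [m0 h1]; exists m0 => m hm; rewrite leNgt; apply/negP => h2.
  by apply: h1; exists m.
have [m1 h1] := good s t (or_introl erefl) (or_introl erefl).
have [m2 h2] := good (s + h / 2) t (or_intror erefl) (or_introl erefl).
have [m3 h3] := good s (t + h / 2) (or_introl erefl) (or_intror erefl).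
have [m4 h4] := good (s + h / 2) (t + h / 2) (or_intror erefl) (or_intror erefl).
(* A depth beyond all four thresholds, plus the one level that [bdryS] consumes. *)
have [[|m] hm] := hb (m1 + m2 + m3 + m4).+1; first by [].
rewrite bdryS; apply/negP; rewrite -leNgt.
have {}h1 := h1 m ltac:(lia); have {}h2 := h2 m ltac:(lia).
have {}h3 := h3 m ltac:(lia); have {}h4 := h4 m ltac:(lia).
set F1 := bdry _ _ _ _ in h1 *; set F2 := bdry _ _ _ _ in h2 *.
set F3 := bdry _ _ _ _ in h3 *; set F4 := bdry _ _ _ _ in h4 *.
have := rnD (F1 + F2 + F3) F4; have := rnD (F1 + F2) F3; have := rnD F1 F2; lra.
Qed.
End Goursat.

(** The dyadic scale 2^-k, by which squares, Cauchy sequences and weights are measured below. *)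
Definition hp (k : nat) : RR := 2^-1 ^+ k.
Lemma hp0 : hp 0 = 1. Proof. by []. Qed.
Lemma hpS k : hp k.+1 = hp k / 2. Proof. by rewrite /hp exprS mulrC. Qed.
Lemma hp_gt0 k : 0 < hp k. Proof. by rewrite exprn_gt0 // invr_gt0. Qed.
Lemma hp_le1 k : hp k <= 1. Proof. by elim: k => [|k]; rewrite ?hp0 // hpS; lra. Qed.

Lemma hp_lt (e : RR) : 0 < e -> exists k, hp k < e.
Proof.
move=> e0; have [k hk] : exists k : nat, e^-1 < k%:R.
  by exists (Num.truncn e^-1).+1; rewrite truncnS_gt.
exists k; rewrite /hp exprVn invf_plt ?posrE ?exprn_gt0 //.
by apply: lt_trans hk _; rewrite -natrX ltr_nat ltn_expl.
Qed.

Lemma nested_point (a : nat -> RR) :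
  (forall k, a k <= a k.+1 /\ a k.+1 + hp k.+1 <= a k + hp k) ->
  exists c, forall k, a k <= c <= a k + hp k.
Proof.
move=> h.
have inc k n : a k <= a (k + n)%N.
  by elim: n => [|n ih]; rewrite ?addn0 // addnS; have := h (k + n)%N; lra.
have dec k n : a (k + n)%N + hp (k + n) <= a k + hp k.
  by elim: n => [|n ih]; rewrite ?addn0 // addnS; have := h (k + n)%N; lra.
have ub k j : a j <= a k + hp k.
  have [jk|kj] := leqP j k.
    by have := inc j (k - j)%N; rewrite subnKC //; have := hp_gt0 k; lra.
  have := dec k (j - k)%N; rewrite subnKC; last exact: ltnW.
  by have := hp_gt0 j; lra.
exists (sup (range a)) => k; apply/andP; split.
  apply: ub_le_sup; last by exists k.
  by exists (a 0%N + hp 0) => _ [j _ <-].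
by apply: ge_sup; [exists (a 0%N); exists 0%N | move=> _ [j _ <-]].
Qed.

(** Dependent choice of a bad quarter inside each bad square. The threshold is divided by 4 every
    time, like the area, whence [e * hp k ^+ 2]. *)
Lemma bad_point (V : normedModType C) (H : C -> V) (z : RR -> RR -> C) (e : RR) :
  bad H z e 0 0 1 ->
  exists s t : RR, forall k, exists a b : RR,
    [/\ 0 <= a /\ a + hp k <= 1, 0 <= b /\ b + hp k <= 1, a <= s <= a + hp k,
        b <= t <= b + hp k & bad H z (e * hp k ^+ 2) a b (hp k)].
Proof.
move=> bad0.
have /choice [f hf] : forall x : nat * (RR * RR), exists y : RR * RR,
   bad H z (e * hp x.1 ^+ 2) x.2.1 x.2.2 (hp x.1) ->
   [/\ y.1 = x.2.1 \/ y.1 = x.2.1 + hp x.1.+1, y.2 = x.2.2 \/ y.2 = x.2.2 + hp x.1.+1 &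
       bad H z (e * hp x.1.+1 ^+ 2) y.1 y.2 (hp x.1.+1)].
  move=> [k [s t]] /=; have [hb|] := pselect (bad H z (e * hp k ^+ 2) s t (hp k)).
    have [s' [t' [hs ht h1]]] := bad_child hb.
    exists (s', t') => _; rewrite hpS; split => //=.
    by rewrite (_ : e * _ = e * hp k ^+ 2 / 4) //; field.
  by exists (s, t).
pose fix X k : RR * RR := if k is k'.+1 then f (k', X k') else (0, 0).
have badX k : bad H z (e * hp k ^+ 2) (X k).1 (X k).2 (hp k).
  elim: k => [|k ih]; first by rewrite hp0 expr1n mulr1.
  by have [] := hf (k, X k) ih.
have X1 k : (X k).1 <= (X k.+1).1 /\ (X k.+1).1 + hp k.+1 <= (X k).1 + hp k.
  have [+ _ _] := hf (k, X k) (badX k); rewrite /= hpS; have := hp_gt0 k.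
  by move=> h0 [] ->; lra.
have X2 k : (X k).2 <= (X k.+1).2 /\ (X k.+1).2 + hp k.+1 <= (X k).2 + hp k.
  have [_ + _] := hf (k, X k) (badX k); rewrite /= hpS; have := hp_gt0 k.
  by move=> h0 [] ->; lra.
have [s hs] := nested_point X1; have [t ht] := nested_point X2.
have X01 k : 0 <= (X k).1 /\ (X k).1 + hp k <= 1.
  by elim: k => [|k ih] /=; [rewrite hp0; lra | have := X1 k => /=; lra].
have X02 k : 0 <= (X k).2 /\ (X k).2 + hp k <= 1.
  by elim: k => [|k ih] /=; [rewrite hp0; lra | have := X2 k => /=; lra].
exists s, t => k; exists (X k).1, (X k).2; split=> //.
Qed.

Lemma goursat (V : normedModType C) (H : C -> V) (z : RR -> RR -> C) (L : RR) :
  (forall s t s' t' : RR, 0 <= s <= 1 -> 0 <= t <= 1 -> 0 <= s' <= 1 -> 0 <= t' <= 1 ->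
     rn (z s t - z s' t') <= L * (`|s - s'| + `|t - t'|)) ->
  (forall s t : RR, 0 <= s <= 1 -> 0 <= t <= 1 -> cdiff H (z s t)) ->
  forall e : RR, 0 < e -> exists m0, forall m, (m0 <= m)%N ->
    rn (bdry H z m 0 0 1) <= e.
Proof.
move=> zL Hd e e0; apply: contrapT => hn.
have bad0 : bad H z e 0 0 1.
  move=> m0; apply: contrapT => h1; apply: hn; exists m0 => m hm.
  by rewrite leNgt; apply/negP => h2; apply: h1; exists m.
have [s [t bst]] := bad_point bad0.
have [s01 t01] : 0 <= s <= 1 /\ 0 <= t <= 1.
  have [a [b [a1 b1 as1 bt1 _]]] := bst 0%N; move: a1 b1 as1 bt1; rewrite hp0; clear; lra.
have [D hD] := Hd s t s01 t01.
(* With [h] for [hp k] and [e'] for the quotient of [e] by this constant, [bdry_affine] gives the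
   bound 4 (L h) (2 e' (2 L h)) = 16 L^2 e' h^2, which has to stay below e h^2; the summand 1 covers
   [L = 0]. *)
have L2 : 0 < 16 * (L ^+ 2 + 1) by have := sqr_ge0 L; lra.
have [d d0 hd] := hD (e / (16 * (L ^+ 2 + 1))) (divr_gt0 e0 L2).
have L1 : 0 <= L.
  have I0 : (0 : RR) <= (0 : RR) <= (1 : RR) by apply/andP; split; [exact: lexx | exact: ler01].
  have I1 : (0 : RR) <= (1 : RR) <= (1 : RR) by apply/andP; split; [exact: ler01 | exact: lexx].
  have := zL 1 0 0 0 I1 I0 I0 I0.
  by rewrite subrr normr0 addr0 subr0 normr1 mulr1; apply: le_trans; exact: rn_ge0.
have L3 : 0 < 2 * (L + 1) by lra.
have [k hk] := hp_lt (divr_gt0 d0 L3).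
have hk' : L * (2 * hp k) < d.
  move: hk; rewrite ltr_pdivlMr; last by clear -L1; lra.
  by have := hp_gt0 k; clear; nra.
have [a [b [a1 b1 as1 bt1 /(_ 0%N)[m _]]]] := bst k.
apply/negP; rewrite -leNgt; have p0 := hp_gt0 k.
have in01 (c u : RR) : 0 <= c /\ c + hp k <= 1 -> c <= u <= c + hp k -> 0 <= u <= 1 by clear; lra.
have close (c u v : RR) : c <= u <= c + hp k -> c <= v <= c + hp k -> `|u - v| <= hp k.
  by rewrite ler_norml; clear; lra.
apply: le_trans (bdry_affine (p := z s t) (D := D) (L := L)
   (M := e / (16 * (L ^+ 2 + 1)) * (L * (2 * hp k))) (ltW p0) _ _ m) _.
- by move=> s1 t1 s2 t2 /(in01 _ _ a1) g1 /(in01 _ _ b1) g2 /(in01 _ _ a1) g3 /(in01 _ _ b1) g4; apply: zL.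
- move=> s1 t1 g1 g2.
  have near : rn (z s1 t1 - z s t) <= L * (2 * hp k).
    apply: le_trans (zL _ _ _ _ (in01 _ _ a1 g1) (in01 _ _ b1 g2) s01 t01) _.
    by apply: ler_wpM2l => //; rewrite mulr_natl mulr2n; apply: lerD; [exact: close g1 as1 | exact: close g2 bt1].
  apply: le_trans (hd _ (le_lt_trans near hk')) _.
  by apply: ler_wpM2l => //; rewrite divr_ge0 // ltW.
- have L20 : L ^+ 2 + 1 != 0 by rewrite gt_eqF // ltr_wpDl // sqr_ge0.
  rewrite (_ : 4 * _ = e * hp k ^+ 2 * (L ^+ 2 / (L ^+ 2 + 1))); last by field.
  apply: ler_piMr; first by rewrite mulr_ge0 ?sqr_ge0 // ltW.
  by rewrite ler_pdivrMr ?mul1r ?lerDl // ltr_wpDl // sqr_ge0.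
Qed.

(** * Roots of unity whose order is a power of 2 *)

Definition cis (t : RR) : C := (trigo.cos t +i* trigo.sin t)%C.

Lemma cis0 : cis 0 = 1.
Proof. by rewrite /cis cos0 sin0. Qed.
Lemma cisD s t : cis (s + t) = cis s * cis t.
Proof. by rewrite /cis trigo.cosD trigo.sinD; apply/eqP; rewrite eq_complex /= eqxx /= addrC. Qed.
Lemma rn_cis t : rn (cis t) = 1.
Proof. by rewrite /rn normc_def /= cos2Dsin2 sqrtr1. Qed.
Lemma cis_neq0 t : cis t != 0.
Proof. by apply/eqP => h; have := rn_cis t; rewrite h rn0; lra. Qed.

Lemma dist_le_of_derive (R : realType) (f df : R -> R) :
  (forall x : R, is_derive x (1 : R) f (df x)) -> (forall x : R, `|df x| <= 1) ->
  forall x y : R, `|f x - f y| <= `|x - y|.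
Proof.
move=> fd df1 x y; wlog xy : x y / x <= y.
  move=> h; have [/h //|/ltW /h] := leP x y.
  by rewrite distrC => h1; rewrite (le_trans h1) // distrC.
have [|c _ h] := @MVT_segment _ f df x y xy (fun z _ => fd z).
  apply: continuous_subspaceT => z; apply: differentiable_continuous.
  by apply/derivable1_diffP; apply: ex_derive.
by rewrite distrC h normrM (distrC x y) ler_piMl.
Qed.

Lemma cos_lip (R : realType) (x y : R) : `|trigo.cos x - trigo.cos y| <= `|x - y|.
Proof.
apply: (@dist_le_of_derive _ _ (fun x => - trigo.sin x)) => t.
by rewrite normrN sin_max.
Qed.

Lemma sin_lip (R : realType) (x y : R) : `|trigo.sin x - trigo.sin y| <= `|x - y|.
Proof.
by apply: (@dist_le_of_derive _ _ trigo.cos) => t; exact: cos_max.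
Qed.

Lemma rn_le_ReIm (a b : RR) : rn ((a +i* b)%C : C) <= `|a| + `|b|.
Proof.
rewrite (_ : (a +i* b)%C = cR a + 'i%C * cR b); last by rewrite [LHS]complexE.
apply: le_trans (rnD _ _) _; rewrite rnM !rn_cR.
by rewrite (_ : rn _ = 1) ?mul1r // /rn normc_def /= expr0n expr1n add0r sqrtr1.
Qed.

Lemma cis_lip s t : rn (cis s - cis t) <= 2 * `|s - t|.
Proof.
rewrite (_ : _ - _ = ((trigo.cos s - trigo.cos t) +i* (trigo.sin s - trigo.sin t))%C) //.
apply: le_trans (rn_le_ReIm _ _) _.
have := cos_lip s t; have := sin_lip s t; lra.
Qed.

(** A primitive root of unity of order [2 ^ m]. *)
Definition om (m : nat) : C := cis (pi *+ 2 * hp m).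

Lemma cisX t k : cis t ^+ k = cis (t *+ k).
Proof. by elim: k => [|k ih]; rewrite ?expr0 ?cis0 // exprS ih mulrS cisD. Qed.
Lemma om_neq0 m : om m != 0. Proof. exact: cis_neq0. Qed.
Lemma rn_om m : rn (om m) = 1. Proof. exact: rn_cis. Qed.
Lemma om_sqr m : om m.+1 ^+ 2 = om m.
Proof. by rewrite cisX /om hpS; congr cis; rewrite -mulr_natr; field. Qed.
Lemma om0 : om 0 = 1.
Proof. by rewrite /om hp0 mulr1 /cis cos2pi sin2pi. Qed.
Lemma om1 : om 1 = -1.
Proof.
rewrite /om (_ : _ * _ = pi); last by rewrite hpS hp0 -mulr_natr; field.
by rewrite /cis cospi sinpi; apply/eqP; rewrite eq_complex /= oppr0 !eqxx.
Qed.
Lemma om_pow m : om m ^+ (2 ^ m) = 1.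
Proof. by elim: m => [|m ih]; rewrite ?om0 ?expr1n // expnS exprM om_sqr. Qed.
Lemma om_half m : om m.+1 ^+ (2 ^ m) = -1.
Proof. by elim: m => [|m ih]; rewrite ?expr1 ?om1 // expnS exprM om_sqr. Qed.

(** The difference is the weight that [edge_ksum] attaches to the mean of a boundary sum; here it is
    seen to be no smaller than the mesh. By w^2 - w^-2 = (w - w^-1) (w + w^-1), whose last factor is
    at most 2, it at most halves from one order to the next. *)
Lemma om_gap m : 2 * hp m <= rn (om m.+2 - (om m.+2)^-1).
Proof.
elim: m => [|m ih].
  rewrite hp0 mulr1; have o2 : om 2 * om 2 = -1 by rewrite -expr2 om_sqr om1.
  have -> : (om 2)^-1 = - om 2.
    by apply: (mulfI (om_neq0 2)); rewrite divff ?om_neq0 // mulrN o2 opprK.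
  rewrite (_ : _ - _ = 2%:R * om 2); last by ring.
  by rewrite rnM rn_om rn_nat mulr1.
rewrite hpS; set w := om m.+3.
have h : om m.+2 - (om m.+2)^-1 = (w - w^-1) * (w + w^-1).
  by rewrite -om_sqr -/w; field; exact: om_neq0.
rewrite h rnM in ih.
have h2 : rn (w + w^-1) <= 2.
  by apply: le_trans (rnD _ _) _; rewrite rnV rn_om; lra.
have := rn_ge0 (w - w^-1); have := rn_ge0 (w + w^-1); nra.
Qed.

Lemma sum_pow2S (V : zmodType) (F : nat -> V) m :
  \sum_(k < 2 ^ m.+1) F k = \sum_(k < 2 ^ m) (F k + F (2 ^ m + k)%N).
Proof.
rewrite -!(big_mkord xpredT) big_split /= expnS mul2n -addnn.
rewrite (@big_cat_nat _ _ _ (2 ^ m)) ?leq_addr //=; congr (_ + _); first by rewrite big_mkord.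
rewrite -{1}(add0n (2 ^ m)%N) big_addn addnK.
by rewrite big_mkord; apply: eq_bigr => k _; rewrite addnC.
Qed.

(** Opposite roots are paired: w / (w - x) + w / (w + x) = 2 w^2 / (w^2 - x^2), which reduces the
    sum to half the order with [x] squared. *)
Lemma kernel_mean m (x : C) : rn x < 1 ->
  \sum_(k < 2 ^ m) (om m ^+ k / (om m ^+ k - x)) = 2 ^+ m / (1 - x ^+ (2 ^ m)).
Proof.
elim: m x => [|m ih] x x1.
  by rewrite expn0 big_ord1 !expr0 expr1.
have ne (y : C) w : rn y = 1 -> rn w < 1 -> y - w != 0.
  by move=> hy hw; apply/eqP => /subr0_eq h; move: hw; rewrite -h hy; lra.
rewrite (sum_pow2S (fun k => om m.+1 ^+ k / (om m.+1 ^+ k - x))).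
transitivity (\sum_(k < 2 ^ m) 2 * (om m ^+ k / (om m ^+ k - x ^+ 2))).
  apply: eq_bigr => k _; rewrite exprD om_half -(om_sqr m) -exprM mulnC exprM.
  have rk : rn (om m.+1 ^+ k) = 1 by rewrite rnX rn_om expr1n.
  have n1 := ne _ _ rk x1; have n2 : om m.+1 ^+ k + x != 0.
    by rewrite -[x]opprK ne // rnN.
  have n3 : (om m.+1 ^+ k) ^+ 2 - x ^+ 2 != 0 by rewrite subr_sqr mulf_neq0.
  field; rewrite n1 n3 /= andbT.
  by rewrite mulN1r -opprD oppr_eq0.
rewrite -mulr_sumr ih; last first.
  by rewrite rnX; have := rn_ge0 x; nra.
by rewrite -exprM -expnS mulrA -exprS.
Qed.
Lemma pow2_hp m : 2 ^+ m * hp m = 1.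
Proof. by rewrite /hp exprVn mulfV // expf_neq0. Qed.

(** * Cauchy's formula through means over roots of unity *)

Section CauchyKernel.
Variables (V : normedModType C) (g : C -> V).
Hypothesis gd : forall p, cdiff g p.

Lemma cdiff_lip p : exists2 K : RR, 0 < K & exists2 d : RR, 0 < d &
  forall w, rn (w - p) < d -> rn (g w - g p) <= K * rn (w - p).
Proof.
have [D hD] := gd p; have [d d0 hd] := hD 1 ltr01.
exists (1 + rn D); first by have := rn_ge0 D; lra.
exists d => // w hw; have := hd w hw.
rewrite mul1r => h; rewrite mulrDl mul1r.
rewrite -[g w - g p](subrK ((w - p) *: D)).
by apply: le_trans (rnD _ _) _; rewrite rnZ (mulrC (rn D)) lerD2r.
Qed.

Lemma cdiff_quot b p : p != b -> cdiff (fun w => (w - b)^-1 *: g w) p.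
Proof.
move=> pb; have [D hD] := gd p; set u := (p - b)^-1.
have pb0 : p - b != 0 by rewrite subr_eq0.
have u0 : 0 < rn u by apply: rn_gt0; rewrite invr_eq0.
exists (u *: D - u ^+ 2 *: g p) => e e0.
have [d d0 hd] := hD (e / (4 * rn u)) ltac:(by rewrite divr_gt0 // mulr_gt0).
set K := 2 * rn u ^+ 2 * rn D + 2 * rn u ^+ 3 * rn (g p).
have K0 : 0 <= K.
  by rewrite addr_ge0 // !mulr_ge0 ?exprn_ge0 ?rn_ge0 // ltW.
(* The first bound is for the remainder of [g]; the second keeps [w] at least half as far from [b]
   as [p] is, so that [v] is at most twice [u]; the third absorbs the terms quadratic in [w - p]. *)
exists (Num.min d (Num.min ((rn u)^-1 / 2) (e / (2 * (K + 1))))).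
  by rewrite !lt_min d0 !divr_gt0 ?invr_gt0 //; lra.
move=> w; rewrite !lt_min => /andP[w1 /andP[w2 w3]].
have ru : rn (p - b) = (rn u)^-1 by rewrite rnV invrK.
have wb : (rn u)^-1 / 2 <= rn (w - b).
  by have := rn_tri w p b; rewrite ru rnB; lra.
have rui : 0 < (rn u)^-1 by rewrite invr_gt0.
have wb0 : w - b != 0 by apply/eqP => h; move: wb; rewrite h rn0; lra.
set v := (w - b)^-1.
have rv : rn v <= 2 * rn u.
  rewrite rnV -[2 * rn u]invrK lef_pV2 ?posrE ?invr_gt0 ?mulr_gt0 //; last lra.
  by rewrite invfM mulrC.
rewrite (_ : _ - _ = v *: (g w - g p - (w - p) *: D)
    - ((w - p) ^+ 2 * u * v) *: D + ((w - p) ^+ 2 * u ^+ 2 * v) *: g p); last first.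
  by module_core (GRing.PzRing.sort (C : pzRingType)); rewrite /u /v; field; rewrite ?wb0 ?pb0.
have {}hd := hd w w1.
set x := rn (w - p) in w1 w2 w3 hd *; have x0 : 0 <= x by exact: rn_ge0.
have rv0 := rn_ge0 v.
have a1 : rn (v *: (g w - g p - (w - p) *: D)) <= e / 2 * x.
  rewrite rnZ; apply: le_trans (ler_pM rv0 (rn_ge0 _) rv hd) _.
  by rewrite le_eqVlt; apply/orP; left; apply/eqP; field; lra.
have a2 : rn (((w - p) ^+ 2 * u * v) *: D) <= x * (x * (2 * rn u ^+ 2 * rn D)).
  rewrite rnZ !rnM -/x (_ : x * (x * _) = x * x * rn u * (2 * rn u) * rn D); last by ring.
  by apply: ler_wpM2r; [exact: rn_ge0 | apply: ler_wpM2l => //; rewrite !mulr_ge0 // ltW].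
have a3 : rn (((w - p) ^+ 2 * u ^+ 2 * v) *: g p) <= x * (x * (2 * rn u ^+ 3 * rn (g p))).
  rewrite rnZ !rnM -/x (_ : x * (x * _) = x * x * (rn u * rn u) * (2 * rn u) * rn (g p)); last by ring.
  by apply: ler_wpM2r; [exact: rn_ge0 | apply: ler_wpM2l => //; rewrite !mulr_ge0 // ltW].
have a4 : x * K <= e / 2.
  move: w3; rewrite ltr_pdivlMr; last lra.
  by nra.
apply: le_trans (rnD _ _) _.
have := rnBD (v *: (g w - g p - (w - p) *: D)) (((w - p) ^+ 2 * u * v) *: D).
have : x * (x * (2 * rn u ^+ 2 * rn D)) + x * (x * (2 * rn u ^+ 3 * rn (g p))) = x * (x * K).
  by rewrite /K; ring.
have : x * (x * K) <= x * (e / 2) by apply: ler_wpM2l.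
lra.
Qed.

Lemma edge_sum (H : C -> V) (gam : RR -> C) m a h : edge H gam m a h =
  \sum_(k < 2 ^ m) trap H (gam (a + k%:R * (h * hp m))) (gam (a + k.+1%:R * (h * hp m))).
Proof.
elim: m a h => [|m ih] a h /=.
  by rewrite expn0 big_ord1 hp0 !mulr1 mul0r mul1r addr0.
rewrite !ih (sum_pow2S (fun k => trap H (gam (a + k%:R * (h * hp m.+1)))
  (gam (a + k.+1%:R * (h * hp m.+1))))) -big_split /=; apply: eq_bigr => k _.
have e (j : nat) : (2 ^ m + j)%:R * (h * hp m.+1) = h / 2 + j%:R * (h / 2 * hp m).
  rewrite natrD natrX hpS mulrDl; congr (_ + _); last by ring.
  rewrite (_ : _ * _ = h / 2 * (2 ^+ m * hp m)); last by ring.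
  by rewrite pow2_hp mulr1.
rewrite -addnS !e !addrA.
by rewrite hpS (_ : h / 2 * hp m = h * (hp m / 2)) //; ring.
Qed.

Variables (b : C) (R : RR).
Hypothesis bR : rn b < R.
Let R0 : 0 < R. Proof. exact: le_lt_trans (rn_ge0 b) bR. Qed.

(** After multiplication by [hp m], the discrete Cauchy integral of [g] at [b] over the circle of
    radius [R] shrunk towards [b] by the ratio [u]. The kernel w / (w - b) does not change under
    shrinking. *)
Definition ksum (m : nat) (u : RR) : V :=
  \sum_(k < 2 ^ m) (cR R * om m ^+ k / (cR R * om m ^+ k - b)) *:
    g (b + cR u * (cR R * om m ^+ k - b)).

(** A homotopy in [s] from the circle shrunk towards [b] by the ratio [tau] to the circle itself;
    [t] is the angle. *)
Definition cone (tau s t : RR) : C :=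
  b + cR (tau + (1 - tau) * s) * (cR R * cis (pi *+ 2 * t) - b).

Lemma rnR_cis t : rn (cR R * cis t) = R.
Proof. by rewrite rnM rn_cis rn_cR mulr1 gtr0_norm. Qed.
Lemma R_cis_neq t : cR R * cis t - b != 0.
Proof. by apply/eqP => /subr0_eq h; have := rnR_cis t; rewrite h => e; move: bR; rewrite e ltxx. Qed.
Lemma om_cis m k : om m ^+ k = cis (pi *+ 2 * (k%:R * hp m)).
Proof. by rewrite /om cisX -mulr_natl; congr cis; ring. Qed.

(** An exact identity: on a closed polygon the trapezoid rule weighs each vertex by the next vertex
    minus the previous one, here a multiple of ω - ω^-1. The summand [G] belongs to the far end of a
    piece, and its index is shifted around the circle. *)
Lemma edge_ksum m u : 0 < u ->
  edge (fun w => (w - b)^-1 *: g w) (fun t => b + cR u * (cR R * cis (pi *+ 2 * t) - b)) m 0 1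
  = (om m - (om m)^-1) *: ksum m u.
Proof.
move=> u0; rewrite edge_sum.
pose a k : C := b + cR u * (cR R * om m ^+ k - b).
pose H (w : C) := (w - b)^-1 *: g w.
transitivity (\sum_(k < 2 ^ m) trap H (a k) (a k.+1)).
  by apply: eq_bigr => k _; rewrite /a !om_cis !add0r !mul1r.
pose G k := (cR u * cR R * om m ^+ k * (1 - (om m)^-1)) *: H (a k).
transitivity (\sum_(k < 2 ^ m) ((cR u * cR R * om m ^+ k * (om m - 1)) *: H (a k) + G k.+1)).
  apply: eq_bigr => k _; rewrite /trap /G scalerDr; congr (_ *: _ + _ *: _).
    by rewrite /a exprS; ring.
  by rewrite /a exprS; field; exact: om_neq0.
have -> : \sum_(k < 2 ^ m) ((cR u * cR R * om m ^+ k * (om m - 1)) *: H (a k) + G k.+1) =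
   \sum_(k < 2 ^ m) ((cR u * cR R * om m ^+ k * (om m - 1)) *: H (a k) + G k).
  rewrite !big_split /=; congr (_ + _).
  have : \sum_(k < (2 ^ m).+1) G k = \sum_(k < (2 ^ m).+1) G k by [].
  rewrite {1}big_ord_recl big_ord_recr /=.
  rewrite (_ : G (2 ^ m)%N = G 0%N); last by rewrite /G /a om_pow expr0.
  by move=> h; apply: (addrI (G 0%N)); rewrite [RHS]addrC -h.
rewrite /ksum scaler_sumr; apply: eq_bigr => k _.
rewrite /G -scalerDl /H /a !scalerA; congr (_ *: _).
have n1 : cR R * om m ^+ k - b != 0 by rewrite om_cis R_cis_neq.
have n2 : cR u != 0 by rewrite -cR0 (inj_eq cR_inj) gt_eqF.
rewrite (addrC b) addrK; field.
by rewrite om_neq0 n1 n2.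
Qed.

(** Goursat's lemma on the cone. Its two radial edges coincide, because the angles 0 and 2π do, and
    cancel; the two circles remain. *)
Lemma ksum_cone (tau : RR) : 0 < tau <= 1 -> forall e : RR, 0 < e ->
  exists m0, forall m, (m0 <= m)%N -> rn (cR (hp m) *: (ksum m 1 - ksum m tau)) <= e.
Proof.
move=> /andP[t0 t1] e e0.
pose H (w : C) := (w - b)^-1 *: g w.
have inner (s : RR) : 0 <= s <= 1 -> 0 < tau + (1 - tau) * s <= 1.
  move=> /andP[s0 s1]; apply/andP; split; nra.
have [m0 hm] : exists m0, forall m, (m0 <= m)%N -> rn (bdry H (cone tau) m 0 0 1) <= e.
  apply: (@goursat _ H (cone tau) (2 * R + 2 * R * (2 * `|pi *+ 2|))) => //.
    move=> s t s' t' hs ht hs' ht'.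
    rewrite /cone; set u := tau + _ * s; set u' := tau + _ * s'.
    rewrite (_ : _ - _ = (cR u - cR u') * (cR R * cis (pi *+ 2 * t) - b) +
       cR u' * (cR R * (cis (pi *+ 2 * t) - cis (pi *+ 2 * t')))); last by ring.
    apply: le_trans (rnD _ _) _.
    have a1 : rn ((cR u - cR u') * (cR R * cis (pi *+ 2 * t) - b)) <= `|s - s'| * (2 * R).
      rewrite rnM -cRB rn_cR; apply: ler_pM => //; first exact: rn_ge0.
        rewrite /u /u' (_ : _ - _ = (1 - tau) * (s - s')); last by ring.
        by rewrite normrM ger0_norm ?ler_piMl //; lra.
      by apply: le_trans (rnBD _ _) _; rewrite rnR_cis; move: bR; lra.
    have a2 : rn (cR u' * (cR R * (cis (pi *+ 2 * t) - cis (pi *+ 2 * t')))) <=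
        R * (2 * (`|pi *+ 2| * `|t - t'|)).
      have /andP[u0 u1] := inner _ hs'; rewrite -/u' in u0 u1.
      rewrite rnM rnM !rn_cR (gtr0_norm R0) (gtr0_norm u0).
      rewrite -[leRHS]mul1r; apply: ler_pM => //; first exact: ltW.
        by rewrite mulr_ge0 ?rn_ge0 // ltW.
      apply: ler_wpM2l; first exact: ltW.
      by apply: le_trans (cis_lip _ _) _; rewrite -mulrBr normrM.
    apply: le_trans (lerD a1 a2) _.
    have := normr_ge0 (s - s'); have := normr_ge0 (t - t').
    have := normr_ge0 (pi *+ 2 : RR); set P := `|_ *+ 2|; set S := `|s - s'|.
    set T := `|t - t'|; move=> P0 T0 S0.
    rewrite -subr_ge0 (_ : _ - _ = 2 * R * T + 4 * (R * (P * S)) + 2 * (R * (P * T)));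
      last by ring.
    by rewrite !addr_ge0 // !mulr_ge0 // ltW.
  move=> s t hs ht; apply: cdiff_quot; rewrite -subr_eq0 /cone addrC addKr.
  rewrite mulf_neq0 ?R_cis_neq // -cR0 (inj_eq cR_inj) gt_eqF //.
  by have /andP[] := inner _ hs.
(* The shift by 2 is that of [om_gap], which allows division by the weight of the two circles. *)
exists (m0 + 2)%N => m hmm; have {hm} := hm m ltac:(lia).
have -> : bdry H (cone tau) m 0 0 1 = (om m - (om m)^-1) *: (ksum m 1 - ksum m tau).
  rewrite /bdry !add0r scalerBr -!edge_ksum //.
  have -> : cone tau ^~ 1 = cone tau ^~ 0.
    by apply/funext => s; rewrite /cone mulr1 mulr0 cis0 /cis cos2pi sin2pi.
  rewrite [X in X - _ - _]addrC addrK; congr (edge _ _ _ _ _ - edge _ _ _ _ _);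
    apply/funext => t; rewrite /cone; congr (_ + cR _ * _); lra.
rewrite !rnZ rn_cR gtr0_norm ?hp_gt0 //; apply: le_trans.
apply: ler_wpM2r; first exact: rn_ge0.
have [k ->] : exists k, m = k.+2 by exists (m - 2)%N; lia.
apply: le_trans _ (om_gap k); rewrite !hpS; have := hp_gt0 k; lra.
Qed.

(** Three errors, each at most [e / 3]: moving the circle to the ratio [tau], replacing [g] there by
    its value at [b], and replacing the mean of the kernel by 1. *)
Lemma ksum_mean (e : RR) : 0 < e ->
  exists m0, forall m, (m0 <= m)%N -> rn (cR (hp m) *: ksum m 1 - g b) <= e.
Proof.
move=> e0; set K := R / (R - rn b).
have Rb : 0 < R - rn b by rewrite subr_gt0.
have K0 : 0 < K by rewrite divr_gt0.
have [L L0 [d d0 hL]] := cdiff_lip b.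
have R2 : 0 < 2 * R by rewrite mulr_gt0.
(* Points of the small circle are within [tau * (2 * R)] of [b]: the second bound brings them into
   the range of the Lipschitz estimate, the third makes [L] times this distance times the bound [K]
   of the kernel at most [e / 3]. *)
pose tau := Num.min 1 (Num.min (d / (2 * (2 * R))) (e / 3 / K / (L * (2 * R)))).
have tau0 : 0 < tau by rewrite !lt_min ltr01 !divr_gt0 // !mulr_gt0.
have tau1 : tau <= 1 by rewrite ge_min lexx.
have e3 : 0 < e / 3 by rewrite divr_gt0.
have [m1 h1] := ksum_cone (introT andP (conj tau0 tau1)) e3.
pose x := b / cR R.
have cR_neq0 : cR R != 0 by rewrite -cR0 (inj_eq cR_inj) gt_eqF.
have x1 : rn x < 1 by rewrite rnM rnV rn_cR gtr0_norm // ltr_pdivrMr // mul1r.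
have [m2 h2] : exists m2, forall m, (m2 <= m)%N ->
   rn (((1 - x ^+ (2 ^ m))^-1 - 1) *: g b) <= e / 3.
  pose D := 2 * (rn (g b) + 1); have gb0 := rn_ge0 (g b).
  have D0 : 0 < D by rewrite /D; lra.
  have eD : 0 < Num.min 2^-1 (e / 3 / D) by rewrite lt_min invr_gt0 divr_gt0 //; lra.
  have : `|rn x| < 1 by rewrite ger0_norm // rn_ge0.
  move=> /cvg_expr /cvgrPdist_lt /(_ _ eD) [n _ hn].
  exists n => m nm; have := hn (2 ^ m)%N; rewrite /= => /(_ _).
  rewrite sub0r normrN ger0_norm ?exprn_ge0 ?rn_ge0 // -rnX lt_min.
  set y := x ^+ _; move=> /(_ _) /andP[]; first by apply: leq_trans nm (ltnW (ltn_expl _ _)).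
  move=> y1 y2.
  have y3 : 2^-1 <= rn (1 - y) by have := rn_leB (1 : C) y; rewrite rn1; lra.
  have y4 : 1 - y != 0 by apply/eqP => h; move: y3; rewrite h rn0; lra.
  rewrite (_ : _ - 1 = y / (1 - y)); last by field.
  rewrite rnZ rnM rnV.
  have y5 : (rn (1 - y))^-1 <= 2.
    by rewrite -[2]invrK lef_pV2 ?posrE //; lra.
  move: y2; rewrite ltr_pdivlMr // /D => y2.
  have y6 : rn y / rn (1 - y) <= rn y * 2 by apply: ler_wpM2l => //; exact: rn_ge0.
  have := rn_ge0 y; have := ler_wpM2r gb0 y6; nra.
exists (maxn m1 m2) => m; rewrite geq_max => /andP[/h1 {}h1 /h2 {}h2].
have knorm k : rn (cR R * om m ^+ k / (cR R * om m ^+ k - b)) <= K.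
  rewrite rnM rnV om_cis rnR_cis ler_pM2l // lef_pV2 ?posrE //.
    by have := rn_leB (cR R * cis (pi *+ 2 * (k%:R * hp m))) b; rewrite rnR_cis.
  by rewrite rn_gt0 // R_cis_neq.
have kmean : cR (hp m) * \sum_(k < 2 ^ m) (cR R * om m ^+ k / (cR R * om m ^+ k - b))
   = (1 - x ^+ (2 ^ m))^-1.
  rewrite (eq_bigr (fun k : 'I_ _ => om m ^+ k / (om m ^+ k - x))); last first.
    move=> k _; have -> : cR R * om m ^+ k - b = cR R * (om m ^+ k - x).
      by rewrite mulrBr /x mulrCA divff // mulr1.
    by rewrite -mulf_div divff // mul1r.
  rewrite kernel_mean // mulrA (_ : cR (hp m) * _ = 1) ?mul1r //.
  rewrite (_ : 2 ^+ m = cR (2 ^+ m)); last by rewrite /cR rmorphXn /= rmorph_nat.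
  by rewrite -cRM mulrC pow2_hp.
rewrite (_ : _ - _ = cR (hp m) *: (ksum m 1 - ksum m tau)
   + cR (hp m) *: (ksum m tau - (\sum_(k < 2 ^ m) (cR R * om m ^+ k / (cR R * om m ^+ k - b))) *: g b)
   + ((1 - x ^+ (2 ^ m))^-1 - 1) *: g b); last first.
  rewrite -kmean; module.
have h3 : rn (cR (hp m) *: (ksum m tau -
    (\sum_(k < 2 ^ m) (cR R * om m ^+ k / (cR R * om m ^+ k - b))) *: g b)) <= e / 3.
  rewrite rnZ rn_cR gtr0_norm ?hp_gt0 // scaler_suml -sumrB.
  have : rn (\sum_(k < 2 ^ m)
     ((cR R * om m ^+ k / (cR R * om m ^+ k - b)) *: g (b + cR tau * (cR R * om m ^+ k - b))
      - (cR R * om m ^+ k / (cR R * om m ^+ k - b)) *: g b)) <= \sum_(k < 2 ^ m) (e / 3).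
    apply: le_trans (rn_sum _ _ _) _; apply: ler_sum => k _.
    rewrite -scalerBr rnZ.
    have w1 : rn (b + cR tau * (cR R * om m ^+ k - b) - b) <= tau * (2 * R).
      rewrite addrAC subrr add0r rnM rn_cR gtr0_norm // ler_pM2l //.
      apply: le_trans (rnBD _ _) _; rewrite om_cis rnR_cis.
      by move: bR; lra.
    have t1 : tau <= d / (2 * (2 * R)) by rewrite !ge_min lexx orbT.
    have t2 : tau <= e / 3 / K / (L * (2 * R)) by rewrite !ge_min lexx !orbT.
    rewrite ler_pdivlMr ?mulr_gt0 // in t1.
    rewrite ler_pdivlMr ?mulr_gt0 // ler_pdivlMr // in t2.
    have tR : 0 < tau * (2 * R) by rewrite mulr_gt0.
    have td : tau * (2 * R) < d by lra.
    have w2 := hL _ (le_lt_trans w1 td).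
    apply: le_trans (ler_pM (rn_ge0 _) (rn_ge0 _) (knorm k) w2) _.
    have : L * rn (b + cR tau * (cR R * om m ^+ k - b) - b) <= L * (tau * (2 * R)).
      by apply: ler_wpM2l => //; exact: ltW.
    move=> w3; apply: le_trans (ler_wpM2l (ltW K0) w3) _; apply: le_trans t2.
    by rewrite le_eqVlt; apply/orP; left; apply/eqP; ring.
  rewrite (_ : \sum_(k < 2 ^ m) e / 3 = 2 ^+ m * (e / 3)); last first.
    by rewrite sumr_const card_ord -natrX mulr_natl.
  move=> w.
  apply: le_trans (ler_wpM2l (ltW (hp_gt0 m)) w) _.
  by rewrite [leLHS]mulrA (mulrC (hp m)) pow2_hp mul1r.
have := rnD (cR (hp m) *: (ksum m 1 - ksum m tau)) (cR (hp m) *: (ksum m tau -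
    (\sum_(k < 2 ^ m) (cR R * om m ^+ k / (cR R * om m ^+ k - b))) *: g b)).
move=> h4; apply: le_trans (rnD _ _) _; lra.
Qed.
End CauchyKernel.

(** The means for all points [b j] use the same nodes on the circle, so cancellation between the
    kernels carries over to the combination of the values of [g]. *)
Lemma cauchy_kernel (V : normedModType C) (g : C -> V) (R M k : RR) (n : nat)
    (c b : 'I_n -> C) :
  (forall p, cdiff g p) -> 0 <= M -> (forall j, rn (b j) < R) ->
  (forall w : C, rn w = R -> rn (g w) <= M) ->
  (forall w : C, rn w = R -> rn (\sum_(j < n) c j * (w / (w - b j))) <= k) ->
  0 < R -> rn (\sum_(j < n) c j *: g (b j)) <= k * M.
Proof.
move=> gd M0 bR gM hk R0.
apply/ler_addgt0Pr => e e0.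
set S := \sum_(j < n) rn (c j).
have S0 : 0 <= S by apply: sumr_ge0 => j _; exact: rn_ge0.
have eS : 0 < e / (S + 1) by rewrite divr_gt0 //; lra.
have /choice [m0 hm0] : forall j, exists m0, forall m, (m0 <= m)%N ->
    rn (cR (hp m) *: ksum g (b j) R m 1 - g (b j)) <= e / (S + 1).
  by move=> j; apply: ksum_mean.
pose m := \max_(j < n) m0 j.
have hm j : rn (g (b j) - cR (hp m) *: ksum g (b j) R m 1) <= e / (S + 1).
  by rewrite rnB; apply: hm0; exact: leq_bigmax.
rewrite (_ : \sum_(j < n) _ =
  cR (hp m) *: \sum_(j < n) c j *: ksum g (b j) R m 1 +
  \sum_(j < n) c j *: (g (b j) - cR (hp m) *: ksum g (b j) R m 1)); last first.
  rewrite scaler_sumr -big_split /=; apply: eq_bigr => j _; module.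
apply: le_trans (rnD _ _) _; apply: lerD.
  rewrite (_ : \sum_(j < n) _ = \sum_(i < 2 ^ m)
     (\sum_(j < n) c j * (cR R * om m ^+ i / (cR R * om m ^+ i - b j))) *: g (cR R * om m ^+ i)); last first.
    rewrite [RHS](eq_bigr (fun i : 'I_(2 ^ m) => \sum_(j < n)
      (c j * (cR R * om m ^+ i / (cR R * om m ^+ i - b j))) *: g (cR R * om m ^+ i))); last first.
      by move=> i _; rewrite scaler_suml.
    rewrite exchange_big /=; apply: eq_bigr => j _; rewrite /ksum scaler_sumr.
    by apply: eq_bigr => i _; rewrite scalerA cR1 mul1r (addrC (b j)) subrK.
  rewrite rnZ rn_cR gtr0_norm ?hp_gt0 //.
  rewrite -[leRHS]mul1r -(pow2_hp m) (mulrC (2 ^+ m)) -mulrA.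
  apply: ler_wpM2l; first exact/ltW/hp_gt0.
  apply: le_trans (rn_sum _ _ _) _.
  rewrite (_ : 2 ^+ m * (k * M) = \sum_(i < 2 ^ m) k * M); last first.
    by rewrite sumr_const card_ord -natrX mulr_natl.
  apply: ler_sum => i _.
  have ri : rn (cR R * om m ^+ i) = R by rewrite rnM rn_cR rnX rn_om expr1n mulr1 gtr0_norm.
  by rewrite rnZ; apply: ler_pM; rewrite ?rn_ge0 //; [exact: hk | exact: gM].
apply: le_trans (rn_sum _ _ _) _.
apply: (@le_trans _ _ (\sum_(j < n) rn (c j) * (e / (S + 1)))).
  by apply: ler_sum => j _; rewrite rnZ; apply: ler_wpM2l; rewrite ?rn_ge0.
rewrite -mulr_suml -/S mulrCA ger_pMr // ler_pdivrMr; lra.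
Qed.

(* Second difference estimate: the kernel combination is [b d (b - d) / ((w - b) (w - d))]. *)
Lemma cauchy_diff2 (V : normedModType C) (g : C -> V) (M : RR) (b d : C) :
  (forall p, cdiff g p) -> 0 <= M -> (forall w : C, rn w = 2 -> rn (g w) <= M) ->
  rn b <= 1 -> rn d <= 1 ->
  rn (d *: (g b - g 0) - b *: (g d - g 0)) <= rn b * rn d * rn (b - d) * M.
Proof.
move=> gd M0 gM b1 d1.
have [->|bd] := eqVneq b d; first by rewrite subrr rn0 subrr rn0 mulr0 mul0r.
pose c (j : 'I_3) : C := if j == 0 then d else if j == 1 then - b else b - d.
pose a (j : 'I_3) : C := if j == 0 then b else if j == 1 then d else 0.
have -> : d *: (g b - g 0) - b *: (g d - g 0) = \sum_(j < 3) c j *: g (a j).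
  by rewrite !big_ord_recl big_ord0 /c /a /=; module.
apply: (@cauchy_kernel _ g 2) => //.
  by case=> [[|[|[]]]] //= i; rewrite /a /= ?rn0; lra.
move=> w w2.
have n1 (y : C) : rn y <= 1 -> 1 <= rn (w - y).
  by have := rn_leB w y; rewrite w2; lra.
have n2 (y : C) : rn y <= 1 -> w - y != 0.
  by move=> /n1; apply: contraTneq => ->; rewrite rn0; lra.
have w0 : w != 0 by apply: contraTneq isT => h; move: w2; rewrite h rn0; lra.
rewrite (_ : \sum_(j < 3) _ = b * d * (b - d) / ((w - b) * (w - d))); last first.
  rewrite !big_ord_recl big_ord0 /c /a /= subr0 divff // addr0 mulr1.
  by field; rewrite !n2.
rewrite !rnM rnV rnM.
have := n1 b b1; have := n1 d d1; have := rn_ge0 b; have := rn_ge0 d; have := rn_ge0 (b - d).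
set x := rn (w - b); set y := rn (w - d) => p1 p2 p3 hy hx.
rewrite ler_pdivrMr; last by rewrite mulr_gt0; lra.
have : 1 <= x * y by nra.
have : 0 <= rn b * rn d * rn (b - d) by rewrite !mulr_ge0.
nra.
Qed.

(** Partial fractions. The [c j] extrapolate from the nodes [a j] to the point 1, and the error has
    a kernel in product form, geometrically small where 1 is closer to the nodes than [z] is. *)
Lemma interp_kernel (a : nat -> C) : injective a -> (forall j, a j != 1) ->
  forall N, exists c : nat -> C, forall z, z != 1 -> (forall j, z != a j) ->
    z / (z - 1) * \prod_(j < N) ((1 - a j) / (z - a j)) =
    z / (z - 1) - \sum_(j < N) c j * (z / (z - a j)).
Proof.
move=> ainj a1; elim=> [|N [c hc]].
  by exists (fun=> 0) => z _ _; rewrite !big_ord0 mulr1 subr0.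
pose c' j := c j * (1 - a N) / (a j - a N).
exists (fun j => if (j < N)%N then c' j else 1 - \sum_(j < N) c' j) => z z1 za.
rewrite [in LHS]big_ord_recr /=.
rewrite (mulrA (z / (z - 1))).
rewrite hc // big_ord_recr /= ltnn.
have -> : \sum_(i < N) (if (i < N)%N then c' i else 1 - \sum_(j < N) c' j) * (z / (z - a i))
    = \sum_(i < N) c' i * (z / (z - a i)) by apply: eq_bigr => i _; rewrite ltn_ord.
have n1 : z - 1 != 0 by rewrite subr_eq0.
have nN j : z - a j != 0 by rewrite subr_eq0.
rewrite mulrBl [(1 - \sum_(j < N) c' j) * _]mulrBl mul1r !mulr_suml.
have -> : z / (z - 1) * ((1 - a N) / (z - a N)) = z / (z - 1) - z / (z - a N).
  by field; rewrite n1 nN.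
have -> : \sum_(j < N) c j * (z / (z - a j)) * ((1 - a N) / (z - a N)) =
   \sum_(j < N) (c' j * (z / (z - a j)) - c' j * (z / (z - a N))).
  apply: eq_bigr => j _; have n2 : a j - a N != 0.
    by rewrite subr_eq0 (inj_eq ainj) ltn_eqF.
  by rewrite /c'; field; rewrite n2 !nN.
by rewrite sumrB; ring.
Qed.

(** A quantitative identity principle: values near 0 determine the value at 1. Nodes and
    coefficients are fixed before [V] and [g], so one combination serves all rays through the origin
    at once. *)
Lemma cauchy_small (rho e : RR) : 0 < rho -> 0 < e ->
  exists n (c a : 'I_n -> C), (forall j, rn (a j) <= rho) /\
    forall (V : normedModType C) (g : C -> V) (M : RR), (forall p, cdiff g p) -> 0 <= M ->
      (forall w : C, rn w = 4 -> rn (g w) <= M) ->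
      rn (g 1 - \sum_(j < n) c j *: g (a j)) <= e * M.
Proof.
move=> rho0 e0; pose r := Num.min rho 1.
have r0 : 0 < r by rewrite lt_min rho0 ltr01.
have r1 : r <= 1 by rewrite ge_min lexx orbT.
have rrho : r <= rho by rewrite ge_min lexx.
pose a (j : nat) : C := cR (r / j.+2%:R).
have j2 (j : nat) : (2 : RR) <= j.+2%:R by rewrite ler_nat.
have arn j : rn (a j) = r / j.+2%:R by rewrite rn_cR ger0_norm // divr_ge0 // ltW.
have ahalf j : rn (a j) <= r / 2.
  by rewrite arn ler_pM2l // lef_pV2 ?posrE //; have := j2 j; lra.
have ainj : injective a.
  move=> i j /cR_inj /(mulfI (lt0r_neq0 r0)) /invr_inj /eqP.
  by rewrite eqr_nat => /eqP [].
have a1 j : a j != 1 by apply/eqP => h; have := ahalf j; rewrite h rn1; lra.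
have : `|2 / 3 : RR| < 1 by rewrite ger0_norm; lra.
(* Half of [e], since the remaining factor w / (w - 1) has modulus at most 4/3 on the circle of
   radius 4. *)
have e1 : 0 < e / 2 by lra.
move=> /cvg_expr /cvgrPdist_lt /(_ _ e1) [N _ /(_ N (leqnn N))] /=.
rewrite sub0r normrN ger0_norm => [hN|]; last by rewrite exprn_ge0 //; lra.
have [c hc] := interp_kernel ainj a1 N.
exists N, (fun j => c j), (fun j => a j); split.
  by move=> j; have := ahalf j; lra.
move=> V g M gd M0 gM.
pose b (j : 'I_N.+1) : C := if unlift ord0 j is Some k then a k else 1.
pose d (j : 'I_N.+1) : C := if unlift ord0 j is Some k then - c k else 1.
have -> : g 1 - \sum_(j < N) c j *: g (a j) = \sum_(j < N.+1) d j *: g (b j).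
  rewrite big_ord_recl /d /b unlift_none scale1r -sumrN; congr (_ + _).
  by apply: eq_bigr => j _; rewrite liftK scaleNr.
apply: (@cauchy_kernel _ g 4) => //.
  move=> j; rewrite /b; case: (unlift _ _) => [k|]; last by rewrite rn1; lra.
  by have := ahalf k; lra.
move=> w w4.
have nw (y : C) : rn y <= 1 -> 3 <= rn (w - y).
  by have := rn_leB w y; rewrite w4; lra.
have nw1 (y : C) : rn y <= 1 -> w != y.
  by move=> /nw; apply: contraTneq => ->; rewrite subrr rn0; lra.
have := hc w; rewrite nw1 ?rn1 // => /(_ isT) /(_ _) hw.
have -> : \sum_(j < N.+1) d j * (w / (w - b j)) =
   w / (w - 1) * \prod_(j < N) ((1 - a j) / (w - a j)).
  rewrite hw; last by move=> j; apply: nw1; have := ahalf j; lra.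
  rewrite big_ord_recl /d /b unlift_none mul1r -sumrN; congr (_ + _).
  by apply: eq_bigr => j _; rewrite liftK mulNr.
have p1 : rn (\prod_(j < N) ((1 - a j) / (w - a j))) <= (2 / 3) ^+ N.
  elim: (N) => [|k ih]; first by rewrite big_ord0 rn1.
  rewrite big_ord_recr /= rnM exprSr; apply: ler_pM; rewrite ?rn_ge0 //.
  rewrite rnM rnV; apply: ler_pM; rewrite ?invr_ge0 ?rn_ge0 //.
    by apply: le_trans (rnBD _ _) _; rewrite rn1; have := ahalf k; lra.
  have := nw (a k) ltac:(have := ahalf k; lra) => h.
  by rewrite lef_pV2 ?posrE //; lra.
rewrite rnM (rnM w) rnV w4.
have h3 := nw 1 ltac:(rewrite rn1; lra).
have h4 : (rn (w - 1))^-1 <= 3^-1 by rewrite lef_pV2 ?posrE //; lra.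
have := rn_ge0 (\prod_(j < N) ((1 - a j) / (w - a j))).
have : 0 <= (rn (w - 1))^-1 by rewrite invr_ge0 rn_ge0.
nra.
Qed.

(** * Hahn-Banach theorem *)

Definition seminorm (V : lmodType C) (p : V -> RR) : Prop :=
  (forall x y, p (x + y) <= p x + p y) /\ (forall (a : C) x, p (a *: x) = rn a * p x).

Section HahnBanach.
Variables (V : lmodType C) (p : V -> RR).
Hypothesis pS : seminorm p.

Let pD x y : p (x + y) <= p x + p y. Proof. exact: pS.1. Qed.
Let pZ (a : C) x : p (a *: x) = rn a * p x. Proof. exact: pS.2. Qed.
Let p0 : p 0 = 0. Proof. by rewrite -(scale0r (0 : V)) pZ rn0 mul0r. Qed.
Let p_ge0 x : 0 <= p x.
Proof. by have := pD x (- x); rewrite subrr p0 -scaleN1r pZ rnN rn1 mul1r; lra. Qed.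

(** Partial functionals are given by their graphs, so that chains have unions; single-valuedness
    follows from domination, since [p 0 = 0]. *)
Definition rgraph (G : set (V * RR)) : Prop :=
  (forall (t : RR) x r y s, G (x, r) -> G (y, s) -> G (cR t *: x + y, t * r + s)) /\
  (forall x r, G (x, r) -> r <= p x).

Lemma rgraph_fun G x r s : rgraph G -> G (x, r) -> G (x, s) -> r = s.
Proof.
move=> [Gl Gp] h1 h2; apply: le_anti; apply/andP; split.
  have := Gp _ _ (Gl (-1) _ _ _ _ h2 h1).
  by rewrite (_ : cR _ *: x + x = 0) ?p0; [lra | rewrite /cR rmorphN rmorph1 scaleN1r addNr].
have := Gp _ _ (Gl (-1) _ _ _ _ h1 h2).
by rewrite (_ : cR _ *: x + x = 0) ?p0; [lra | rewrite /cR rmorphN rmorph1 scaleN1r addNr].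
Qed.

Lemma rgraph_step G x0 : rgraph G -> G (0, 0) ->
  exists G', [/\ rgraph G', G `<=` G' & exists r, G' (x0, r)].
Proof.
move=> [Gl Gp] G0.
have G1 x r y s : G (x, r) -> G (y, s) -> G (x + y, r + s).
  by move=> h1 h2; have := Gl 1 _ _ _ _ h1 h2; rewrite cR1 scale1r mul1r.
have GZ t x r : G (x, r) -> G (cR t *: x, t * r).
  by move=> h; have := Gl t _ _ _ _ h G0; rewrite !addr0.
pose S := [set z | exists x r, G (x, r) /\ z = r - p (x - x0)].
have Sub y s : G (y, s) -> ubound S (p (y + x0) - s).
  move=> hy _ [x [r [hx ->]]].
  have := Gp _ _ (G1 _ _ _ _ hx hy); have := pD (x - x0) (y + x0).
  by rewrite addrACA addNr addr0; lra.
have S0 : S !=set0 by exists (0 - p (0 - x0)); exists 0, 0.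
(* The least value at [x0] compatible with domination; [Sub] shows that it does not exceed the upper
   constraints. *)
pose al := sup S.
have al1 x r : G (x, r) -> r - p (x - x0) <= al.
  move=> h; apply: ub_le_sup; last by exists x, r.
  by exists (p (0 + x0) - 0); exact: Sub.
have al2 y s : G (y, s) -> al <= p (y + x0) - s.
  by move=> h; apply: ge_sup => //; exact: Sub.
exists [set u | exists x r t, G (x, r) /\ u = (x + cR t *: x0, r + t * al)].
split; first split.
- move=> t x r y s [x1 [r1 [t1 [h1 [-> ->]]]]] [x2 [r2 [t2 [h2 [-> ->]]]]].
  exists (cR t *: x1 + x2), (t * r1 + r2), (t * t1 + t2); split; first exact: Gl.
  congr pair; last by ring.
  by rewrite cRD cRM; module.
- move=> _ _ [x [r [t [h [-> ->]]]]].
  have [t0|t0|->] := ltgtP t 0.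
  + have h1 := al1 _ _ (GZ (- t^-1) _ _ h).
    have t0' : 0 < - t by lra.
    have e : p (x + cR t *: x0) = - t * p (cR (- t^-1) *: x - x0).
      rewrite -[X in X * _](gtr0_norm t0') -rn_cR -pZ; congr p.
      rewrite scalerBr scalerA -cRM (_ : - t * _ = 1) ?cR1 ?scale1r //; last first.
        by field; lra.
      by rewrite /cR rmorphN /= scaleNr opprK.
    rewrite e; have := ler_wpM2l (ltW t0') h1.
    by rewrite mulrBr mulrA (_ : - t * - t^-1 = 1) ?mul1r; [lra | field; lra].
  + have h1 := al2 _ _ (GZ (t^-1) _ _ h).
    have e : p (x + cR t *: x0) = t * p (cR (t^-1) *: x + x0).
      rewrite -[X in X * _](gtr0_norm t0) -rn_cR -pZ; congr p.
      by rewrite scalerDr scalerA -cRM divff ?cR1 ?scale1r ?gt_eqF.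
    rewrite e; have := ler_wpM2l (ltW t0) h1.
    by rewrite mulrBr mulrA divff ?gt_eqF // mul1r; lra.
  + by rewrite cR0 scale0r mul0r !addr0; exact: Gp.
- move=> [x r] h; exists x, r, 0; split => //.
  by rewrite cR0 scale0r mul0r !addr0.
- exists (0 + 1 * al); exists 0, 0, 1; split => //.
  by rewrite cR1 scale1r !add0r.
Qed.

Lemma real_hahn_banach G0 : rgraph G0 -> G0 (0, 0) ->
  exists U : V -> RR, [/\ (forall (t : RR) x y, U (cR t *: x + y) = t * U x + U y),
     (forall x, U x <= p x) & (forall x r, G0 (x, r) -> U x = r)].
Proof.
move=> g0 g00.
(* [G0] is added to every member so that the empty chain has a union with the property as well. *)
pose P (G : set (V * RR)) := rgraph (G0 `|` G).
have [|A [PA Amax]] := @Zorn_bigcup _ P.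
  move=> F FP tot; split.
    move=> t x r y s hx hy.
    have [H1 [H1P h1]] : exists H, (H = set0 \/ F H) /\ (G0 `|` H) (x, r).
      case: hx => [h|[H FH h]]; last by exists H; split; right.
      by exists set0; split; left.
    have [H2 [H2P h2]] : exists H, (H = set0 \/ F H) /\ (G0 `|` H) (y, s).
      case: hy => [h|[H FH h]]; last by exists H; split; right.
      by exists set0; split; left.
    have [H [HP h3 h4]] : exists H, [/\ (H = set0 \/ F H), (G0 `|` H) (x, r) & (G0 `|` H) (y, s)].
      case: H1P h1 => [->|F1] h1.
        by exists H2; split => //; case: h1 => // h1; left.
      case: H2P h2 => [->|F2] h2.
        by exists H1; split; [right | | case: h2 => // h2; left].
      case: (tot _ _ F1 F2) => sub.
        by exists H2; split; [right | case: h1 => h1; [left | right; exact: sub] |].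
      by exists H1; split; [right | | case: h2 => h2; [left | right; exact: sub]].
    have : rgraph (G0 `|` H) by case: HP => [->|/FP //]; rewrite setU0.
    move=> [/(_ t _ _ _ _ h3 h4) h5 _]; case: HP h5 => [->|FH] [h|h]; try by left.
    by right; exists H.
  move=> x r [h|[H FH h]]; first exact: g0.2.
  by apply: (FP _ FH).2; right.
pose G := G0 `|` A.
have tot x : exists r, G (x, r).
  apply: contrapT => hn.
  have [G' [G'r GG' [r hr]]] := @rgraph_step G x PA (or_introl g00).
  apply: (Amax G').
    split; first by move=> u hu; apply: GG'; right.
    by move=> h; apply: hn; exists r; right; exact: h.
  rewrite /P (_ : G0 `|` G' = G') //; apply/setUidPr => u hu.
  by apply: GG'; left.
have [U hU] := choice tot.
exists U; split.
- move=> t x y; apply: (@rgraph_fun G (cR t *: x + y)) => //.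
  exact: (PA.1 t _ _ _ _ (hU x) (hU y)).
- by move=> x; apply: PA.2; exact: hU.
- by move=> x r h; apply: (@rgraph_fun G x) => //; left.
Qed.

Lemma hahn_banach (M : set V) (f : V -> C) : M 0 ->
  (forall (a : C) x y, M x -> M y -> M (a *: x + y)) ->
  (forall (a : C) x y, M x -> M y -> f (a *: x + y) = a * f x + f y) ->
  (forall x, M x -> rn (f x) <= p x) ->
  exists F : V -> C, [/\ (forall (a : C) x y, F (a *: x + y) = a * F x + F y),
    (forall x, rn (F x) <= p x) & (forall x, M x -> F x = f x)].
Proof.
move=> M0 Ml fl fp.
have Re_le (z : C) : complex.Re z <= rn z.
  rewrite /rn normc_def /=; apply: le_trans (ler_norm _) _.
  by rewrite -sqrtr_sqr ler_wsqrtr // lerDl sqr_ge0.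
have f0 : f 0 = 0.
  have := fl (-1) 0 0 M0 M0; rewrite scaler0 addr0 mulN1r => /eqP.
  by rewrite addNr => /eqP.
have [||U [Ul Up Uf]] := @real_hahn_banach [set u | M u.1 /\ u.2 = complex.Re (f u.1)].
- split=> [t x r y s [/= hx ->] [/= hy ->]|x r [/= hx ->]]; last first.
    by apply: le_trans (Re_le _) _; exact: fp.
  split => /=; first exact: Ml.
  by rewrite fl //; case: (f x) => a b; case: (f y) => c d /=; ring.
- by split => //=; rewrite f0.
pose ii : C := 'i%C.
have ii2 : ii * ii = -1 by rewrite -expr2 sqr_i.
have UD x y : U (x + y) = U x + U y.
  by have := Ul 1 x y; rewrite cR1 scale1r mul1r.
have U0 : U 0 = 0 by have := UD 0 0; rewrite addr0; lra.
have UZ t x : U (cR t *: x) = t * U x by have := Ul t x 0; rewrite U0 !addr0.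
have UN x : U (- x) = - U x by have := UZ (-1) x; rewrite /cR rmorphN rmorph1 scaleN1r mulN1r.
pose F x : C := (U x +i* - U (ii *: x))%C.
have FE x : F x = cR (U x) - ii * cR (U (ii *: x)).
  by rewrite /F [LHS]complexE /= /cR rmorphN mulrN.
have Fl a x y : F (a *: x + y) = a * F x + F y.
  have ea : a = cR (complex.Re a) + ii * cR (complex.Im a) by rewrite [LHS]complexE.
  rewrite !FE; set s := complex.Re a in ea *; set t := complex.Im a in ea *.
  have -> : U (a *: x + y) = s * U x + t * U (ii *: x) + U y.
    by rewrite -!UZ -!UD; congr U; rewrite ea; module.
  have -> : U (ii *: (a *: x + y)) = s * U (ii *: x) - t * U x + U (ii *: y).
    rewrite -!UZ -UN -!UD; congr U.
    by rewrite ea !scalerDr !scalerA; module_core (GRing.PzRing.sort (C : pzRingType));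
      try ring; rewrite !mulrDr mulrA ii2; ring.
  rewrite ea; apply/eqP; rewrite eq_complex /cR /ii /=.
  by apply/andP; split; apply/eqP; ring.
exists F; split => //.
- move=> x; have [->|Fx] := eqVneq (F x) 0; first by rewrite rn0.
  pose a : C := cR (rn (F x)) / F x.
  have ra : rn a = 1.
    by rewrite rnM rnV rn_cR ger0_norm ?rn_ge0 // divff // gt_eqF // rn_gt0.
  have : F (a *: x) = cR (rn (F x)).
    have F0 : F 0 = 0 by rewrite /F scaler0 U0 oppr0.
    by have := Fl a x 0; rewrite F0 !addr0 /a divfK.
  move=> /(congr1 (@complex.Re _)) /= <-.
  by apply: le_trans (Up _) _; rewrite pZ ra mul1r.
- move=> x hx; have hix : M (ii *: x) by have := Ml ii x 0 hx M0; rewrite addr0.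
  rewrite FE (Uf x (complex.Re (f x))) // (Uf (ii *: x) (complex.Re (f (ii *: x)))) //.
  have -> : f (ii *: x) = ii * f x by have := fl ii x 0 hx M0; rewrite f0 !addr0.
  apply/eqP; rewrite eq_complex /cR /ii; case: (f x) => c d /=.
  by apply/andP; split; apply/eqP; ring.
Qed.

(** On the sum of the line of [a] and [M] the functional sends [c *: a + m] to [c] times [lam];
    after division by [c] its domination is the distance hypothesis, which also keeps [a] out of
    [M]. *)
Lemma hahn_banach_dist (M : set V) (a : V) (lam : RR) : M 0 ->
  (forall (c : C) x y, M x -> M y -> M (c *: x + y)) -> 0 < lam ->
  (forall m, M m -> lam <= p (a + m)) ->
  exists F : V -> C, [/\ (forall (c : C) x y, F (c *: x + y) = c * F x + F y),
    (forall x, rn (F x) <= p x), (forall x, M x -> F x = 0) & F a = cR lam].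
Proof.
move=> M0 Ml lam0 hlam.
have MZ (c : C) x : M x -> M (c *: x) by move=> h; have := Ml c x 0 h M0; rewrite addr0.
have MD x y : M x -> M y -> M (x + y) by move=> h; have := Ml 1 x y h; rewrite scale1r.
have MN x : M x -> M (- x) by rewrite -scaleN1r; exact: MZ.
have inj c m c' m' : M m -> M m' -> c *: a + m = c' *: a + m' -> c = c'.
  move=> h h' e; apply/eqP; rewrite -subr_eq0; apply: contraT => cc.
  have := hlam _ (MZ (c - c')^-1 _ (MD _ _ h (MN _ h'))).
  rewrite (_ : a + _ = 0) ?p0; first by lra.
  have /(canRL (addrK _)) e1 := e.
  rewrite -{1}[a]scale1r -(mulVf cc) -scalerA -scalerDr scalerBl e1.
  by rewrite (_ : c' *: a + m' - m - c' *: a + (m - m') = 0) ?scaler0 //; module.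
pose N := [set x | exists c m, M m /\ x = c *: a + m].
have [f hf] : exists f : V -> C, forall c m, M m -> f (c *: a + m) = c * cR lam.
  have /choice [f hf] : forall x, exists c : C, forall c' m, M m -> x = c' *: a + m -> c' = c.
    move=> x; have [[c [m [hm ->]]]|hn] := pselect (N x).
      by exists c => c' m' hm' /esym e; exact: inj e.
    by exists 0 => c m hm e; case: hn; exists c, m.
  by exists (fun x => f x * cR lam) => c m hm; rewrite -(hf _ c m hm erefl).
have [||||F [Fl Fp Ff]] := @hahn_banach N f.
- by exists 0, 0; rewrite scale0r addr0.
- move=> c _ _ [c1 [m1 [h1 ->]]] [c2 [m2 [h2 ->]]].
  by exists (c * c1 + c2), (c *: m1 + m2); split; [exact: Ml | module].
- move=> c _ _ [c1 [m1 [h1 ->]]] [c2 [m2 [h2 ->]]].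
  rewrite (_ : c *: _ + _ = (c * c1 + c2) *: a + (c *: m1 + m2)); last by module.
  by rewrite !hf //; [ring | exact: Ml].
- move=> _ [c [m [h ->]]]; rewrite hf // rnM rn_cR gtr0_norm //.
  have [->|c0] := eqVneq c 0; first by rewrite rn0 mul0r.
  have -> : c *: a + m = c *: (a + c^-1 *: m) by rewrite scalerDr scalerA divff // scale1r.
  rewrite pZ; apply: ler_wpM2l; first exact: rn_ge0.
  by apply: hlam; exact: MZ.
exists F; split => //.
- move=> x hx; rewrite Ff; last by exists 0, x; rewrite scale0r add0r.
  by have := hf 0 x hx; rewrite scale0r add0r mul0r.
- rewrite Ff; last by exists 1, 0; rewrite scale1r addr0.
  by have := hf 1 0 M0; rewrite scale1r addr0 mul1r.
Qed.
End HahnBanach.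

(** * Bounded linear maps, norming functionals and biorthogonal systems *)

Section Clinear.
Variables (X V : normedModType C) (f : X -> V).
Hypothesis fl : clinear f.

Lemma clin0 : f 0 = 0.
Proof. by have := fl (-1) 0 0; rewrite scaler0 addr0 scaleN1r addNr. Qed.
Lemma clinD x y : f (x + y) = f x + f y.
Proof. by have := fl 1 x y; rewrite !scale1r. Qed.
Lemma clinZ (a : C) x : f (a *: x) = a *: f x.
Proof. by have := fl a x 0; rewrite clin0 !addr0. Qed.
Lemma clinN x : f (- x) = - f x.
Proof. by rewrite -scaleN1r clinZ scaleN1r. Qed.
Lemma clinB x y : f (x - y) = f x - f y.
Proof. by rewrite clinD clinN. Qed.
Lemma clin_sum (I : Type) (r : seq I) (P : pred I) (F : I -> X) :
  f (\sum_(i <- r | P i) F i) = \sum_(i <- r | P i) f (F i).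
Proof.
elim/big_rec2: _ => [|i u v _ h]; first exact: clin0.
by rewrite clinD h.
Qed.

Lemma clin_bdd : continuous f -> exists2 K : RR, 0 < K & forall x, rn (f x) <= K * rn x.
Proof.
move=> fc; have /rn_cvgP/(_ 1 ltr01) := fc 0.
move=> /rn_nbhs [d d0 hd].
exists (2 / d); first by rewrite divr_gt0.
move=> x; have [->|x0] := eqVneq x 0; first by rewrite clin0 !rn0 mulr0.
have rx := rn_gt0 x0.
pose a : C := cR (d / (2 * rn x)).
have ra : rn a = d / (2 * rn x) by rewrite rn_cR ger0_norm // divr_ge0 ?mulr_ge0 // ltW.
have : rn (f (a *: x) - f 0) < 1.
  apply: hd; rewrite subr0 rnZ ra (_ : _ * _ = d / 2); [lra | by field; lra].
rewrite clin0 subr0 clinZ rnZ ra => h; apply: ltW.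
move: h; rewrite mulrAC ltr_pdivrMr ?mulr_gt0 // mul1r => h.
by rewrite mulrAC ltr_pdivlMr // mulrC.
Qed.

Lemma clin_cont (K : RR) : (forall x, rn (f x) <= K * rn x) -> continuous f.
Proof.
move=> hK x; apply/rn_cvgP => e e0.
have K1 : 0 < `|K| + 1 by have := normr_ge0 K; lra.
apply/rn_nbhs; exists (e / (`|K| + 1)); first by rewrite divr_gt0.
move=> y; rewrite ltr_pdivlMr // -clinB => h; apply: le_lt_trans (hK _) _.
by have := rn_ge0 (y - x); have := ler_norm K; nra.
Qed.
End Clinear.

Lemma bfunctionalE (X : normedModType C) (phi : X -> C) :
  bfunctional phi = blinear (phi : X -> (C : normedModType C)).
Proof. by []. Qed.

Lemma seminorm_rn (V : normedModType C) : seminorm (@rn V).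
Proof. by split; [exact: rnD | exact: rnZ]. Qed.

Lemma exists_functional (V : normedModType C) (x : V) : exists phi : V -> C,
  [/\ bfunctional phi, (forall y, rn (phi y) <= rn y) & phi x = cR (rn x)].
Proof.
have [->|x0] := eqVneq x 0.
  exists (fun=> 0); split; last by rewrite rn0.
    by split; [move=> *; rewrite mulr0 addr0 | move=> y; exact: cvg_cst].
  by move=> y; rewrite rn0 rn_ge0.
have [||||F [Fl Fp _ Fx]] := hahn_banach_dist (seminorm_rn V) (M := [set 0]) (a := x) (lam := rn x).
- by [].
- by move=> c _ _ -> ->; rewrite scaler0 addr0.
- exact: rn_gt0.
- by move=> _ ->; rewrite addr0.
exists F; split => //; split => //.
by apply: (@clin_cont _ _ (F : V -> (C : normedModType C)) Fl 1) => y; rewrite mul1r.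
Qed.

Lemma functionals_separate (V : normedModType C) (x y : V) :
  (forall phi : V -> C, bfunctional phi -> phi x = phi y) -> x = y.
Proof.
move=> h; apply/eqP; rewrite -subr_eq0; apply/eqP; apply: rn0_eq0.
have [phi [pb _ hp]] := exists_functional (x - y); apply: cR_inj; rewrite -hp.
have pl : clinear (phi : V -> (C : normedModType C)) by exact: pb.1.
by rewrite (clinB pl) h // subrr.
Qed.

(** A Gram-Schmidt process in which Hahn-Banach functionals replace the inner product. Coordinates
    become continuous functionals on the whole space, and [s] may be linearly dependent. *)
Lemma biorthogonal (X : normedModType C) (m : nat) (s : 'I_m -> X) :
  exists (d : nat) (e : 'I_d -> X) (phi : 'I_d -> X -> C),
    [/\ forall k, bfunctional (phi k),
        forall k l, phi k (e l) = (k == l)%:R,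
        forall k, span_of s (e k) &
        forall x, span_of s x -> x = \sum_(k < d) phi k x *: e k].
Proof.
elim: m s => [|m ih] s.
  exists 0%N, (fun=> 0), (fun _ _ => 0); split; try by case.
  by move=> x [c ->]; rewrite !big_ord0.
have [d [e [phi [pb pe se sx]]]] := ih (s \o lift ord0).
have pl k : clinear (phi k : X -> (C : normedModType C)) by exact: (pb k).1.
have span_lift x : span_of (s \o lift ord0) x -> span_of s x.
  move=> [c ->]; exists (fun k => if unlift ord0 k is Some j then c j else 0).
  rewrite big_ord_recl unlift_none scale0r add0r.
  by apply: eq_bigr => k _; rewrite liftK.
have span_lin (n : nat) (u : 'I_n -> X) (a : C) x y : span_of u x -> span_of u y -> span_of u (a *: x + y).
  move=> [c ->] [c' ->]; exists (fun k => a * c k + c' k).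
  by rewrite scaler_sumr -big_split; apply: eq_bigr => k _ /=; module.
have span0 (n : nat) (u : 'I_n -> X) : span_of u 0.
  by exists (fun=> 0); rewrite big1 // => k _; rewrite scale0r.
have span_sum (n : nat) (u : 'I_n -> X) (I : Type) (r : seq I) (c : I -> C) (F : I -> X) :
    (forall i, span_of u (F i)) -> span_of u (\sum_(i <- r) c i *: F i).
  move=> h; elim: r => [|i r hr]; first by rewrite big_nil.
  by rewrite big_cons; apply: span_lin.
pose w := s ord0 - \sum_(k < d) phi k (s ord0) *: e k.
have ws : span_of s w.
  rewrite /w -scaleN1r addrC; apply: span_lin.
    by apply: span_sum => k; apply: span_lift.
  exists (fun k => (k == ord0)%:R); rewrite (bigD1 ord0) //= scale1r big1 ?addr0 //.
  by move=> k /negPf ->; rewrite scale0r.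
have pw k : phi k w = 0.
  rewrite /w (clinB (pl k)) (clin_sum (pl k)) (bigD1 k) //= (clinZ (pl k)) pe eqxx.
  rewrite big1 ?addr0; first by rewrite /GRing.scale /= mulr1 subrr.
  by move=> j jk; rewrite (clinZ (pl k)) pe eq_sym (negPf jk) scaler0.
have decomp x : span_of s x -> exists c : C, exists2 y, span_of (s \o lift ord0) y & x = c *: w + y.
  move=> [c ->]; rewrite big_ord_recl; exists (c ord0).
  exists (c ord0 *: (\sum_(k < d) phi k (s ord0) *: e k)
     + \sum_(k < m) c (lift ord0 k) *: s (lift ord0 k)).
    apply: span_lin; first exact: span_sum.
    by exists (fun k => c (lift ord0 k)).
  by rewrite /w addrA -scalerDr subrK.
have [w0|w0] := eqVneq w 0.
  exists d, e, phi; split => //; first by move=> k; apply: span_lift.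
  move=> x /decomp [c [y hy ->]]; rewrite w0 scaler0 add0r; exact: sx.
have [psi [psib _ psiw]] := exists_functional w.
have psil : clinear (psi : X -> (C : normedModType C)) by exact: psib.1.
have rw0 : cR (rn w) != 0 by rewrite -cR0 (inj_eq cR_inj) gt_eqF // rn_gt0.
(* The norming functional of [w], corrected to vanish on the earlier vectors and normalised at
   [w]. *)
pose psi' x := (cR (rn w))^-1 * (psi x - \sum_(k < d) psi (e k) * phi k x).
have psi'w : psi' w = 1.
  by rewrite /psi' big1 ?subr0 ?psiw ?mulVf // => k _; rewrite pw mulr0.
have psi'e k : psi' (e k) = 0.
  rewrite /psi' (bigD1 k) //= pe eqxx mulr1 big1 ?addr0 ?subrr ?mulr0 //.
  by move=> j jk; rewrite pe (negPf jk) mulr0.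
pose f (k : 'I_d.+1) : X := if unlift ord0 k is Some j then e j else w.
pose chi (k : 'I_d.+1) : X -> C := if unlift ord0 k is Some j then phi j else psi'.
exists d.+1, f, chi; split.
- move=> k; rewrite /chi; case: (unlift ord0 k) => [j|]; first exact: pb.
  have [K K0 hK] := clin_bdd psil psib.2.
  have /choice [L hL] : forall k, exists L : RR, forall x, rn (phi k x) <= L * rn x.
    by move=> j; have [L _ hL] := clin_bdd (pl j) (pb j).2; exists L.
  have l' : clinear (psi' : X -> (C : normedModType C)).
    move=> a x y; rewrite /psi' (clinD psil) (clinZ psil) /GRing.scale /=.
    rewrite (eq_bigr (fun k => a * (psi (e k) * phi k x) + psi (e k) * phi k y)); last first.
      by move=> j _; rewrite (clinD (pl j)) (clinZ (pl j)) /GRing.scale /=; ring.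
    by rewrite big_split /= -mulr_sumr; ring.
  split=> //; apply: (clin_cont l' (K := (rn w)^-1 * (K + \sum_(k < d) rn (psi (e k)) * L k))) => x.
  rewrite /psi' rnM rnV rn_cR ger0_norm ?rn_ge0 // -mulrA.
  apply: ler_wpM2l; first by rewrite invr_ge0 rn_ge0.
  apply: le_trans (rnBD _ _) _; rewrite mulrDl; apply: lerD => //.
  rewrite mulr_suml; apply: le_trans (rn_sum _ _ _) _; apply: ler_sum => j _.
  by rewrite rnM -mulrA; apply: ler_wpM2l; rewrite ?rn_ge0.
- move=> k l; rewrite /chi /f.
  case: (unliftP ord0 k) => [j ->|->]; case: (unliftP ord0 l) => [j' ->|->].
  + by rewrite pe (inj_eq lift_inj).
  + by rewrite pw eq_sym (negPf (neq_lift _ _)).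
  + by rewrite psi'e (negPf (neq_lift _ _)).
  + by rewrite psi'w eqxx.
- by move=> k; rewrite /f; case: (unlift ord0 k) => [j|//]; apply: span_lift.
- move=> x /decomp [c [y hy ->]]; rewrite big_ord_recl /chi /f unlift_none.
  have e1 : y = \sum_(k < d) phi k y *: e k by exact: sx.
  have psi'l : psi' (c *: w + y) = c.
    rewrite /psi' (clinD psil) (clinZ psil) psiw {1}e1 (clin_sum psil).
    rewrite (eq_bigr (fun k => psi (e k) * phi k y)); last first.
      by move=> k _; rewrite (clinZ psil) /GRing.scale /= mulrC.
    rewrite [X in _ - X](eq_bigr (fun k => psi (e k) * phi k y)); last first.
      by move=> k _; rewrite (clinD (pl k)) (clinZ (pl k)) pw scaler0 add0r.
    by rewrite addrK /GRing.scale /= mulrC mulfK.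
  rewrite psi'l; congr (_ + _); rewrite {1}e1; apply: eq_bigr => k _.
  by rewrite liftK (clinD (pl k)) (clinZ (pl k)) pw scaler0 add0r.
Qed.

(** * Ultrafilter limits and relative compactness *)

Definition nlim (I : Type) (U : set_system I) (E : normedModType C) (u : I -> E) (l : E) :=
  forall e : RR, 0 < e -> U [set s | rn (u s - l) <= e].

Definition wlim (I : Type) (U : set_system I) (E : normedModType C) (u : I -> E) (l : E) :=
  forall phi : E -> C, bfunctional phi -> nlim U (phi \o u : I -> (C : normedModType C)) (phi l).

(* Norm convergence ([b = false]) and weak convergence ([b = true]), treated uniformly. *)
Definition Lim (b : bool) (I : Type) (U : set_system I) (E : normedModType C)
  (u : I -> E) (l : E) := if b then wlim U u l else nlim U u l.

Section LimTheory.
Context {I : Type} {U : set_system I} {UF : ProperFilter U}.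
Implicit Types E : normedModType C.

Lemma nlim_ext E (u v : I -> E) l : U [set s | u s = v s] -> nlim U u l -> nlim U v l.
Proof.
by move=> uv h e e0; apply: filterS (filterI uv (h e e0)) => s [/= -> //].
Qed.

Lemma nlim_lin E (a : C) (u v : I -> E) l k :
  nlim U u l -> nlim U v k -> nlim U (fun s => a *: u s + v s) (a *: l + k).
Proof.
move=> hu hv e e0; have ra : 0 < 2 * (rn a + 1) by have := rn_ge0 a; lra.
have e2 : 0 < e / 2 by lra.
apply: filterS (filterI (hu _ (divr_gt0 e0 ra)) (hv _ e2)) => s [/= h1 h2].
rewrite (_ : _ - _ = a *: (u s - l) + (v s - k)); last by module.
apply: le_trans (rnD _ _) _; rewrite rnZ.
move: h1; rewrite ler_pdivlMr // => h1.
have := rn_ge0 a; have := rn_ge0 (u s - l); nra.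
Qed.

Lemma nlim_cst E (l : E) : nlim U (fun=> l) l.
Proof. by move=> e e0; apply: filterE => s /=; rewrite subrr rn0 ltW. Qed.

Lemma nlim_uniq E (u : I -> E) l k : nlim U u l -> nlim U u k -> l = k.
Proof.
move=> hl hk; apply/eqP; rewrite -subr_eq0; apply/eqP; apply: rn_eps0 => e e0.
have e2 : 0 < e / 2 by lra.
have [s [/= h1 h2]] := filter_ex (filterI (hl _ e2) (hk _ e2)).
by have := rn_tri (u s) l k; rewrite (rnB l (u s)); lra.
Qed.

Lemma nlim_bound E (u : I -> E) l (M : RR) : U [set s | rn (u s) <= M] -> nlim U u l -> rn l <= M.
Proof.
move=> hM hl; apply/ler_addgt0Pr => e e0.
have [s [/= h1 h2]] := filter_ex (filterI hM (hl _ e0)).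
by have := rn_leB l (u s); rewrite rnB; lra.
Qed.

Lemma bfun_lin E (phi : E -> C) : bfunctional phi -> clinear (phi : E -> (C : normedModType C)).
Proof. by case. Qed.

Lemma nlim_bfun E (phi : E -> C) (u : I -> E) l : bfunctional phi -> nlim U u l ->
  nlim U (phi \o u : I -> (C : normedModType C)) (phi l).
Proof.
move=> hb hu e e0; have pl := bfun_lin hb.
have [K K0 hK] := clin_bdd pl hb.2.
apply: filterS (hu _ (divr_gt0 e0 K0)) => s /=; rewrite ler_pdivlMr // => h.
rewrite -[X in rn X](clinB pl); apply: le_trans (hK _) _; by rewrite mulrC.
Qed.

Lemma Lim_ext b E (u v : I -> E) l : U [set s | u s = v s] -> Lim b U u l -> Lim b U v l.
Proof.
case: b => /= uv; last exact: nlim_ext.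
move=> h phi hb; apply: nlim_ext (h phi hb).
by apply: filterS uv => s /= ->.
Qed.

Lemma Lim_lin b E (a : C) (u v : I -> E) l k :
  Lim b U u l -> Lim b U v k -> Lim b U (fun s => a *: u s + v s) (a *: l + k).
Proof.
case: b => /=; last exact: nlim_lin.
move=> hu hv phi hb; have pl := bfun_lin hb; rewrite (pl a l k).
apply: nlim_ext (nlim_lin a (hu phi hb) (hv phi hb)).
by apply: filterE => s /=; rewrite (pl a).
Qed.

Lemma Lim_cst b E (l : E) : Lim b U (fun=> l) l.
Proof. by case: b => /= [phi hb|]; exact: nlim_cst. Qed.

Lemma Lim_uniq b E (u : I -> E) l k : Lim b U u l -> Lim b U u k -> l = k.
Proof.
case: b => /=; last exact: nlim_uniq.
move=> hl hk; apply: functionals_separate => phi hb.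
exact: nlim_uniq (hl _ hb) (hk _ hb).
Qed.

Lemma Lim_bound b E (u : I -> E) l (M : RR) : U [set s | rn (u s) <= M] -> Lim b U u l -> rn l <= M.
Proof.
case: b => /= hM; last exact: nlim_bound.
have [phi [hb h1 hl]] := exists_functional l.
move=> /(_ phi hb) h; rewrite -[rn l]ger0_norm ?rn_ge0 // -rn_cR -hl.
apply: nlim_bound h; apply: filterS hM => s /= hs; exact: le_trans (h1 _) hs.
Qed.

Lemma nlim_Lim b E (u : I -> E) l : nlim U u l -> Lim b U u l.
Proof. by case: b => //= h phi hb; exact: nlim_bfun. Qed.

Lemma LimZ b E (a : C) (u : I -> E) l : Lim b U u l -> Lim b U (fun s => a *: u s) (a *: l).
Proof.
move=> h; have := Lim_lin a h (Lim_cst b (0 : E)); rewrite addr0.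
by apply: Lim_ext; apply: filterE => s /=; rewrite addr0.
Qed.

Lemma LimB b E (u v : I -> E) l k : Lim b U u l -> Lim b U v k ->
  Lim b U (fun s => u s - v s) (l - k).
Proof.
move=> hu hv; have := Lim_lin (-1) hv hu; rewrite scaleN1r addrC.
by apply: Lim_ext; apply: filterE => s /=; rewrite scaleN1r addrC.
Qed.

Lemma Lim_sum b E (J : Type) (r : seq J) (c : J -> C) (u : J -> I -> E) (l : J -> E) :
  (forall j, Lim b U (u j) (l j)) ->
  Lim b U (fun s => \sum_(j <- r) c j *: u j s) (\sum_(j <- r) c j *: l j).
Proof.
move=> h; elim: r => [|j r ih].
  rewrite big_nil; apply: Lim_ext (Lim_cst b 0).
  by apply: filterE => s /=; rewrite big_nil.
rewrite big_cons; apply: Lim_ext (Lim_lin (c j) (h j) ih).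
by apply: filterE => s /=; rewrite big_cons.
Qed.

Lemma cauchy_seq_lim (E : completeNormedModType C) (x : nat -> E) :
  (forall k j : nat, (k <= j)%N -> rn (x j - x k) <= hp k) ->
  exists l : E, forall k, rn (x k - l) <= hp k.
Proof.
move=> hx.
have xc : cvg (x @ \oo).
  apply: cauchy_cvg; apply: cauchy_exP => e /gt0_cR [r r0 ->].
  have [k hk] := hp_lt r0; exists (x k); exists k => // j /= kj.
  by rewrite -ball_normE /ball_ /= rnE cR_lt rnB; apply: le_lt_trans (hx k j kj) hk.
exists (lim (x @ \oo)) => k; apply/ler_addgt0Pr => e e0.
have /rn_cvgP /(_ e e0) [N _ hN] := xc.
have := hN (maxn N k) (leq_maxl _ _) => /= h1.
have := hx k (maxn N k) (leq_maxr _ _) => h2.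
by have := rn_tri (x (maxn N k)) (x k) (lim (x @ \oo)); rewrite (rnB (x k) (x (maxn N k))); lra.
Qed.

(** The limits of better and better approximants form a norm Cauchy sequence even when the
    convergence is weak, because [Lim_bound] passes norm bounds to weak limits. *)
Lemma Lim_complete b (E : completeNormedModType C) (u : I -> E) :
  (forall e : RR, 0 < e -> exists v l, Lim b U v l /\ U [set s | rn (u s - v s) <= e]) ->
  exists l, Lim b U u l.
Proof.
move=> h.
have /choice [x hx] : forall k, exists x : E, exists v, Lim b U v x /\
    U [set s | rn (u s - v s) <= hp k / 2].
  by move=> k; have [v [l [h1 h2]]] := h (hp k / 2) ltac:(have := hp_gt0 k; lra); exists l, v.
have hpm k j : (k <= j)%N -> hp j <= hp k.
  move=> /subnKC <-; elim: (j - k)%N => [|n ih]; first by rewrite addn0.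
  by rewrite addnS hpS; have := hp_gt0 (k + n)%N; lra.
have [k j kj|l hl] := @cauchy_seq_lim E x.
  have [v [h1 h2]] := hx k; have [w [h3 h4]] := hx j.
  apply: Lim_bound (LimB h3 h1); apply: filterS (filterI h2 h4) => s [/= a1 a2].
  have := hpm _ _ kj; have := rn_tri (u s) (w s) (v s); rewrite (rnB (w s) (u s)); lra.
exists l.
have near e : 0 < e -> exists v x, [/\ Lim b U v x, rn (x - l) <= e & U [set s | rn (u s - v s) <= e]].
  move=> e0; have [k hk] := hp_lt e0; have [v [h1 h2]] := hx k.
  exists v, (x k); split => //; first by have := hl k; lra.
  by apply: filterS h2 => s /=; have := hp_gt0 k; lra.
case: b near {h hx} => /= near.
  move=> phi hb e e0; have pl := bfun_lin hb.
  have [K K0 hK] := clin_bdd pl hb.2.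
  have [v [y [h1 h2 h3]]] := near (e / (3 * K)) ltac:(by rewrite divr_gt0 //; lra).
  have e3 : 0 < e / 3 by lra.
  apply: filterS (filterI (h1 phi hb _ e3) h3) => s [/= h4 h5].
  have K3 : 0 < 3 * K by lra.
  rewrite ler_pdivlMr // in h2; rewrite ler_pdivlMr // in h5.
  have := rn_tri (phi (v s) : (C : normedModType C)) (phi (u s)) (phi l).
  have := rn_tri (phi y : (C : normedModType C)) (phi (v s)) (phi l).
  rewrite -[X in rn (X : _ : normedModType _) <= _ + rn (phi y - phi l)](clinB pl).
  have := hK (u s - v s); have := hK (y - l); rewrite !(clinB pl).
  by lra.
move=> e e0; have e3 : 0 < e / 3 by lra.
have [v [y [h1 h2 h3]]] := near (e / 3) e3.
apply: filterS (filterI (h1 (e / 3) e3) h3) => s [/= h4 h5].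
by have := rn_tri (v s) (u s) l; have := rn_tri y (v s) l; lra.
Qed.

End LimTheory.

(** Compactness in the form in which extensions use it: a family indexed by any type has a limit
    along any ultrafilter. One definition covers the norm and the weak topology. *)
Definition Lcompact (b : bool) (E : normedModType C) (K : set E) : Prop :=
  forall (I : Type) (U : set_system I), UltraFilter U -> forall u : I -> E,
    U [set s | K (u s)] -> exists2 l, K l & Lim b U u l.

Definition relL (b : bool) (E : normedModType C) (A : set E) : Prop :=
  exists2 K, Lcompact b K & A `<=` K.

Lemma fmap_ultra (I J : Type) (f : I -> J) (U : set_system I) :
  UltraFilter U -> UltraFilter (f @ U).
Proof.
move=> UU; split; first exact: fmap_proper_filter.
move=> G GF sub; apply/seteqP; split => [B GB|]; last exact: sub.
have [//|h] := in_ultra_setVsetC (f @^-1` B) UU.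
have GB' : G (~` B) by apply: sub; exact: h.
by have [x []] := filter_ex (filterI GB GB').
Qed.

(** For the converse, an ultrafilter refining the traces on [A] of the neighbourhoods of a point of
    [closure A] converges to that point and to a point of [K]; uniqueness of limits puts the closure
    inside [K]. *)
Lemma relcompactP (T : topologicalType)
    (conv : forall I : Type, set_system I -> (I -> T) -> T -> Prop) (A : set T) :
  (forall (I : Type) (U : set_system I) u l, Filter U -> conv I U u l <-> u @ U --> l) ->
  (forall (I : Type) (U : set_system I) u l k, ProperFilter U ->
     conv I U u l -> conv I U u k -> l = k) ->
  compact (closure A) <-> exists2 K : set T,
    (forall (I : Type) (U : set_system I), UltraFilter U -> forall u : I -> T,
      U [set s | K (u s)] -> exists2 l, K l & conv I U u l) & A `<=` K.
Proof.
move=> hconv huniq; split.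
  rewrite compact_ultra => hc; exists (closure A); last exact: subset_closure.
  move=> I U UU u hu; have UU' := fmap_ultra u UU.
  by have [l [Al hl]] := hc _ UU' hu; exists l => //; apply/hconv.
move=> [K hK AK].
have cK : closure A `<=` K.
  move=> p hp.
  have FF : ProperFilter (filter_from [set B | nbhs p B] (fun B => A `&` B)).
    apply: filter_from_proper; last by move=> B /hp.
    apply: filter_from_filter; first by exists setT; exact: filterT.
    move=> B D hB hD; exists (B `&` D); first exact: filterI.
    by move=> x [Ax [Bx Dx]].
  have [U [UU sub]] := ultraFilterLemma FF.
  have UA : U A by apply: sub; exists setT; [exact: filterT | move=> x []].
  have [l Kl hl] := hK _ U UU id (filterS AK UA).
  suff -> : p = l by [].
  apply: (huniq _ U id) hl; apply/hconv => B /= hB.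
  by apply: sub; exists B => // x [].
rewrite compact_ultra => F UF Fc.
have [l Kl /hconv hl] := hK _ F UF id (filterS cK Fc).
exists l; split => //; rewrite (closure_id (closure A)).1; last exact: closed_closure.
move=> B hB; have [x []] := filter_ex (filterI Fc (hl _ hB : F B)).
by exists x.
Qed.

Lemma rel_compactP (E : normedModType C) (A : set E) : rel_compact A <-> relL false A.
Proof.
apply: (@relcompactP E (fun I U u l => nlim U u l)).
  move=> I U u l FU; rewrite rn_cvgP; split=> h e e0.
    have e2 : 0 < e / 2 by lra.
    by apply: filterS (h (e / 2) e2) => s /=; lra.
  by apply: filterS (h e e0) => s /=; exact: ltW.
by move=> I U u l k PU; exact: nlim_uniq.
Qed.

Lemma weak_cvgP (E : normedModType C) (I : Type) (U : set_system I) (u : I -> E) (l : E) :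
  Filter U -> wlim U u l <-> u @ U --> (l : weakV E).
Proof.
move=> FU; split.
  move=> h B /= [_ [[W1 oW1 <-] W1l sB]]; apply: filterS sB _ => /=.
  have : @nbhs _ (prod_topology (fun _ : dual E => C)) (@weak_embed E l) W1 by exact: open_nbhs_nbhs.
  suff : (@weak_embed E \o u) @ U --> (@weak_embed E l : prod_topology (fun _ : dual E => C)) by exact.
  apply/cvg_sup => phi D /= [_ [[W oW <-] Wl sD]].
  have /= := h (proj1_sig phi) (proj2_sig phi).
  have : nbhs (proj1_sig phi l) W by exact: open_nbhs_nbhs.
  move=> /(@rn_nbhs (C : normedModType C)) [e e0 he] h0; have e2 : 0 < e / 2 by lra.
  have h1 := h0 _ e2; have e2l : e / 2 < e by lra.
  have hW : U [set s | W (proj1_sig phi (u s))].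
    by apply: filterS h1 => s /= h1; apply: he; exact: (le_lt_trans h1 e2l).
  exact: (filterS (fun s (hs : W (proj1_sig phi (u s))) => sD (@weak_embed E (u s)) hs) hW).
move=> h phi hb e e0; pose ph : dual E := exist _ phi hb.
have h1 : (@weak_embed E \o u) @ U --> (@weak_embed E l : prod_topology (fun _ : dual E => C)).
  apply: cvg_comp h _; exact: initial_continuous.
move: h1 => /cvg_sup /(_ ph) h1.
have : phi \o u @ U --> phi l.
  have := @initial_continuous _ _ (fun f : (dual E -> C) => f ph) (@weak_embed E l).
  move=> h2 D hD; exact: (h1 _ (h2 D hD)).
move=> /(@rn_cvgP (C : normedModType C)) /(_ e e0).
by apply: filterS => s /=; exact: ltW.
Qed.

Lemma rel_wcompactP (E : normedModType C) (A : set E) : rel_wcompact A <-> relL true A.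
Proof.
apply: (@relcompactP (weakV E) (fun I U u l => @wlim I U E u l)).
  by move=> I U u l FU; exact: weak_cvgP.
by move=> I U u l k PU; exact: (@Lim_uniq I U PU true E).
Qed.
Lemma relL_sub b (E : normedModType C) (A B : set E) : A `<=` B -> relL b B -> relL b A.
Proof. by move=> AB [K hK BK]; exists K => //; apply: subset_trans BK. Qed.

Lemma Lcompact_comb b (E : normedModType C) (K : set E) n (c : 'I_n -> C) :
  Lcompact b K ->
  Lcompact b [set x | exists k : 'I_n -> E, (forall j, K (k j)) /\ x = \sum_(j < n) c j *: k j].
Proof.
move=> hK I U UU u hu.
have /choice [k hk] : forall s, exists k : 'I_n -> E,
    (exists k : 'I_n -> E, (forall j, K (k j)) /\ u s = \sum_(j < n) c j *: k j) ->
    (forall j, K (k j)) /\ u s = \sum_(j < n) c j *: k j.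
  move=> s; have [[k hk]|hn] := pselect (exists k : 'I_n -> E,
    (forall j, K (k j)) /\ u s = \sum_(j < n) c j *: k j); first by exists k.
  by exists (fun=> 0).
have /choice [l hl] : forall j, exists l, K l /\ Lim b U (k ^~ j) l.
  move=> j; have [|l Kl hl] := hK I U UU (k ^~ j); last by exists l.
  by apply: filterS hu => s /= /hk [].
exists (\sum_(j < n) c j *: l j); first by exists l; split => // j; exact: (hl j).1.
have h : Lim b U (fun s => \sum_(j < n) c j *: k s j) (\sum_(j < n) c j *: l j).
  by apply: Lim_sum => j; exact: (hl j).2.
apply: Lim_ext h; apply: filterS hu => s /= /hk [_ ->] //.
Qed.

(** Total boundedness in the norm case, Grothendieck's criterion in the weak case. The compact set
    is the intersection of the [hp k]-neighbourhoods of the [K k]; limits exist by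
    [Lim_complete]. *)
Lemma relL_approx b (E : completeNormedModType C) (A : set E) :
  (forall e : RR, 0 < e -> exists2 K, Lcompact b K &
     forall x, A x -> exists2 y, K y & rn (x - y) <= e) -> relL b A.
Proof.
move=> h.
have /choice [K hK] : forall k, exists K : set E, Lcompact b K /\
    forall x, A x -> exists2 y, K y & rn (x - y) <= hp k.
  by move=> k; have [K h1 h2] := h _ (hp_gt0 k); exists K.
exists [set x | forall k, exists2 y, K k y & rn (x - y) <= hp k]; last first.
  by move=> x Ax k; exact: (hK k).2.
move=> I U UU u hu.
have app k : exists v l, [/\ K k l, Lim b U v l & U [set s | rn (u s - v s) <= hp k]].
  have /choice [v hv] : forall s, exists y : E,
      (exists2 y, K k y & rn (u s - y) <= hp k) -> K k y /\ rn (u s - y) <= hp k.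
    move=> s; have [[y h1 h2]|hn] := pselect (exists2 y, K k y & rn (u s - y) <= hp k).
      by exists y.
    by exists 0.
  have hv' : U [set s | K k (v s) /\ rn (u s - v s) <= hp k].
    by apply: filterS hu => s /= /(_ k) /hv.
  have [|l Kl hl] := (hK k).1 I U UU v; first by apply: filterS hv' => s /= [].
  by exists v, l; split => //; apply: filterS hv' => s /= [].
have [e e0|l hl] := @Lim_complete I U _ b E u.
  have [k hk] := hp_lt e0; have [v [l [_ h1 h2]]] := app k.
  by exists v, l; split => //; apply: filterS h2 => s /=; lra.
exists l => // k; have [v [y [Ky h1 h2]]] := app k.
by exists y => //; apply: Lim_bound (LimB hl h1).
Qed.

Lemma real_ultra_lim (I : Type) (U : set_system I) (UU : UltraFilter U) (v : I -> RR) (M : RR) :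
  U [set s | `|v s| <= M] -> exists r, forall e, 0 < e -> U [set s | `|v s - r| <= e].
Proof.
move=> hM; pose T := [set t : RR | U [set s | t <= v s]].
have Tub : ubound T M.
  move=> t ht; have [s [/= h1 h2]] := filter_ex (filterI ht hM).
  by move: h2; rewrite ler_norml; lra.
have Tne : T !=set0.
  by exists (- M); apply: filterS hM => s /=; rewrite ler_norml => /andP[].
exists (sup T) => e e0.
have h1 : U [set s | sup T - e <= v s].
  have [t Tt ht] := sup_adherent e0 (conj Tne (ex_intro _ M Tub)).
  by apply: filterS Tt => s /=; lra.
have h2 : U (~` [set s | sup T + e <= v s]).
  case: (in_ultra_setVsetC [set s | sup T + e <= v s] UU) => // h2.
  have hT : has_ubound T by exists M.
  have := ub_le_sup hT h2; lra.
apply: filterS (filterI h1 h2) => s [/= h3 /negP]; rewrite -ltNge => h4.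
by rewrite ler_norml; lra.
Qed.

Lemma rn_ReIm (z : C) : `|complex.Re z| <= rn z /\ `|complex.Im z| <= rn z.
Proof.
by rewrite /rn normc_def /= -!sqrtr_sqr; split; apply: ler_wsqrtr;
  rewrite ?lerDl ?lerDr sqr_ge0.
Qed.

Lemma scalar_ultra_lim (I : Type) (U : set_system I) (UU : UltraFilter U) (u : I -> C) (M : RR) :
  U [set s | rn (u s) <= M] -> exists l : C, nlim U (u : I -> (C : normedModType C)) l.
Proof.
move=> hM.
have [|r hr] := @real_ultra_lim I U UU (fun s => complex.Re (u s)) M.
  by apply: filterS hM => s /=; have [h _] := rn_ReIm (u s); lra.
have [|t ht] := @real_ultra_lim I U UU (fun s => complex.Im (u s)) M.
  by apply: filterS hM => s /=; have [_ h] := rn_ReIm (u s); lra.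
exists (r +i* t)%C => e e0; have e2 : 0 < e / 2 by lra.
apply: filterS (filterI (hr _ e2) (ht _ e2)) => s [/= h1 h2].
have := rn_le_ReIm (complex.Re (u s) - r) (complex.Im (u s) - t).
rewrite (_ : (_ +i* _)%C = u s - (r +i* t)%C); last by case: (u s).
by lra.
Qed.

Lemma Lcompact_box b (E : normedModType C) n (v : 'I_n -> E) (B : RR) :
  Lcompact b [set x | exists d : 'I_n -> C, (forall l, rn (d l) <= B) /\
                       x = \sum_(l < n) d l *: v l].
Proof.
move=> I U UU u hu.
have /choice [d hd] : forall s, exists d : 'I_n -> C,
    (exists d : 'I_n -> C, (forall l, rn (d l) <= B) /\ u s = \sum_(l < n) d l *: v l) ->
    (forall l, rn (d l) <= B) /\ u s = \sum_(l < n) d l *: v l.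
  move=> s; have [[d h]|hn] := pselect (exists d : 'I_n -> C,
    (forall l, rn (d l) <= B) /\ u s = \sum_(l < n) d l *: v l); first by exists d.
  by exists (fun=> 0).
have hB l : U [set s | rn (d s l) <= B] by apply: filterS hu => s /= /hd [].
have /choice [dl hdl] : forall l, exists c : C, nlim U (fun s => d s l : (C : normedModType C)) c.
  by move=> l; exact: scalar_ultra_lim (hB l).
exists (\sum_(l < n) dl l *: v l).
  by exists dl; split => // l; apply: (nlim_bound (hB l) (hdl l)).
have h : Lim b U (fun s => \sum_(l < n) 1 *: (d s l *: v l)) (\sum_(l < n) 1 *: (dl l *: v l)).
  apply: Lim_sum => l; apply: nlim_Lim => e e0.
  have e1 : 0 < e / (rn (v l) + 1) by rewrite divr_gt0 //; have := rn_ge0 (v l); lra.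
  apply: filterS (hdl l _ e1) => s /=; rewrite -scalerBl rnZ.
  have v0 := rn_ge0 (v l); rewrite ler_pdivlMr; last lra.
  by have := rn_ge0 (d s l - dl l); nra.
rewrite (eq_bigr _ (fun l _ => esym (scale1r (dl l *: v l)))).
apply: Lim_ext h; apply: filterS hu => s /= /hd [_ ->].
by apply: eq_bigr => l _; rewrite scale1r.
Qed.

(** * Finite sums of scalar functions times vectors *)

(** With [P] the functionals, their powers, or the functionals composed with a given map, this
    covers finite-rank operators, finite type polynomials, and the approximants obtained from the
    approximation property. *)
Definition psum (V : Type) (Z : normedModType C) (P : set (V -> C)) (Q : V -> Z) : Prop :=
  exists (m : nat) (p : 'I_m -> V -> C) (v : 'I_m -> Z),
    (forall k, P (p k)) /\ forall x, Q x = \sum_(k < m) p k x *: v k.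

Lemma psumD (V : Type) (Z : normedModType C) (P : set (V -> C)) (Q1 Q2 : V -> Z) :
  psum P Q1 -> psum P Q2 -> psum P (fun x => Q1 x + Q2 x).
Proof.
move=> [m1 [p1 [v1 [h1 e1]]]] [m2 [p2 [v2 [h2 e2]]]].
exists (m1 + m2)%N, (fun k => match fintype.split k with inl i => p1 i | inr j => p2 j end),
  (fun k => match fintype.split k with inl i => v1 i | inr j => v2 j end); split.
  by move=> k; case: (fintype.split k).
move=> x; rewrite big_split_ord /= e1 e2; congr (_ + _); apply: eq_bigr => k _.
  by rewrite (unsplitK (inl k)).
by rewrite (unsplitK (inr k)).
Qed.

Lemma psumZ (V : Type) (Z : normedModType C) (P : set (V -> C)) (Q : V -> Z) (a : C) :
  psum P Q -> psum P (fun x => a *: Q x).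
Proof.
move=> [m [p [v [h e]]]]; exists m, p, (fun k => a *: v k); split => // x.
by rewrite e scaler_sumr; apply: eq_bigr => k _; module.
Qed.

Lemma psum_box (V : Type) (Z : normedModType C) (P : set (V -> C)) (Q : V -> Z) (S : set V) :
  psum P Q -> (forall p, P p -> exists B : RR, forall x, S x -> rn (p x) <= B) ->
  exists m (v : 'I_m -> Z) (B : RR) (d : V -> 'I_m -> C),
    forall x, S x -> (forall l, rn (d x l) <= B) /\ Q x = \sum_(l < m) d x l *: v l.
Proof.
move=> [m [p [v [h e]]]] hP.
have /choice [B hB] : forall k, exists B : RR, forall x, S x -> rn (p k x) <= B.
  by move=> k; exact: hP.
exists m, v, (\sum_(l < m) `|B l|), (fun x l => p l x) => x Sx; split => // l.
apply: le_trans (hB l x Sx) _; apply: le_trans (ler_norm _) _.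
by rewrite (bigD1 l) //= lerDl; apply: sumr_ge0.
Qed.

Lemma psum_limit_relL b (V : Type) (Z : completeNormedModType C) (P : set (V -> C))
    (f : V -> Z) (S : set V) :
  (forall p, P p -> exists B : RR, forall x, S x -> rn (p x) <= B) ->
  (forall e : RR, 0 < e -> exists2 Q, psum P Q & forall x, S x -> rn (f x - Q x) <= e) ->
  relL b (f @` S).
Proof.
move=> hP h; apply: relL_approx => e e0; have [Q hQ fQ] := h e e0.
have [m [v [B [d hd]]]] := psum_box hQ hP.
exists [set x | exists d : 'I_m -> C, (forall l, rn (d l) <= B) /\ x = \sum_(l < m) d l *: v l].
  exact: Lcompact_box.
move=> _ [x Sx <-]; exists (Q x); last exact: fQ.
by have [h1 h2] := hd x Sx; exists (d x).
Qed.

(** * Polarization and homogeneous polynomials *)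

Section Polarization.
Variables (X V : normedModType C) (n : nat).
Hypothesis n0 : (0 < n)%N.

Lemma mlin0 (A : ('I_n -> X) -> V) (x : 'I_n -> X) k : multilinear A -> x k = 0 -> A x = 0.
Proof.
move=> Am xk; have := Am k x (-1) 0 0; rewrite scaler0 addr0 scaleN1r addNr.
by rewrite (_ : fupd x k 0 = x) //; apply/funext => j; rewrite /fupd; case: eqP => // ->.
Qed.

Lemma mlin_sum (A : ('I_n -> X) -> V) (x : 'I_n -> X) k m (u : 'I_m -> X) : multilinear A ->
  A (fupd x k (\sum_(i < m) u i)) = \sum_(i < m) A (fupd x k (u i)).
Proof.
move=> Am; elim: m u => [|m ih] u.
  by rewrite !big_ord0; apply: (mlin0 (k := k)) => //; rewrite /fupd eqxx.
rewrite !big_ord_recl -ih -[u ord0 in LHS]scale1r (Am k x) scale1r //.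
Qed.

(** In [S j] the first [j] arguments are expanded, yet the sum runs over all [f]; the values of [f]
    at the other places do not matter. Expanding one more argument thus costs a factor [n], and the
    total factor n^n is cancelled at the end. *)
Lemma mlin_expand (A : ('I_n -> X) -> V) (u : 'I_n -> 'I_n -> X) : multilinear A ->
  A (fun k => \sum_(i < n) u k i) = \sum_(f : {ffun 'I_n -> 'I_n}) A (fun k => u k (f k)).
Proof.
move=> Am.
pose arg j (f : {ffun 'I_n -> 'I_n}) (k : 'I_n) :=
  if (k < j)%N then u k (f k) else \sum_(i < n) u k i.
pose S j := \sum_(f : {ffun 'I_n -> 'I_n}) A (arg j f).
have nn : (n%:R : C) != 0 by rewrite pnatr_eq0 -lt0n.
have step j : (j < n)%N -> S j = n%:R *: S j.+1.
  move=> jn; pose jj := Ordinal jn.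
  pose upd (f : {ffun 'I_n -> 'I_n}) i : {ffun 'I_n -> 'I_n} :=
    [ffun k => if k == jj then i else f k].
  transitivity (\sum_(f : {ffun 'I_n -> 'I_n}) \sum_(i < n) A (arg j.+1 (upd f i))).
    apply: eq_bigr => f _.
    rewrite (_ : arg j f = fupd (arg j f) jj (\sum_(i < n) u jj i)); last first.
      by apply/funext => k; rewrite /fupd /arg; case: eqP => // ->; rewrite ltnn.
    rewrite mlin_sum //; apply: eq_bigr => i _; congr A; apply/funext => k.
    rewrite /fupd /arg /upd ffunE; case: eqP => [->|/eqP kj]; first by rewrite ltnSn.
    have kj' : (k == j :> nat) = false.
      by apply/negbTE; apply: contra kj => /eqP e; apply/eqP/val_inj.
    by rewrite (_ : (k < j.+1)%N = (k < j)%N) // ltnS [LHS]leq_eqVlt kj'.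
  rewrite (pair_big xpredT xpredT (fun f i => A (arg j.+1 (upd f i)))) /=.
  (* An involution exchanging the summation index [i] with the value of [f] at [jj]. *)
  pose h (q : {ffun 'I_n -> 'I_n} * 'I_n) := (upd q.1 q.2, q.1 jj).
  have hK : involutive h.
    move=> [f i]; rewrite /h /=; congr pair; last by rewrite ffunE eqxx.
    by apply/ffunP => k; rewrite !ffunE; case: eqP => // ->.
  rewrite (reindex_inj (inv_inj hK)) /=.
  transitivity (\sum_(q : {ffun 'I_n -> 'I_n} * 'I_n) A (arg j.+1 q.1)).
    apply: eq_bigr => -[f i] _ /=; congr (A (arg _ _)).
    by apply/ffunP => k; rewrite !ffunE; case: eqP => // ->.
  rewrite -(pair_big xpredT xpredT (fun f (_ : 'I_n) => A (arg j.+1 f))) /=.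
  rewrite /S scaler_sumr; apply: eq_bigr => f _.
  by rewrite sumr_const card_ord scaler_nat.
have all j : (j <= n)%N -> S 0%N = n%:R ^+ j *: S j.
  elim: j => [|j ih] jn; first by rewrite expr0 scale1r.
  by rewrite ih ?(ltnW jn) // (step j jn) scalerA exprSr.
have S0 : S 0%N = n%:R ^+ n *: A (fun k => \sum_(i < n) u k i).
  rewrite /S (eq_bigr (fun=> A (fun k => \sum_(i < n) u k i))) //.
  by rewrite sumr_const card_ffun !card_ord -natrX scaler_nat.
have Sn : S n = \sum_(f : {ffun 'I_n -> 'I_n}) A (fun k => u k (f k)).
  by apply: eq_bigr => f _; congr A; apply/funext => k; rewrite /arg ltn_ord.
have := all n (leqnn n); rewrite S0 Sn => h.
by apply: (scalerI _ h); rewrite expf_neq0.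
Qed.

Definition hit (f : {ffun 'I_n -> 'I_n}) (i : 'I_n) := [exists k, f k == i].

Definition surjs : {pred {ffun 'I_n -> 'I_n}} := [pred f | [forall i, hit f i]].

Lemma surjs_gt0 : (0 < #|surjs|)%N.
Proof.
apply/card_gt0P; exists [ffun k => k]; rewrite inE; apply/forallP => i.
by apply/existsP; exists i; rewrite ffunE.
Qed.

Lemma surj_inj f : f \in surjs -> injective f.
Proof.
rewrite inE => /forallP h.
have /choice [g hg] : forall i, exists k, f k = i by move=> i; have /existsP [k /eqP] := h i; exists k.
have gi : injective g by apply: (can_inj (g := f)).
have [g' _ g'K] := injF_bij gi.
by move=> x y; rewrite -(g'K x) -(g'K y) !hg => ->.
Qed.

(** The sign (-1)^(n - |S|) of inclusion-exclusion. *)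
Definition sgn (S : {ffun 'I_n -> bool}) : C := \prod_i (if S i then 1 else -1).

(** Inclusion-exclusion over the sets containing the image of [f]: the sum is a product over [i] in
    which every point missed by [f] contributes 1 - 1. *)
Lemma alt_sum (f : {ffun 'I_n -> 'I_n}) :
  \sum_(S : {ffun 'I_n -> bool}) (if [forall k, S (f k)] then sgn S else 0) =
  (f \in surjs)%:R.
Proof.
pose F i b : C := if b then 1 else if hit f i then 0 else -1.
transitivity (\sum_(S : {ffun 'I_n -> bool}) \prod_i F i (S i)).
  apply: eq_bigr => S _; case: ifP => [/forallP h|/negbT].
    apply: eq_bigr => i _; rewrite /F; case: ifP => Si //; case: ifP => // /existsP [k /eqP fk].
    by have := h k; rewrite fk Si.
  rewrite negb_forall => /existsP [k /negPf hk].
  rewrite (bigD1 (f k)) //= /F hk (_ : hit f (f k)) ?mul0r //.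
  by apply/existsP; exists k.
rewrite -bigA_distr_bigA /=; transitivity (\prod_i (hit f i)%:R : C).
  apply: eq_bigr => i _; rewrite big_bool /F /=.
  by case: (hit f i); rewrite ?addr0 ?subrr.
rewrite [f \in surjs]inE /=; have [/forallP h|] := boolP [forall i, hit f i].
  by rewrite big1 // => i _; rewrite h.
by rewrite negb_forall => /existsP [i /negPf hi]; rewrite (bigD1 i) //= hi mul0r.
Qed.

(** The polarization formula. Surjections of a finite set onto itself are permutations, so the
    divisor is n!; the proofs use only that it is nonzero. *)
Definition polar (P : X -> V) (x : 'I_n -> X) : V :=
  (#|surjs|%:R)^-1 *: \sum_(S : {ffun 'I_n -> bool}) sgn S *: P (\sum_(i | S i) x i).

Lemma polarE (A : ('I_n -> X) -> V) (x : 'I_n -> X) : multilinear A ->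
  polar (fun x => A (fun=> x)) x = (#|surjs|%:R)^-1 *: \sum_(f in surjs) A (x \o f).
Proof.
move=> Am; congr (_ *: _).
transitivity (\sum_(S : {ffun 'I_n -> bool}) \sum_(f : {ffun 'I_n -> 'I_n})
   (if [forall k, S (f k)] then sgn S else 0) *: A (x \o f)).
  apply: eq_bigr => S _.
  rewrite (_ : (fun=> _) = (fun k : 'I_n => \sum_(i < n) if S i then x i else 0)); last first.
    by apply/funext => k; rewrite -big_mkcond.
  rewrite (mlin_expand (fun _ i => if S i then x i else 0)) // scaler_sumr.
  apply: eq_bigr => f _; case: ifP => [/forallP h|/negbT].
    by congr (_ *: A _); apply/funext => k /=; rewrite h.
  rewrite negb_forall => /existsP [k /negPf hk].
  by rewrite (mlin0 (k := k)) ?scaler0 ?scale0r // hk.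
rewrite exchange_big /= [RHS]big_mkcond /=; apply: eq_bigr => f _.
by rewrite -scaler_suml alt_sum; case: ifP => _; rewrite ?scale1r ?scale0r.
Qed.

Lemma polar_multilinear (A : ('I_n -> X) -> V) : multilinear A ->
  multilinear (polar (fun x => A (fun=> x))).
Proof.
move=> Am k x a y z; rewrite !polarE // scalerA mulrC -scalerA -scalerDr; congr (_ *: _).
rewrite scaler_sumr -big_split /=; apply: eq_bigr => f fs.
have [k' hk] : exists k', f k' = k.
  by move: fs; rewrite inE => /forallP /(_ k) /existsP [k' /eqP]; exists k'.
have e w : fupd x k w \o f = fupd (x \o f) k' w.
  by apply/funext => j; rewrite /fupd /= -hk (inj_eq (surj_inj fs)).
by rewrite !e Am.
Qed.

Lemma polar_diag (A : ('I_n -> X) -> V) x : multilinear A ->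
  polar (fun x => A (fun=> x)) (fun=> x) = A (fun=> x).
Proof.
move=> Am; rewrite polarE //.
rewrite (eq_bigr (fun=> A (fun=> x))); last by move=> f _; congr A.
rewrite sumr_const -[A _ *+ _]scaler_nat scalerA mulVf ?scale1r //.
by rewrite pnatr_eq0 -lt0n surjs_gt0.
Qed.

Lemma polar_bounded (P : X -> V) (r M : RR) : 0 <= r ->
  (forall x, rn x <= n%:R * r -> rn (P x) <= M) ->
  exists K : RR, forall x : 'I_n -> X, (forall i, rn (x i) <= r) -> rn (polar P x) <= K.
Proof.
move=> r0 hP; exists ((#|surjs|%:R)^-1 * \sum_(S : {ffun 'I_n -> bool}) M) => x hx.
rewrite /polar rnZ rnV rn_nat; apply: ler_wpM2l; first by rewrite invr_ge0.
apply: le_trans (rn_sum _ _ _) _; apply: ler_sum => S _.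
have rs : rn (sgn S) = 1.
  rewrite /sgn; elim/big_ind: _ => [|u v hu hv|i _]; rewrite ?rn1 ?rnM ?hu ?hv ?mul1r //.
  by case: ifP; rewrite ?rnN rn1.
rewrite rnZ rs mul1r; apply: hP.
apply: le_trans (rn_sum _ _ _) _.
apply: (@le_trans _ _ (\sum_(i | S i) r)); first by apply: ler_sum.
rewrite sumr_const -[r *+ _]mulr_natl; apply: ler_wpM2r => //.
by rewrite ler_nat -[leqRHS]card_ord max_card.
Qed.

Lemma mlin_scale (A : ('I_n -> X) -> V) (a : C) x : multilinear A ->
  A (fun=> a *: x) = a ^+ n *: A (fun=> x).
Proof.
move=> Am.
have h j : (j <= n)%N -> A (fun k => if (k < j)%N then a *: x else x) = a ^+ j *: A (fun=> x).
  elim: j => [|j ih] jn; first by rewrite expr0 scale1r.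
  pose jj := Ordinal jn; pose y k : X := if (k < j)%N then a *: x else x.
  have e w : fupd (fun k : 'I_n => y k) jj w = fun k : 'I_n => if k == jj then w else y k by [].
  have -> : (fun k : 'I_n => if (k < j.+1)%N then a *: x else x) = fupd (fun k : 'I_n => y k) jj (a *: x + 0).
    apply/funext => k; rewrite e addr0 /y ltnS leq_eqVlt -(inj_eq val_inj) /=.
    by case: eqP.
  rewrite Am (mlin0 (x := fupd _ jj 0) (k := jj)) //; last by rewrite /fupd eqxx.
  rewrite addr0 exprS -scalerA -ih; last exact: ltnW.
  congr (_ *: A _); apply/funext => k; rewrite e /y; case: eqP => // ->.
  by rewrite /= ltnn.
rewrite -(h n (leqnn n)); congr A; apply/funext => k; by rewrite ltn_ord.
Qed.

Lemma mlin_cont (A : ('I_n -> X) -> V) :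
  multilinear A ->
  (forall r : RR, 0 <= r -> exists K : RR, forall x : 'I_n -> X, (forall i, rn (x i) <= r) -> rn (A x) <= K) ->
  continuous (fun x => A (fun=> x)).
Proof.
move=> Am hA x; pose r := rn x + 1; have r0 : 0 <= r by have := rn_ge0 x; rewrite /r; lra.
have [K hK] := hA r r0.
have lip y : rn (y - x) <= 1 -> rn (A (fun=> y) - A (fun=> x)) <= n%:R * (rn (y - x) * `|K|).
  (* The arguments [x] are replaced by [y] one at a time, each replacement changing a single slot by
     [y - x]. *)
  move=> yx; pose w j (k : 'I_n) : X := if (k < j)%N then y else x.
  have ry : rn y <= r by have := rn_leB y x; rewrite /r; lra.
  have h j : (j <= n)%N -> rn (A (w j) - A (w 0%N)) <= j%:R * (rn (y - x) * `|K|).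
    elim: j => [|j ih] jn; first by rewrite subrr rn0 mul0r.
    pose jj := Ordinal jn.
    have e1 : w j.+1 = fupd (w j) jj y.
      by apply/funext => k; rewrite /fupd /w ltnS leq_eqVlt -(inj_eq val_inj) /=; case: eqP.
    have e2 : w j = fupd (w j) jj x.
      by apply/funext => k; rewrite /fupd /w; case: eqP => // ->; rewrite /= ltnn.
    have e3 : rn (A (w j.+1) - A (w j)) <= rn (y - x) * `|K|.
      have [yx0|yx0] := eqVneq y x.
        rewrite (_ : w j.+1 = w j) ?subrr ?rn0 ?mulr_ge0 ?rn_ge0 //.
        by apply/funext => k; rewrite /w yx0 !if_same.
      have rz : 0 < rn (y - x) by rewrite rn_gt0 // subr_eq0.
      pose v := (cR (rn (y - x)))^-1 *: (y - x).
      have rv : rn v = 1.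
        by rewrite /v rnZ rnV rn_cR ger0_norm ?rn_ge0 // mulVf // gt_eqF.
      have nz : cR (rn (y - x)) != 0 by rewrite -cR0 (inj_eq cR_inj) gt_eqF.
      have -> : A (w j.+1) - A (w j) = cR (rn (y - x)) *: A (fupd (w j) jj v).
        rewrite e1 [A (w j)](congr1 A e2).
        have ey : y = cR (rn (y - x)) *: v + x.
          by rewrite /v scalerA divff // scale1r subrK.
        by rewrite {1}ey Am addrK.
      rewrite rnZ rn_cR ger0_norm ?rn_ge0 //; apply: ler_wpM2l; first exact: ltW.
      apply: le_trans (hK _ _) (ler_norm _) => k; rewrite /fupd /w.
      case: eqP => _; first by rewrite rv /r; have := rn_ge0 x; lra.
      by case: ifP => _ //; rewrite /r; have := rn_ge0 x; lra.
    have := rn_tri (A (w j)) (A (w j.+1)) (A (w 0%N)).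
    have := ih (ltnW jn); rewrite -natr1 mulrDl mul1r; lra.
  have := h n (leqnn n); congr (rn (_ - A _) <= _).
  by congr A; apply/funext => k; rewrite /w ltn_ord.
apply/rn_cvgP => e e0; apply/rn_nbhs.
pose L := n%:R * `|K| + 1; have L0 : 0 < L by rewrite ltr_wpDl // mulr_ge0.
exists (Num.min 1 (e / L)); first by rewrite lt_min ltr01 divr_gt0.
move=> y; rewrite lt_min ltr_pdivlMr // => /andP[h1 h2].
apply: le_lt_trans (lip y (ltW h1)) _; have := rn_ge0 (y - x).
have : n%:R * (rn (y - x) * `|K|) = rn (y - x) * (n%:R * `|K|) by ring.
rewrite /L in h2; nra.
Qed.
End Polarization.

Section HPoly.
Variables (X V : normedModType C) (n : nat).
Hypothesis n0 : (0 < n)%N.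

Lemma hpoly_homog (P : X -> V) (a : C) x : hpoly n P -> P (a *: x) = a ^+ n *: P x.
Proof. by move=> [_ [A [Am PA]]]; rewrite !PA mlin_scale. Qed.

Lemma hpoly_bounded (P : X -> V) : hpoly n P ->
  forall r : RR, exists M : RR, forall x, rn x <= r -> rn (P x) <= M.
Proof.
move=> hP r; have P0 : P 0 = 0.
  by have := hpoly_homog 0 0 hP; rewrite scaler0 expr0n -[n == 0%N]negbK -lt0n n0 scale0r.
have /rn_cvgP /(_ 1 ltr01) /rn_nbhs [d d0 hd] := hP.1 0.
pose R := Num.max r 1; have R0 : 0 < R by rewrite lt_max ltr01 orbT.
pose a := d / (2 * R); have a0 : 0 < a by rewrite divr_gt0 ?mulr_gt0.
have ca : cR a != 0 by rewrite -cR0 (inj_eq cR_inj) gt_eqF.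
exists ((a^-1) ^+ n) => x xr.
have hx : rn (P (cR a *: x)) <= 1.
  apply: ltW; have := hd (cR a *: x); rewrite P0 !subr0; apply.
  rewrite rnZ rn_cR gtr0_norm //; apply: (@le_lt_trans _ _ (a * R)).
    by apply: ler_wpM2l; [exact: ltW | rewrite le_max xr].
  have Rn : R != 0 by rewrite gt_eqF.
  have -> : a * R = d / 2 by rewrite /a; field.
  by rewrite ltr_pdivrMr // ltr_pMr // ltr1n.
have -> : P x = (cR a)^-1 ^+ n *: P (cR a *: x).
  by rewrite -hpoly_homog // scalerA mulVf // scale1r.
rewrite rnZ rnX rnV rn_cR gtr0_norm // -[leRHS]mulr1; apply: ler_wpM2l => //.
by rewrite exprn_ge0 // invr_ge0 ltW.
Qed.

(** Continuity is traded for boundedness on balls, which, unlike continuity, passes to pointwise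
    limits. *)
Lemma hpoly_of_polar (T : X -> V) : multilinear (@polar X V n T) ->
  (forall x, @polar X V n T (fun=> x) = T x) ->
  (forall r : RR, exists M : RR, forall x, rn x <= r -> rn (T x) <= M) -> hpoly n T.
Proof.
move=> Tm Td Tb; split; last by exists (@polar X V n T); split => // x; rewrite Td.
rewrite (_ : T = (fun x => polar T (fun _ : 'I_n => x))); last by apply/funext => x.
apply: mlin_cont => // r r0; have [M hM] := Tb (n%:R * r).
exact: polar_bounded hM.
Qed.

Lemma hpoly_polar (P : X -> V) : hpoly n P ->
  multilinear (@polar X V n P) /\ forall x, @polar X V n P (fun=> x) = P x.
Proof.
move=> [_ [A [Am PA]]].
have -> : P = (fun x => A (fun=> x)) by apply/funext => x; exact: PA.
by split; [exact: polar_multilinear | move=> x; exact: polar_diag].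
Qed.

Lemma Lim_polar b (I : Type) (U : set_system I) (UF : ProperFilter U) (u : I -> X -> V) (T : X -> V) x :
  (forall x, Lim b U (fun s => u s x) (T x)) ->
  Lim b U (fun s => @polar X V n (u s) x) (@polar X V n T x).
Proof.
by move=> h; apply: LimZ; apply: Lim_sum => S; exact: h.
Qed.

(* The polar form commutes with limits. *)
Lemma hpoly_limit b (I : Type) (U : set_system I) (UF : ProperFilter U) (u : I -> X -> V) (T : X -> V) :
  (forall x, Lim b U (fun s => u s x) (T x)) ->
  (forall k x a y z, U [set s | @polar X V n (u s) (fupd x k (a *: y + z)) =
     a *: @polar X V n (u s) (fupd x k y) + @polar X V n (u s) (fupd x k z)]) ->
  (forall x, U [set s | @polar X V n (u s) (fun=> x) = u s x]) ->
  (forall r : RR, exists M : RR, forall x, rn x <= r -> rn (T x) <= M) -> hpoly n T.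
Proof.
move=> hT hm hd hb; apply: hpoly_of_polar => // [k x a y z|x].
  apply: (Lim_uniq (Lim_polar UF (fupd x k (a *: y + z)) hT)).
  apply: Lim_ext (Lim_lin a (Lim_polar UF (fupd x k y) hT) (Lim_polar UF (fupd x k z) hT)).
  by apply: filterS (hm k x a y z) => s /= ->.
apply: (Lim_uniq (Lim_polar UF (fun=> x) hT)).
by apply: Lim_ext (hT x); apply: filterS (hd x) => s /= ->.
Qed.
End HPoly.

(** * Holomorphic maps *)

Lemma differentiable_rnP (X V : normedModType C) (f : X -> V) (x : X) :
  differentiable f x <-> exists D : X -> V, [/\ clinear D, continuous D &
    forall e : RR, 0 < e -> exists2 d : RR, 0 < d &
      forall h, rn h < d -> rn (f (x + h) - f x - D h) <= e * rn h].
Proof.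
split.
  move=> /diff_locallyP [Dc /eqaddoP Do]; exists ('d f x); split => //.
    by move=> a u v; rewrite linearP.
  move=> e e0; have ce : 0 < cR e by rewrite -cR0 cR_lt.
  have /rn_nbhs [d d0 hd] := Do _ ce; exists d => // h hh.
  have := hd h; rewrite subr0 => /(_ hh).
  rewrite -[(_ - _) h]/(f (h + x) - (f x + 'd f x h)).
  by rewrite !rnE -cRM cR_le (addrC h x) opprD addrA.
move=> [D [Dl Dc hD]].
pose D' : {linear X -> V} := HB.pack D (GRing.isLinear.Build _ _ _ _ _ (Dl : linear D)).
have o : f \o shift x = cst (f x) + D' +o_ 0 id.
  apply/eqaddoP => _ /gt0_cR [e e0 ->]; apply/rn_nbhs; have [d d0 hd] := hD e e0.
  exists d => // h; rewrite subr0 => /hd.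
  rewrite -[(_ - _) h]/(f (h + x) - (f x + D h)).
  by rewrite !rnE -cRM cR_le (addrC h x) opprD addrA.
have e : 'd f x = D' :> (X -> V) by exact: diff_unique.
by apply/diff_locallyP; rewrite e; split.
Qed.

Definition bddballs (X V : normedModType C) (F : X -> V) : Prop :=
  forall r : RR, exists M : RR, forall x, rn x <= r -> rn (F x) <= M.

Lemma bddballs_C (X V : normedModType C) (F : X -> V) :
  (forall r : C, exists M : C, forall x, `|x| <= r -> `|F x| <= M) <-> bddballs F.
Proof.
split=> h r.
  have [M hM] := h (cR r); exists (complex.Re M) => x xr.
  have := hM x; rewrite !rnE cR_le => /(_ xr) /le_cR [m -> hm] //.
have [M hM] := h (complex.Re r); exists (cR M) => x; rewrite !rnE => h1.
have [m rm xm] := le_cR h1; rewrite cR_le; apply: hM; by rewrite rm.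
Qed.

Lemma Hb_bddballs (X V : normedModType C) (F : X -> V) : Hb F -> bddballs F.
Proof. by move=> [_ /bddballs_C]. Qed.

(** The difference quotients at [x] in the direction [h] depend in a Lipschitz manner on the scalar
    increment. Multiplying by [b * d] removes the denominators and leaves a bound on a finite
    combination of values, which survives limits. *)
Definition diff2 (X V : normedModType C) (F : X -> V) : Prop :=
  forall r : RR, exists M : RR, forall x h, rn x <= r -> rn h <= 1 ->
    forall b d : C, rn b <= 1 -> rn d <= 1 ->
    rn (d *: (F (x + b *: h) - F x) - b *: (F (x + d *: h) - F x)) <=
    rn b * rn d * rn (b - d) * M.

Lemma Hb_cdiff (X V : normedModType C) (F : X -> V) x h : Hb F ->
  forall p, cdiff (fun z => F (x + z *: h)) p.
Proof.
move=> [/(_ (x + _)) Fd _] p.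
have /differentiable_rnP [D [Dl Dc hD]] := Fd (p *: h).
exists (D h) => e e0.
have rh1 : 0 < rn h + 1 by have := rn_ge0 h; lra.
have [d d0 hd] := hD (e / (rn h + 1)) (divr_gt0 e0 rh1).
exists (d / (rn h + 1)); first by rewrite divr_gt0.
move=> w; rewrite ltr_pdivlMr // => hw.
have h1 := hd ((w - p) *: h).
have e1 : x + p *: h + (w - p) *: h = x + w *: h by module.
rewrite rnZ e1 (clinZ Dl) in h1.
apply: le_trans (h1 _) _; first by have := rn_ge0 (w - p); nra.
rewrite (_ : e / _ * _ = e * rn (w - p) * (rn h / (rn h + 1))); last by ring.
apply: ler_piMr; first by rewrite mulr_ge0 ?rn_ge0 // ltW.
by rewrite ler_pdivrMr // mul1r; lra.
Qed.

Lemma Hb_diff2 (X V : normedModType C) (F : X -> V) : Hb F -> diff2 F.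
Proof.
move=> HF r; have [M hM] := Hb_bddballs HF (r + 2).
exists `|M| => x h xr h1 b d b1 d1.
have := @cauchy_diff2 V (fun z => F (x + z *: h)) `|M| b d (Hb_cdiff x h HF).
rewrite scale0r addr0; apply => // w w2; apply: le_trans (ler_norm M); apply: hM.
by apply: le_trans (rnD _ _) _; rewrite rnZ w2; lra.
Qed.

Lemma Hb_comb (X V : normedModType C) (F : X -> V) (r rho e : RR) : Hb F ->
  0 <= r -> 0 < rho -> 0 < e ->
  exists n (c a : 'I_n -> C), (forall j, rn (a j) <= rho) /\
    forall x, rn x <= r -> rn (F x - \sum_(j < n) c j *: F (a j *: x)) <= e.
Proof.
move=> HF r0 rho0 e0; have [M hM] := Hb_bddballs HF (4 * r).
have M1 : 0 < `|M| + 1 by have := normr_ge0 M; lra.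
have [n [c [a [ha hg]]]] := cauchy_small rho0 (divr_gt0 e0 M1).
exists n, c, a; split => // x xr.
have := hg V (fun z => F (0 + z *: x)) `|M| (Hb_cdiff 0 x HF) (normr_ge0 _).
rewrite add0r scale1r (eq_bigr (fun j => c j *: F (a j *: x))); last first.
  by move=> j _; rewrite add0r.
move=> h; apply: le_trans (h _) _.
  move=> w w4; rewrite add0r; apply: le_trans (ler_norm M); apply: hM.
  by rewrite rnZ w4; apply: ler_wpM2l.
by rewrite mulrAC ler_pdivrMr //; apply: ler_wpM2l; [exact: ltW | lra].
Qed.

(** Compactness near the origin spreads to every ball: by [Hb_comb], values on the ball are, up to
    [e], fixed combinations of values on [W], and such combinations form a compact set. *)
Lemma Hb_relL b (X : normedModType C) (V : completeNormedModType C) (F : X -> V) (W : set X) :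
  Hb F -> nbhs 0 W -> relL b (F @` W) -> forall r : RR, relL b (F @` [set x | rn x <= r]).
Proof.
move=> HF /rn_nbhs [d d0 hd] [K hK FK] r.
pose R := Num.max r 1; have R0 : 0 < R by rewrite lt_max ltr01 orbT.
apply: relL_approx => e e0.
have rho0 : 0 < d / (2 * R) by rewrite divr_gt0 ?mulr_gt0.
have [n [c [a [ha hg]]]] := Hb_comb HF (ltW R0) rho0 e0.
exists [set x | exists k : 'I_n -> V, (forall j, K (k j)) /\ x = \sum_(j < n) c j *: k j].
  exact: Lcompact_comb.
move=> _ [x /= xr <-]; have xR : rn x <= R by rewrite le_max xr.
exists (\sum_(j < n) c j *: F (a j *: x)); last exact: hg.
exists (fun j => F (a j *: x)); split => // j; apply: FK; exists (a j *: x) => //.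
apply: hd; rewrite subr0 rnZ.
apply: (@le_lt_trans _ _ (d / (2 * R) * R)); first by apply: ler_pM; rewrite ?rn_ge0.
have Rn : R != 0 by rewrite gt_eqF.
have -> : d / (2 * R) * R = d / 2 by field.
by rewrite ltr_pdivrMr // ltr_pMr // ltr1n.
Qed.

Lemma diff2_quot (X V : normedModType C) (F : X -> V) : diff2 F ->
  forall r : RR, exists2 M : RR, 0 < M & forall x h, rn x <= r -> rn h <= 1 ->
    forall b d : C, b != 0 -> d != 0 -> rn b <= 1 -> rn d <= 1 ->
    rn (b^-1 *: (F (x + b *: h) - F x) - d^-1 *: (F (x + d *: h) - F x)) <= rn (b - d) * M.
Proof.
move=> F2 r; have [M hM] := F2 r; exists (`|M| + 1); first by have := normr_ge0 M; lra.
move=> x h xr h1 b d b0 d0 b1 d1; have := hM x h xr h1 b d b1 d1.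
have rb := rn_gt0 b0; have rd := rn_gt0 d0.
rewrite (_ : d *: _ - b *: _ = (b * d) *: (b^-1 *: (F (x + b *: h) - F x) -
  d^-1 *: (F (x + d *: h) - F x))); last first.
  by module_core (GRing.PzRing.sort (C : pzRingType)); field; rewrite ?b0 ?d0.
rewrite rnZ rnM -(mulrA (rn b * rn d)) => h2.
have rbd : 0 < rn b * rn d by rewrite mulr_gt0.
move: h2; rewrite ler_pM2l // => h2; apply: le_trans h2 _.
by apply: ler_wpM2l; [exact: rn_ge0 | have := ler_norm M; lra].
Qed.

Lemma hp_anti k j : (k <= j)%N -> hp j <= hp k.
Proof.
move=> /subnKC <-; elim: (j - k)%N => [|n ih]; rewrite ?addn0 // addnS hpS.
by have := hp_gt0 (k + n)%N; lra.
Qed.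

Lemma rn_hp k : rn (cR (hp k)) = hp k.
Proof. by rewrite rn_cR gtr0_norm ?hp_gt0. Qed.
Lemma cR_neq0 (a : RR) : a != 0 -> cR a != 0.
Proof. by rewrite -cR0 (inj_eq cR_inj). Qed.
Lemma hp_neq0 k : cR (hp k) != 0.
Proof. by rewrite cR_neq0 // gt_eqF ?hp_gt0. Qed.

(** The limit comes before the constant in the conclusion, since one derivative must serve the
    Lipschitz constants of all balls containing the base point. *)
Lemma quot_limit (V : completeNormedModType C) (Q : C -> V) :
  (exists2 M : RR, 0 < M & forall b d : C, b != 0 -> d != 0 -> rn b <= 1 -> rn d <= 1 ->
     rn (Q b - Q d) <= rn (b - d) * M) ->
  exists l : V, forall M : RR, 0 < M ->
    (forall b d : C, b != 0 -> d != 0 -> rn b <= 1 -> rn d <= 1 ->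
     rn (Q b - Q d) <= rn (b - d) * M) ->
    forall b : C, b != 0 -> rn b <= 1 -> rn (Q b - l) <= rn b * M.
Proof.
move=> [M M0 hM].
(* Shifting the sequence by [m] absorbs the Lipschitz constant, as [hp m * M < 1]. *)
have [m hm] := hp_lt (divr_gt0 ltr01 M0).
have [k j kj|l hl] := @cauchy_seq_lim V (fun k => Q (cR (hp (k + m)))).
  have kj' : (k + m <= j + m)%N by rewrite leq_add2r.
  apply: le_trans (hM _ _ (hp_neq0 _) (hp_neq0 _) _ _) _; rewrite ?rn_hp ?hp_le1 //.
  rewrite -cRB rn_cR distrC ger0_norm; last by have := hp_anti kj'; lra.
  have -> : hp (k + m) = hp k * hp m by rewrite /hp exprD.
  have := hp_gt0 (j + m)%N; have := hp_gt0 k; have := hp_gt0 m.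
  by move: hm; rewrite ltr_pdivlMr // => hm p1 p2 p3; nra.
exists l => M' M'0 hM' b b0 b1; apply/ler_addgt0Pr => e e0.
have eM : 0 < e / (M' + 1) by rewrite divr_gt0 //; lra.
have [k hk] := hp_lt eM.
have h2 := hM' b (cR (hp (k + m))) b0 (hp_neq0 _) b1; rewrite rn_hp hp_le1 in h2.
have {}h2 := h2 isT; have h3 := hl k; have hkm : hp (k + m) <= hp k by apply: hp_anti; exact: leq_addr.
have h4 := rn_tri (Q (cR (hp (k + m)))) (Q b) l.
have h5 : rn (b - cR (hp (k + m))) <= rn b + hp k.
  by apply: le_trans (rnBD _ _) _; rewrite rn_hp; lra.
move: hk; rewrite ltr_pdivlMr; last lra.
have h6 := ler_wpM2r (ltW M'0) h5.
by have := hp_gt0 k; lra.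
Qed.

(** * From quadratic remainders to the derivative *)

Section Gateaux.
Variables (X V : normedModType C) (F : X -> V) (D : X -> X -> V) (R M : RR).
Hypothesis M0 : 0 < M.
Hypothesis key : forall y h (b : C), rn y <= R -> rn b * (rn h + 1) <= 1 ->
  rn (F (y + b *: h) - F y - b *: D y h) <= (rn b * (rn h + 1)) ^+ 2 * M.

Let sqm (c d : RR) : 0 <= c -> c <= d -> c ^+ 2 * M <= d ^+ 2 * M.
Proof. by move=> c0 cd; rewrite ler_pM2r // !expr2; apply: ler_pM. Qed.

Let keyA y h (b : C) (c A : RR) : rn y <= R -> rn b = c -> c * A <= 1 -> rn h + 1 <= A ->
  rn (F (y + b *: h) - F y - b *: D y h) <= (c * A) ^+ 2 * M.
Proof.
move=> yR <- cA hA; have bA : rn b * (rn h + 1) <= rn b * A by rewrite ler_wpM2l ?rn_ge0.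
apply: le_trans (key yR (le_trans bA cA)) _; apply: sqm => //.
by rewrite mulr_ge0 ?rn_ge0 // addr_ge0 ?rn_ge0.
Qed.

(** The increment along a small multiple of [a *: h] is expanded with direction [a *: h] and with
    direction [h]; the quadratic remainders vanish after division by the step. *)
Lemma gateauxZ x (a : C) h : rn x <= R -> D x (a *: h) = a *: D x h.
Proof.
move=> xle; apply/eqP; rewrite -subr_eq0; apply/eqP; apply: rn_eps0 => e e0.
have [A [A0 A1 A2]] : exists A : RR, [/\ 0 < A, rn (a *: h) + 1 <= A & rn a * (rn h + 1) <= A].
  exists (rn (a *: h) + 1 + rn a * (rn h + 1)).
  have ra := rn_ge0 a; have rh := rn_ge0 h; have rah := rn_ge0 (a *: h).
  have := mulr_ge0 ra rh; split; lra.
have s0 : 0 < Num.min A^-1 (e / (A ^+ 2 * M * 2)).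
  by rewrite lt_min invr_gt0 A0 divr_gt0 // !mulr_gt0 // exprn_gt0.
have [k] := hp_lt s0; rewrite lt_min => /andP[k1 k2]; have p0 := hp_gt0 k.
have hkA : hp k * A <= 1 by rewrite -ler_pdivlMr // div1r ltW.
have h1 := keyA xle (rn_hp k) hkA A1.
have h2 : rn (F (x + (cR (hp k) * a) *: h) - F x - (cR (hp k) * a) *: D x h) <= (hp k * A) ^+ 2 * M.
  have le : rn (cR (hp k) * a) * (rn h + 1) <= hp k * A by rewrite rnM rn_hp -mulrA ler_pM2l.
  apply: le_trans (key xle (le_trans le hkA)) _; apply: sqm => //.
  by rewrite mulr_ge0 ?rn_ge0 // addr_ge0 ?rn_ge0.
rewrite -scalerA in h2.
have : rn (cR (hp k) *: (D x (a *: h) - a *: D x h)) <= (hp k * A) ^+ 2 * M * 2.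
  rewrite (_ : cR _ *: _ = (F (x + cR (hp k) *: (a *: h)) - F x - (cR (hp k) * a) *: D x h)
    - (F (x + cR (hp k) *: (a *: h)) - F x - cR (hp k) *: D x (a *: h))); last by module.
  by apply: le_trans (rnBD _ _) _; rewrite mulr_natr mulr2n; exact: lerD.
rewrite rnZ rn_hp (_ : _ * 2 = hp k * (hp k * (A ^+ 2 * M * 2))); last by ring.
rewrite ler_pM2l // => h3; apply: le_trans h3 _.
by rewrite -ler_pdivlMr ?ltW // !mulr_gt0 // exprn_gt0.
Qed.

(* Comparing the increments along [h + k] with those along [h] and then [k] at scale [t ^ 2],
   after comparing [D y k] with [D x k], [y = x + t ^ 2 h], at scale [t]. *)
Lemma gateauxD x h k (K : RR) : rn x + 1 <= R -> 0 < K ->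
  (forall y u (b : C), rn y <= R -> rn b * (rn u + 1) <= 1 ->
     rn (F (y + b *: u) - F y) <= rn b * (rn u + 1) * K) ->
  D x (h + k) = D x h + D x k.
Proof.
move=> xR K0 lip; have xle : rn x <= R by apply: le_trans xR; rewrite lerDl.
apply/eqP; rewrite -subr_eq0; apply/eqP; apply: rn_eps0 => e e0.
have [A [A0 Ah Ak Ahk]] : exists A : RR,
    [/\ 0 < A, rn h + 1 <= A, rn k + 1 <= A & rn (h + k) + 1 <= A].
  exists (rn h + rn k + 1); have := rnD h k; have := rn_ge0 h; have := rn_ge0 k.
  by split; lra.
have [t [t0 t1 tA tN]] : exists t : RR,
    [/\ 0 < t, t <= 1, t * A <= 1 & t * (5 * (A ^+ 2 * M) + 2 * (A * K)) <= e].
  have AM : 0 < A ^+ 2 * M by rewrite mulr_gt0 // exprn_gt0.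
  have AK : 0 < A * K by rewrite mulr_gt0.
  have N0 : 0 < 5 * (A ^+ 2 * M) + 2 * (A * K) by lra.
  have s0 : 0 < Num.min A^-1 (e / (5 * (A ^+ 2 * M) + 2 * (A * K))).
    by rewrite lt_min invr_gt0 A0 divr_gt0.
  have [j] := hp_lt s0; rewrite lt_min => /andP[k1 k2].
  exists (hp j); rewrite hp_gt0 hp_le1 -!ler_pdivlMr // div1r; split=> //; exact: ltW.
have tb : t * t * A <= 1.
  by rewrite -mulrA; apply: le_trans (ler_piMl _ t1) tA; rewrite mulr_ge0 // ltW.
have rt : rn (cR t) = t by rewrite rn_cR gtr0_norm.
have rb : rn (cR (t * t)) = t * t by rewrite rn_cR gtr0_norm ?mulr_gt0.
have near (c : RR) u : 0 < c -> c * A <= 1 -> rn u + 1 <= A -> rn (x + cR c *: u) <= R.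
  move=> c0 cA uA; apply: le_trans (rnD _ _) _; rewrite rnZ rn_cR gtr0_norm //.
  apply: le_trans xR; rewrite lerD2l; apply: le_trans cA; rewrite ler_pM2l //.
  by apply: le_trans uA; rewrite lerDl.
have ry := near _ _ (mulr_gt0 t0 t0) tb Ah; have rtk := near _ _ t0 tA Ak.
have lipA z : rn z <= R -> rn (F (z + cR (t * t) *: h) - F z) <= t * t * A * K.
  move=> zR; have le : rn (cR (t * t)) * (rn h + 1) <= t * t * A.
    by rewrite rb ler_pM2l // mulr_gt0.
  by apply: le_trans (lip _ _ _ zR (le_trans le tb)) _; rewrite ler_pM2r.
have E1 := keyA xle rb tb Ahk; have E2 := keyA xle rb tb Ah.
have E3 := keyA ry rb tb Ak; have E4 := keyA ry rt tA Ak; have E5 := keyA xle rt tA Ak.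
have E6 := lipA _ rtk; have E7 := lipA _ xle.
set y := x + cR (t * t) *: h in E2 E3 E4 E7 ry.
have e1 : x + cR t *: k + cR (t * t) *: h = y + cR t *: k by rewrite /y; module.
have e2 : x + cR (t * t) *: (h + k) = y + cR (t * t) *: k by rewrite /y; module.
rewrite e1 in E6; rewrite e2 in E1.
have P1 : t * rn (D y k - D x k) <= t * (2 * (t * (A ^+ 2 * M)) + 2 * (t * (A * K))).
  rewrite -{1}rt -rnZ.
  rewrite (_ : cR t *: _ = (F (x + cR t *: k) - F x - cR t *: D x k)
    - (F (y + cR t *: k) - F y - cR t *: D y k)
    + ((F (y + cR t *: k) - F (x + cR t *: k)) - (F y - F x))); last by module.
  apply: le_trans (rnD _ _) _; apply: le_trans (lerD (rnBD _ _) (rnBD _ _)) _.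
  apply: le_trans (lerD (lerD E5 E4) (lerD E6 E7)) _.
  by rewrite le_eqVlt; apply/orP; left; apply/eqP; ring.
rewrite ler_pM2l // in P1.
have S1 : t * t * rn (D x (h + k) - (D x h + D x k)) <=
    t * t * (3 * (t * t * (A ^+ 2 * M)) + rn (D y k - D x k)).
  have bE u : rn (cR (t * t) *: (u : V)) = t * t * rn u by rewrite rnZ rb.
  rewrite mulrDr -!bE.
  rewrite (_ : cR (t * t) *: _ = (F (y + cR (t * t) *: k) - F y - cR (t * t) *: D y k)
    + (F y - F x - cR (t * t) *: D x h)
    - (F (y + cR (t * t) *: k) - F x - cR (t * t) *: D x (h + k))
    + cR (t * t) *: (D y k - D x k)); last by module.
  apply: le_trans (rnD _ _) _; apply: lerD => //.
  apply: le_trans (rnBD _ _) _; apply: le_trans (lerD (rnD _ _) (lexx _)) _.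
  apply: le_trans (lerD (lerD E3 E2) E1) _.
  by rewrite le_eqVlt; apply/orP; left; apply/eqP; ring.
rewrite ler_pM2l ?mulr_gt0 // in S1; apply: le_trans S1 _; apply: le_trans (lerD (_ : _ <= 3 * (t * (A ^+ 2 * M))) P1) _.
  by apply: ler_wpM2l => //; rewrite -mulrA; apply: (ler_piMl _ t1); rewrite !mulr_ge0 ?exprn_ge0 // ltW.
by apply: le_trans tN; rewrite le_eqVlt; apply/orP; left; apply/eqP; ring.
Qed.
End Gateaux.

Lemma gateaux_frechet (X V : normedModType C) (F D : X -> V) (x : X) (K M : RR) :
  clinear D -> (forall h, rn (D h) <= K * (rn h + 1)) -> 0 < M ->
  (forall h (b : C), rn b * (rn h + 1) <= 1 ->
     rn (F (x + b *: h) - F x - b *: D h) <= (rn b * (rn h + 1)) ^+ 2 * M) ->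
  differentiable F x.
Proof.
move=> Dl Db M0 key; apply/differentiable_rnP; exists D.
have DZ := clinZ Dl.
have unit (h : X) : h != 0 -> h = cR (rn h) *: ((cR (rn h))^-1 *: h) /\ rn ((cR (rn h))^-1 *: h) = 1.
  move=> h0; have rh := rn_gt0 h0; have n1 : cR (rn h) != 0 by rewrite cR_neq0 // gt_eqF.
  split; first by rewrite scalerA divff // scale1r.
  by rewrite rnZ rnV rn_cR gtr0_norm // mulVf // gt_eqF.
split => //.
  apply: (clin_cont Dl (K := K * 2)) => h.
  have [->|h0] := eqVneq h 0; first by rewrite (clin0 Dl) !rn0 mulr0.
  have [e1 e2] := unit h h0; rewrite {1}e1 DZ rnZ rn_cR ger0_norm ?rn_ge0 // mulrC.
  apply: ler_wpM2r; first exact: rn_ge0.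
  by have := Db ((cR (rn h))^-1 *: h); rewrite e2.
(* For a unit direction and step [rn h] the remainder is at most 4 M times the square of [rn h]; the
   bound 1/2 makes the step admissible. *)
move=> e e0; exists (Num.min 2^-1 (e / (4 * M))).
  by rewrite lt_min invr_gt0 divr_gt0 //; lra.
move=> h; rewrite lt_min => /andP[h1 h2].
have [->|h0] := eqVneq h 0; first by rewrite addr0 subrr (clin0 Dl) subrr !rn0 mulr0.
have [e1 e2] := unit h h0; have rh := rn_gt0 h0.
have := key ((cR (rn h))^-1 *: h) (cR (rn h)).
rewrite -e1 -DZ -e1 e2 rn_cR gtr0_norm // => h3; apply: le_trans (h3 _) _; first by lra.
move: h2; rewrite ltr_pdivlMr; last lra.
by nra.
Qed.

(** The converse of [Hb_diff2]. Completeness yields directional derivatives with quadratic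
    remainders uniform on balls, and this uniformity, not mere existence, gives additivity in the
    direction. *)
Lemma diff2_Hb (X : normedModType C) (V : completeNormedModType C) (F : X -> V) :
  bddballs F -> diff2 F -> Hb F.
Proof.
move=> Fb /diff2_quot F2; split; last exact/bddballs_C.
pose Q (xh : X * X) (b : C) := b^-1 *: (F (xh.1 + b *: xh.2) - F xh.1).
have /choice [D1 hD1] : forall xh : X * X, exists l : V, rn xh.2 <= 1 -> forall M : RR, 0 < M ->
    (forall b d : C, b != 0 -> d != 0 -> rn b <= 1 -> rn d <= 1 ->
     rn (Q xh b - Q xh d) <= rn (b - d) * M) ->
    forall b : C, b != 0 -> rn b <= 1 -> rn (Q xh b - l) <= rn b * M.
  move=> [x h]; have [h1|hn] := pselect (rn h <= 1); last by exists 0 => h1; case: hn.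
  have [M M0 hM] := F2 (rn x).
  have [|l hl] := @quot_limit V (Q (x, h)); last by exists l.
  by exists M => // b d; apply: hM.
(* Directions are scaled by [rn h + 1] rather than [rn h], so that zero is no special case;
   homogeneity is recovered by [gateauxZ]. *)
pose D x h : V := cR (rn h + 1) *: D1 (x, (cR (rn h + 1))^-1 *: h).
have a0 h : 0 < rn (h : X) + 1 by have := rn_ge0 h; lra.
have ca h : cR (rn (h : X) + 1) != 0 by rewrite cR_neq0 // gt_eqF.
have key r : exists2 M : RR, 0 < M & forall y h (b : C), rn y <= r -> rn b * (rn h + 1) <= 1 ->
    rn (F (y + b *: h) - F y - b *: D y h) <= (rn b * (rn h + 1)) ^+ 2 * M.
  have [M M0 hM] := F2 r; exists M => // y h b yr b1; set a := rn h + 1 in b1 *.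
  have [->|b0] := eqVneq b 0.
    by rewrite !scale0r addr0 subrr subr0 !rn0 mul0r expr0n mul0r.
  have h1 : rn ((cR a)^-1 *: h) <= 1.
    rewrite rnZ rnV rn_cR (gtr0_norm (a0 h)) mulrC ler_pdivrMr ?a0 // mul1r /a; lra.
  have b0' : b * cR a != 0 by rewrite mulf_neq0 ?ca.
  have rba : rn (b * cR a) = rn b * a by rewrite rnM rn_cR (gtr0_norm (a0 h)).
  have b1' : rn (b * cR a) <= 1 by rewrite rba.
  have := hD1 (y, (cR a)^-1 *: h) h1 M M0 (hM y _ yr h1) (b * cR a) b0' b1'.
  rewrite /Q /= scalerA mulfK ?ca // => h2.
  rewrite (_ : _ - _ = (b * cR a) *: ((b * cR a)^-1 *: (F (y + b *: h) - F y)
     - D1 (y, (cR a)^-1 *: h))); last first.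
    by rewrite /D -/a; module_core (GRing.PzRing.sort (C : pzRingType)); field; rewrite ?b0 ?ca.
  rewrite rnZ rba (_ : (rn b * a) ^+ 2 * M = rn b * a * (rn b * a * M)); last by ring.
  by apply: ler_wpM2l; rewrite ?mulr_ge0 ?rn_ge0 ?(ltW (a0 h)) // -rba.
move=> x.
(* Base points near [x] stay within [rn x + 1], and the points reached from them by an admissible
   step within [rn x + 2]. *)
have [M M0 {}key] := key (rn x + 1); have [B hB] := Fb (rn x + 2).
pose K : RR := 2 * `|B| + M; have B0 := normr_ge0 B.
have K0 : 0 < K by rewrite /K; lra.
have Dbound y h : rn y <= rn x + 1 -> rn (D y h) <= K * (rn h + 1).
  move=> yr; pose b := cR (rn h + 1)^-1.
  have rb : rn b = (rn h + 1)^-1 by rewrite rn_cR gtr0_norm // invr_gt0.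
  have := key y h b yr; rewrite rb mulVf ?gt_eqF // lexx expr1n mul1r => /(_ isT) h1.
  have h2 : rn (F (y + b *: h)) <= `|B|.
    apply: le_trans (hB _ _) (ler_norm _); apply: le_trans (rnD _ _) _.
    rewrite rnZ rb; have : (rn h + 1)^-1 * rn h <= 1.
      by rewrite mulrC ler_pdivrMr // mul1r; lra.
    lra.
  have h3 : rn (F y) <= `|B| by apply: le_trans (hB _ _) (ler_norm _); lra.
  rewrite mulrC -ler_pdivrMl // -rb -rnZ.
  have := rn_tri (F (y + b *: h) - F y) (b *: D y h) 0; rewrite !subr0.
  by have := rnBD (F (y + b *: h)) (F y); rewrite (rnB (b *: D y h) (F (y + b *: h) - F y)) /K; lra.
have lip y h (b : C) : rn y <= rn x + 1 -> rn b * (rn h + 1) <= 1 ->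
    rn (F (y + b *: h) - F y) <= rn b * (rn h + 1) * (K + M).
  move=> yr b1; have h1 := key y h b yr b1; have h2 := Dbound y h yr.
  have := rnD (F (y + b *: h) - F y - b *: D y h) (b *: D y h); rewrite subrK rnZ => h3.
  apply: le_trans h3 _; have c0 : 0 <= rn b * (rn h + 1) by rewrite mulr_ge0 ?rn_ge0 // ltW.
  have := ler_wpM2l (rn_ge0 b) h2; set c : RR := rn b * (rn h + 1) in b1 c0 h1 *.
  have : c ^+ 2 * M <= c * M by rewrite expr2 -mulrA; apply: ler_piMl => //; rewrite mulr_ge0 // ltW.
  have -> : rn b * (K * (rn h + 1)) = c * K by rewrite /c; ring.
  by rewrite (mulrDr c K); lra.
have xle : rn x <= rn x + 1 by rewrite lerDl.
have KM : 0 < K + M by exact: addr_gt0.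
have Dl : clinear (D x).
  by move=> a u v; rewrite (gateauxD M0 key _ _ (lexx _) KM lip) (gateauxZ M0 key _ _ xle).
by apply: (gateaux_frechet Dl (K := K) _ M0) => [h|h b]; [exact: Dbound | exact: key].
Qed.

(** * Extensions from locally splitting subspaces *)

Lemma span_of_lin (X : normedModType C) m (s : 'I_m -> X) (a : C) x y :
  span_of s x -> span_of s y -> span_of s (a *: x + y).
Proof.
move=> [c ->] [c' ->]; exists (fun k => a * c k + c' k).
by rewrite scaler_sumr -big_split; apply: eq_bigr => k _ /=; module.
Qed.

Lemma span_of0 (X : normedModType C) m (s : 'I_m -> X) : span_of s 0.
Proof. by exists (fun=> 0); rewrite big1 // => k _; rewrite scale0r. Qed.

Lemma span_of_mem (X : normedModType C) m (s : 'I_m -> X) k : span_of s (s k).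
Proof.
exists (fun j => (j == k)%:R); rewrite (bigD1 k) //= eqxx scale1r big1 ?addr0 // => j /negPf ->.
by rewrite scale0r.
Qed.

Lemma span_of_sum (X : normedModType C) m (s : 'I_m -> X) (I : Type) (r : seq I) (c : I -> C)
  (F : I -> X) : (forall i, span_of s (F i)) -> span_of s (\sum_(i <- r) c i *: F i).
Proof.
move=> h; elim: r => [|i r hr]; first by rewrite big_nil; exact: span_of0.
by rewrite big_cons; apply: span_of_lin.
Qed.

Section Retractions.
Variables (X Y : normedModType C) (i : Y -> X).

(** Any finite set of vectors lies in [rdom s] for [U]-most [s]; outside its domain [retr s] is
    arbitrary. [retr_id] already includes injectivity of [i]. *)
Record retractions (I : Type) (U : set_system I) (lam : RR) := Retractions {
  rdom : I -> set X;
  retr : I -> X -> Y;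
  rdomU : forall x, U [set s | rdom s x];
  rdom0 : forall s, rdom s 0;
  rdom_lin : forall s (a : C) x y, rdom s x -> rdom s y -> rdom s (a *: x + y);
  retr_lin : forall s (a : C) x y, rdom s x -> rdom s y ->
    retr s (a *: x + y) = a *: retr s x + retr s y;
  retr_bound : forall s x, rdom s x -> rn (retr s x) <= lam * rn x;
  retr_id : forall s y, rdom s (i y) -> retr s (i y) = y }.

Lemma locally_splits_retractions : injective i -> locally_splits i ->
  exists (I : Type) (U : set_system I) (lam : RR), UltraFilter U /\ 0 < lam /\
    inhabited (retractions U lam).
Proof.
move=> inji [l [/gt0_cR[lam lam0 ->] hE]].
pose D (s : seq X) := span_of (fun k : 'I_(size s) => nth 0 s k).
have Dmem s x : x \in s -> D s x.
  move=> xs; have xs' : (index x s < size s)%N by rewrite index_mem.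
  by have := span_of_mem (fun k : 'I_(size s) => nth 0 s k) (Ordinal xs'); rewrite /= nth_index.
have /choice [T hT] : forall s : seq X, exists T : X -> Y,
        [/\ (forall (a : C) (e1 e2 : X), D s e1 -> D s e2 ->
               T (a *: e1 + e2) = a *: T e1 + T e2),
            (forall e, D s e -> `|T e| <= cR lam * `|e|) &
            (forall e, D s e -> (exists y, i y = e) -> i (T e) = e)].
  by move=> s; apply: hE; exists (size s), (fun k : 'I_(size s) => nth 0 s k).
(* The tails of the finite lists of vectors, ordered by inclusion. *)
pose F : set_system (seq X) := [set A | exists s0 : seq X, forall s : seq X, {subset s0 <= s} -> A s].
have FF : ProperFilter F.
  split; first by move=> [s0 /(_ s0)]; apply.
  split; first by exists [::].
  - move=> A B [s1 h1] [s2 h2]; exists (s1 ++ s2) => s hs; split.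
      by apply: h1 => x xs; apply: hs; rewrite mem_cat xs.
    by apply: h2 => x xs; apply: hs; rewrite mem_cat xs orbT.
  - by move=> A B AB [s0 h]; exists s0 => s /h /AB.
have [U [UU FU]] := ultraFilterLemma FF.
exists (seq X), U, lam; split=> //; split=> //; constructor.
apply: (@Retractions _ U lam D T).
- by move=> x; apply: FU; exists [:: x] => s h; apply: Dmem; apply: h; rewrite mem_seq1.
- by move=> s; exact: span_of0.
- by move=> s a x y; exact: span_of_lin.
- by move=> s; have [h _ _] := hT s.
- by move=> s x xD; have [_ h _] := hT s; have := h x xD; rewrite !rnE -cRM cR_le.
- by move=> s y yD; have [_ _ h] := hT s; apply: inji; apply: h => //; exists y.
Qed.

Section Theory.
Context {I : Type} {U : set_system I} {UF : ProperFilter U} {lam : RR}.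
Variable R : retractions U lam.

Lemma retr0 s : retr R s 0 = 0.
Proof.
have := retr_lin 1 (rdom0 R s) (rdom0 R s); rewrite !scale1r !addr0 => /eqP.
by rewrite -subr_eq0 opprD addrA subrr sub0r oppr_eq0 => /eqP.
Qed.

Lemma retrZ s (a : C) x : rdom R s x -> retr R s (a *: x) = a *: retr R s x.
Proof. by move=> xD; have := retr_lin a xD (rdom0 R s); rewrite retr0 !addr0. Qed.

Lemma retr_sum s (J : Type) (r : seq J) (P : pred J) (x : J -> X) : (forall j, rdom R s (x j)) ->
  rdom R s (\sum_(j <- r | P j) x j) /\
  retr R s (\sum_(j <- r | P j) x j) = \sum_(j <- r | P j) retr R s (x j).
Proof.
move=> xD; elim: r => [|j r [h1 h2]]; first by rewrite !big_nil retr0; split=> //; exact: rdom0.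
rewrite !big_cons; case: (P j) => //; rewrite -[x j]scale1r.
split; first exact: rdom_lin.
by rewrite retr_lin // h2 !scale1r.
Qed.

Lemma retr_polar (E : normedModType C) n (t : Y -> E) s (x : 'I_n -> X) :
  (forall j, rdom R s (x j)) ->
  polar (t \o retr R s) x = polar t (fun j => retr R s (x j)).
Proof.
move=> xD; rewrite /polar; congr (_ *: _); apply: eq_bigr => S _; congr (_ *: _).
by rewrite /= (retr_sum _ _ xD).2.
Qed.

Lemma rdom_all n (x : 'I_n -> X) : U [set s | forall j, rdom R s (x j)].
Proof. by apply: filter_forall => j; exact: rdomU. Qed.

Lemma retr_limit_hpoly b (E : normedModType C) n (t : Y -> E) (T : X -> E) :
  (0 < n)%N -> hpoly n t -> (forall x, Lim b U (fun s => t (retr R s x)) (T x)) ->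
  bddballs T -> hpoly n T.
Proof.
move=> n0 ht hT Tb; have [tm td] := hpoly_polar n0 ht.
refine (hpoly_limit UF (u := fun s => t \o retr R s) hT _ _ Tb).
- move=> k x a y z.
  apply: filterS (filterI (rdom_all x) (filterI (rdomU R y) (rdomU R z))) => s [/= xD [yD zD]].
  have fD w j : rdom R s w -> rdom R s (fupd x k w j) by rewrite /fupd; case: eqP.
  have e w : (fun j => retr R s (fupd x k w j)) = fupd (fun j => retr R s (x j)) k (retr R s w).
    by apply/funext => j; rewrite /fupd; case: eqP.
  have azD := rdom_lin a yD zD.
  rewrite !retr_polar; try by move=> j; apply: fD.
  by rewrite !e retr_lin // tm.
- move=> x; apply: filterS (rdomU R x) => s /= xD.
  by rewrite retr_polar // td.
Qed.

(** Directions in [diff2] have norm at most 1 while retractions expand by [lam]; composing [t] with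
    multiplication by [lam] turns them into contractions. *)
Lemma retr_limit_diff2 b (E : normedModType C) (t : Y -> E) (T : X -> E) : 0 < lam ->
  diff2 (fun y => t (cR lam *: y)) -> (forall x, Lim b U (fun s => t (retr R s x)) (T x)) ->
  diff2 T.
Proof.
move=> l0 ht hT r; have [M hM] := ht r; exists M => x h xr h1 b' d b1 d1.
have lim := LimB (LimZ d (LimB (hT (x + b' *: h)) (hT x))) (LimZ b' (LimB (hT (x + d *: h)) (hT x))).
apply: (Lim_bound _ (lim _ _ _ _ _)); apply: filterS (filterI (rdomU R x) (rdomU R h)) => s [/= xD hD].
have l1 : cR lam != 0 by rewrite cR_neq0 // gt_eqF.
pose S y := (cR lam)^-1 *: retr R s y.
have Sb y : rdom R s y -> rn (S y) <= rn y.
  move=> yD; rewrite /S rnZ rnV rn_cR gtr0_norm // mulrC ler_pdivrMr // mulrC; exact: retr_bound.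
have Sl (a : C) : retr R s (x + a *: h) = cR lam *: (S x + a *: S h).
  rewrite addrC (retr_lin a hD xD) /S.
  by module_core (GRing.PzRing.sort (C : pzRingType)); field.
have -> : retr R s x = cR lam *: S x by rewrite /S scalerA divff // scale1r.
rewrite !Sl; apply: hM => //; first exact: le_trans (Sb _ xD) xr.
exact: le_trans (Sb _ hD) h1.
Qed.

End Theory.
End Retractions.

Lemma rn_uball (X : normedModType C) (x : X) : uball x <-> rn x <= 1.
Proof. by rewrite /uball /= rnE -cR1 cR_le. Qed.

Lemma nlim_cvg (I : Type) (U : set_system I) (E : normedModType C) (u : I -> E) (l : E) :
  Filter U -> nlim U u l <-> u @ U --> l.
Proof.
move=> UF; rewrite rn_cvgP; split=> h e e0.
  have e2 : 0 < e / 2 by lra.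
  by apply: filterS (h _ e2) => s /= h1; lra.
by apply: filterS (h _ e0) => s /= /ltW.
Qed.

Lemma hpoly_relL b n (X V : normedModType C) (P : X -> V) : hpoly n P ->
  relL b (P @` @uball X) -> forall r : RR, relL b (P @` [set x | rn x <= r]).
Proof.
move=> hP [K Kc PK] r; pose a := cR (`|r| + 1).
have a0 : 0 < `|r| + 1 by have := normr_ge0 r; lra.
have ane : a != 0 by rewrite cR_neq0 // gt_eqF.
exists [set x | exists k : 'I_1 -> V, (forall j, K (k j)) /\ x = \sum_(j < 1) a ^+ n *: k j].
  exact: Lcompact_comb.
move=> _ [x /= xr <-]; exists (fun=> P (a^-1 *: x)); split.
  move=> _; apply: PK; exists (a^-1 *: x) => //; apply/rn_uball.
  rewrite rnZ rnV rn_cR gtr0_norm // mulrC ler_pdivrMr // mul1r.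
  by apply: le_trans xr _; have := ler_norm r; lra.
by rewrite big_ord1 -(hpoly_homog _ _ hP) scalerA divff // scale1r.
Qed.

Definition powers_of_functionals n (X : normedModType C) : set (X -> C) :=
  [set p | exists2 phi, bfunctional phi & p = fun x => phi x ^+ n].

Lemma finite_type_psum n (X V : normedModType C) (Q : X -> V) :
  finite_type_poly n Q <-> psum (@powers_of_functionals n X) Q.
Proof.
split=> [[m [phi [v [hp hQ]]]]|[m [p [v [hp hQ]]]]].
  by exists m, (fun k x => phi k x ^+ n), v; split=> // k; exists (phi k).
have /choice [phi hphi] : forall k, exists phi, bfunctional phi /\ p k = fun x => phi x ^+ n.
  by move=> k; have [phi] := hp k; exists phi.
exists m, phi, v; split=> [k|x]; first by have [] := hphi k.
by rewrite hQ; apply: eq_bigr => k _; have [_ ->] := hphi k.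
Qed.

Lemma powers_of_functionals_bdd n (X : normedModType C) (p : X -> C) (r : RR) :
  powers_of_functionals n p -> exists B : RR, forall x, rn x <= r -> rn (p x) <= B.
Proof.
move=> [phi hp ->]; have [K K0 hK] := clin_bdd (bfun_lin hp) hp.2.
exists ((K * r) ^+ n) => x xr; rewrite rnX; have h := hK x; have x0 := rn_ge0 x.
by apply: lerXn2r; rewrite ?nnegrE ?rn_ge0 //; [nra | apply: le_trans h _; rewrite ler_pM2l].
Qed.

Lemma PA_approx n (X V : normedModType C) (P : X -> V) : PA n P ->
  forall r e : RR, 0 < e -> exists2 Q, psum (@powers_of_functionals n X) Q &
    forall x, rn x <= r -> rn (P x - Q x) <= e.
Proof.
move=> [hP h] r e e0; pose a := `|r| + 1.
have a0 : 0 < a by have := normr_ge0 r; rewrite /a; lra.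
have ane : cR a != 0 by rewrite cR_neq0 // gt_eqF.
have an : 0 < a ^+ n by rewrite exprn_gt0.
have [|Q [hQ PQ]] := h (cR (e / a ^+ n)); first by rewrite -cR0 cR_lt divr_gt0.
exists Q; first exact/finite_type_psum.
move=> x xr; have [m [phi [v [hp Qx]]]] := hQ.
have h1 : rn ((cR a)^-1 *: x) <= 1.
  rewrite rnZ rnV rn_cR gtr0_norm // mulrC ler_pdivrMr // mul1r.
  by apply: le_trans xr _; have := ler_norm r; rewrite /a; lra.
have -> : P x - Q x = (cR a) ^+ n *: (P ((cR a)^-1 *: x) - Q ((cR a)^-1 *: x)).
  rewrite scalerBr -(hpoly_homog _ _ hP) scalerA divff // scale1r; congr (_ - _).
  rewrite !Qx scaler_sumr; apply: eq_bigr => k _.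
  rewrite scalerA -exprMn; congr (_ ^+ n *: _).
  by rewrite [in RHS](clinZ (bfun_lin (hp k))) /GRing.scale /= mulrA divff // mul1r.
have /PQ : `|(cR a)^-1 *: x| <= 1 by rewrite rnE -cR1 cR_le.
rewrite rnE cR_le rnZ rnX rn_cR gtr0_norm // ler_pdivlMr // mulrC //.
Qed.

Lemma cvg_exprn (I : Type) (U : set_system I) (u : I -> C) (l : C) n : Filter U ->
  (u : I -> (C : normedModType C)) @ U --> (l : (C : normedModType C)) ->
  (fun s => u s ^+ n : (C : normedModType C)) @ U --> (l ^+ n : (C : normedModType C)).
Proof.
move=> UF ul; elim: n => [|n ih]; first exact: cvg_cst.
rewrite exprS (_ : (fun s => _) = fun s => u s * u s ^+ n); last by apply/funext => s; rewrite exprS.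
exact: cvgM ul ih.
Qed.

Section Extension.
Variables (X Y : normedModType C) (i : Y -> X).
Context {I : Type} {U : set_system I} {UU : UltraFilter U} {lam : RR}.
Variable R : retractions i U lam.
Hypothesis lam0 : 0 < lam.

Lemma retr_ball r x : rn x <= r -> U [set s | rn (retr R s x) <= lam * r].
Proof.
move=> xr; apply: filterS (rdomU R x) => s /= xD; apply: le_trans (retr_bound xD) _.
by rewrite ler_pM2l.
Qed.

(** The values of [t] at the retracted points stay eventually in the image of a ball enlarged by
    [lam], whence both the limit and the compactness of the extension. *)
Lemma retr_extension b (E : normedModType C) (t : Y -> E) :
  (forall r, relL b (t @` [set y | rn y <= r])) ->
  exists T : X -> E, [/\ forall x, Lim b U (fun s => t (retr R s x)) (T x),
    forall r, relL b (T @` [set x | rn x <= r]) & T \o i = t].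
Proof.
move=> ht.
have ex r x K : Lcompact b K -> t @` [set y | rn y <= lam * r] `<=` K -> rn x <= r ->
    exists2 l, K l & Lim b U (fun s => t (retr R s x)) l.
  move=> Kc tK xr; apply: Kc; apply: filterS (retr_ball xr) => s /= h.
  by apply: tK; exists (retr R s x).
have /choice [T hT] : forall x, exists l, Lim b U (fun s => t (retr R s x)) l.
  move=> x; have [K Kc tK] := ht (lam * rn x).
  by have [l _ hl] := ex _ x K Kc tK (lexx _); exists l.
exists T; split=> //.
  move=> r; have [K Kc tK] := ht (lam * r); exists K => // _ [x xr <-].
  have [l Kl hl] := ex _ x K Kc tK xr.
  by rewrite (Lim_uniq (hT x) hl).
apply/funext => y; apply: (Lim_uniq (hT (i y))).
by apply: (Lim_ext _ (Lim_cst b (t y))); apply: filterS (rdomU R (i y)) => s /= yD; rewrite (retr_id yD).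
Qed.

Lemma retr_limit_bddballs b (E : normedModType C) (t : Y -> E) (T : X -> E) : bddballs t ->
  (forall x, Lim b U (fun s => t (retr R s x)) (T x)) -> bddballs T.
Proof.
move=> tb hT r; have [M hM] := tb (lam * r); exists M => x xr.
by apply: (Lim_bound _ (hT x)); apply: filterS (retr_ball xr) => s /= /hM.
Qed.

Lemma extend_hpoly b n (E : normedModType C) (t : Y -> E) : (0 < n)%N ->
  hpoly n t -> relL b (t @` @uball Y) ->
  exists T : X -> E, [/\ hpoly n T, relL b (T @` @uball X), T \o i = t &
    forall x, Lim b U (fun s => t (retr R s x)) (T x)].
Proof.
move=> n0 ht tK; have [T [hT TK Ti]] := retr_extension (hpoly_relL ht tK).
exists T; split=> //.
  apply: (retr_limit_hpoly n0 ht hT); apply: retr_limit_bddballs hT.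
  exact: hpoly_bounded ht.
by apply: relL_sub (TK 1) => _ [x /rn_uball x1 <-]; exists x.
Qed.

Lemma extend_functional (phi : Y -> C) : bfunctional phi ->
  exists2 psi : X -> C, bfunctional psi &
    forall x, nlim U (fun s => phi (retr R s x) : (C : normedModType C)) (psi x).
Proof.
move=> hp; have pl := bfun_lin hp; have [K K0 hK] := clin_bdd pl hp.2.
have bd x : U [set s | rn (phi (retr R s x)) <= K * (lam * rn x)].
  apply: filterS (rdomU R x) => s /= xD; have h := retr_bound xD; apply: le_trans (hK _) _.
  by rewrite ler_pM2l.
have /choice [psi hpsi] : forall x, exists l : C,
    nlim U (fun s => phi (retr R s x) : (C : normedModType C)) l.
  by move=> x; apply: scalar_ultra_lim (bd x).
exists psi => //.
have psil : clinear (psi : X -> (C : normedModType C)).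
  move=> a x y; apply: (nlim_uniq (hpsi (a *: x + y))).
  apply: nlim_ext (nlim_lin a (hpsi x) (hpsi y)).
  apply: filterS (filterI (rdomU R x) (rdomU R y)) => s [/= xD yD].
  by rewrite retr_lin // pl.
split=> //; apply: (clin_cont psil (K := K * lam)) => x.
by apply: (nlim_bound _ (hpsi x)); apply: filterS (bd x) => s; rewrite mulrA.
Qed.

Lemma extend_PA n (E : completeNormedModType C) (t : Y -> E) : (0 < n)%N -> PA n t ->
  exists T : X -> E, PA n T /\ T \o i = t.
Proof.
move=> n0 tA; have ap := PA_approx tA.
have tK : relL false (t @` @uball Y).
  apply: (@psum_limit_relL _ _ _ (@powers_of_functionals n Y)).
    move=> p hp; have [B hB] := powers_of_functionals_bdd 1 hp; exists B => x /rn_uball; exact: hB.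
  move=> e e0; have [Q Qs hQ] := ap 1 e e0; exists Q => // x /rn_uball; exact: hQ.
have [T [Tp _ Ti hT]] := extend_hpoly n0 tA.1 tK; exists T; split=> //; split=> // _ /gt0_cR[e e0 ->].
(* Approximation on the ball of radius [lam], where the retractions send the unit ball. *)
have [Q /finite_type_psum[m [phi [v [hphi Qx]]]] hQ] := ap lam e e0.
have /choice [psi hpsi] : forall k, exists psi : X -> C, bfunctional psi /\
    forall x, nlim U (fun s => phi k (retr R s x) : (C : normedModType C)) (psi x).
  by move=> k; have [psi ? ?] := extend_functional (hphi k); exists psi.
exists (fun x => \sum_(k < m) psi k x ^+ n *: v k); split.
  by exists m, psi, v; split=> // k; have [] := hpsi k.
move=> x x1; rewrite rnE cR_le.
have {}x1 : rn x <= 1 by apply/rn_uball.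
have lim : Lim false U (fun s => Q (retr R s x)) (\sum_(k < m) psi k x ^+ n *: v k).
  rewrite (_ : (fun s => _) = fun s => \sum_(k < m) 1 *: (phi k (retr R s x) ^+ n *: v k)).
    rewrite (eq_bigr (fun k => 1 *: (psi k x ^+ n *: v k))) => [|k _]; last by rewrite scale1r.
    apply: Lim_sum => k; apply/nlim_cvg; apply: cvgZr_tmp.
    apply: cvg_exprn; apply/nlim_cvg; by have [_] := hpsi k; exact.
  by apply/funext => s; rewrite Qx; apply: eq_bigr => k _; rewrite scale1r.
have h := LimB (hT x) lim.
apply: (Lim_bound _ (h _)); apply: filterS (retr_ball x1) => s /=; rewrite mulr1; exact: hQ.
Qed.

Lemma Hb_scale (E : normedModType C) (t : Y -> E) (a : C) : Hb t -> Hb (fun y => t (a *: y)).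
Proof.
move=> [td /bddballs_C tb]; split; last first.
  apply/bddballs_C => r; have [M hM] := tb (rn a * r); exists M => x xr; apply: hM.
  by rewrite rnZ; apply: ler_wpM2l; rewrite ?rn_ge0.
move=> y; apply: (@differentiable_comp _ _ _ _ (fun y => a *: y) t); last exact: td.
apply/differentiable_rnP; exists (fun h => a *: h); split.
- by move=> c u v; module.
- exact: scaler_continuous.
- move=> e e0; exists 1 => // h _; rewrite (_ : _ - _ - _ = 0); last by module.
  by rewrite rn0 mulr_ge0 ?rn_ge0 // ltW.
Qed.

Lemma extend_Hb b (E : completeNormedModType C) (t : Y -> E) : Hb t ->
  (forall r, relL b (t @` [set y | rn y <= r])) ->
  exists T : X -> E, [/\ Hb T, forall r, relL b (T @` [set x | rn x <= r]) & T \o i = t].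
Proof.
move=> tH /retr_extension[T [hT TK Ti]]; exists T; split=> //; apply: diff2_Hb.
  exact: retr_limit_bddballs (Hb_bddballs tH) hT.
apply: (retr_limit_diff2 lam0 _ hT); exact: Hb_diff2 (Hb_scale _ tH).
Qed.

End Extension.

Lemma locally_relL_balls b (X : normedModType C) (E : completeNormedModType C) (t : X -> E)
  (cpt : set E -> Prop) : (forall A, cpt A <-> relL b A) -> Hb t ->
  (forall x : X, exists W, nbhs x W /\ cpt (t @` W)) <->
  (forall r, relL b (t @` [set y | rn y <= r])).
Proof.
move=> hc tH; split=> [/(_ 0)[W [W0 /hc tW]]|h x]; first exact: Hb_relL tW.
exists [set y | rn y <= rn x + 1]; split; last exact/hc.
apply/rn_nbhs; exists 1 => // y h1 /=; have := rnD (y - x) x; rewrite subrK; lra.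
Qed.

(** * Open mapping theorem and liftings *)

Lemma hp_eps (a b : RR) k : (forall j, (k <= j)%N -> a <= b + hp j) -> a <= b.
Proof.
move=> h; apply/ler_addgt0Pr => e e0; have [m hm] := hp_lt e0.
have := h (k + m)%N (leq_addr _ _); have := hp_anti (leq_addl k m); lra.
Qed.

Section OpenMapping.
Variables (X Z : completeNormedModType C) (q : X -> Z) (S : set Z).
Hypotheses (ql : clinear q) (qc : continuous q).
Hypothesis S_lin : forall (a : C) x y, S x -> S y -> S (a *: x + y).
Hypothesis S_closed : forall (u : nat -> Z) l, (forall k, S (u k)) ->
  (forall k, rn (u k - l) <= hp k) -> S l.
Hypothesis qS : forall x, S (q x).
Hypothesis q_onto : forall z, S z -> exists x, q x = z.

Let S0 : S 0. Proof. by rewrite -(clin0 ql); exact: qS. Qed.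
Let SD x y : S x -> S y -> S (x + y). Proof. by move=> *; rewrite -[x]scale1r; exact: S_lin. Qed.
Let SZ (a : C) x : S x -> S (a *: x). Proof. by move=> h; rewrite -[_ *: _]addr0; exact: S_lin. Qed.
Let SB x y : S x -> S y -> S (x - y).
Proof. by move=> hx hy; rewrite addrC -scaleN1r; exact: S_lin. Qed.

(* Baire's theorem: were no closure of an image of a ball somewhere dense, one could choose
   nested balls avoiding the image of the [n]-th ball at the [n]-th step. *)
Lemma baire_image : exists (N : nat) (z0 : Z) (r : RR), [/\ S z0, 0 < r &
  forall z, S z -> rn (z - z0) <= r -> forall e : RR, 0 < e ->
  exists2 x, rn x <= N%:R & rn (z - q x) <= e].
Proof.
apply: contrapT => hn.
have /choice [g hg] : forall a : nat * Z * RR, exists p : Z * RR, S a.1.2 -> 0 < a.2 ->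
    [/\ S p.1, rn (p.1 - a.1.2) <= a.2, 0 < p.2 & forall x, rn x <= a.1.1%:R -> p.2 < rn (p.1 - q x)].
  move=> [[n z0] r] /=; apply: contrapT => h; apply: hn; exists n, z0, r.
  have [Sz0|nS] := pselect (S z0); last by case: h; exists (0, 0) => /nS.
  have [r0|nr] := pselect (0 < r); last by case: h; exists (0, 0) => _ /nr.
  split=> // z Sz zr e e0; apply: contrapT => h2; apply: h; exists (z, e) => _ _; split=> // x xn.
  by rewrite ltNge; apply/negP => h3; apply: h2; exists x.
(* Halving the old radius keeps the balls nested; halving the radius of avoidance keeps it strict
   for the limit of the centres. *)
pose step n (p : Z * RR) : Z * RR :=
  let w := g (n, p.1, p.2 / 2) in (w.1, Num.min (w.2 / 2) (p.2 / 2)).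
pose s := fix s n := if n is m.+1 then step m (s m) else (0, 1) : Z * RR.
have ss n : [/\ S (s n).1 & 0 < (s n).2].
  elim: n => [|n [h1 h2]]; first by split=> //=.
  have r2 : 0 < (s n).2 / 2 by lra.
  have [g1 g2 g3 g4] := hg (n, (s n).1, (s n).2 / 2) h1 r2.
  by split => //=; rewrite lt_min r2 andbT divr_gt0.
have sg n : [/\ rn ((s n.+1).1 - (s n).1) <= (s n).2 / 2, (s n.+1).2 <= (s n).2 / 2 &
    forall x, rn x <= n%:R -> (s n.+1).2 < rn ((s n.+1).1 - q x)].
  have [h1 h2] := ss n; have r2 : 0 < (s n).2 / 2 by lra.
  have [g1 g2 g3 g4] := hg (n, (s n).1, (s n).2 / 2) h1 r2; split=> //=.
    by rewrite ge_min lexx orbT.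
  move=> x /g4; apply: le_lt_trans; rewrite ge_min; apply/orP; left.
  by move: g3 => /=; lra.
have rk n : (s n).2 <= hp n.
  elim: n => [|n ih]; first by rewrite hp0.
  by have [_ h _] := sg n; rewrite hpS; lra.
have nest k d : rn ((s (k + d)%N).1 - (s k).1) + (s (k + d)%N).2 <= (s k).2.
  elim: d => [|d ih]; first by rewrite addn0 subrr rn0; lra.
  rewrite addnS; have [h1 h2 _] := sg (k + d)%N.
  by have := rn_tri (s (k + d)%N).1 (s (k + d).+1).1 (s k).1; lra.
have nest' k j : (k <= j)%N -> rn ((s j).1 - (s k).1) <= (s k).2.
  by move=> kj; have := nest k (j - k)%N; rewrite subnKC //; have [_ ?] := ss j; lra.
have [k j kj|l hl] := @cauchy_seq_lim Z (fun k => (s k).1).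
  exact: le_trans (nest' _ _ kj) (rk k).
have lk k : rn ((s k).1 - l) <= (s k).2.
  apply: (@hp_eps _ _ k) => j kj; have := rn_tri (s j).1 (s k).1 l.
  by have := nest' k j kj; rewrite (rnB (s j).1 (s k).1); have := hl j; lra.
have [x qx] : exists x, q x = l.
  by apply: q_onto; apply: (S_closed (u := fun k => (s k).1)) => // k; have [] := ss k.
have [n xn] : exists n : nat, rn x <= n%:R.
  by exists (Num.bound (rn x)); rewrite ltW // archi_boundP // rn_ge0.
have [_ _ /(_ x xn)] := sg n; rewrite qx; have := lk n.+1; lra.
Qed.

Lemma almost_open : exists2 K : RR, 0 < K & forall z, S z -> forall e : RR, 0 < e ->
  exists2 x, rn x <= K * rn z & rn (z - q x) <= e.
Proof.
have [N [z0 [r [Sz0 r0 h]]]] := baire_image.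
have N0 : 0 <= N%:R :> RR by rewrite ler0n.
have K0 : 0 < (2 * N%:R + 1) / r by rewrite divr_gt0 //; lra.
exists ((2 * N%:R + 1) / r) => // z Sz e e0.
have [->|zn] := eqVneq z 0.
  by exists 0; rewrite ?rn0 ?mulr0 // (clin0 ql) subr0 rn0 ltW.
have rz := rn_gt0 zn; pose a := r / rn z; have a0 : 0 < a by rewrite divr_gt0.
have ra : rn (cR a) = a by rewrite rn_cR gtr0_norm.
have ane : cR a != 0 by rewrite cR_neq0 // gt_eqF.
have ea : 0 < e * a / 2 by rewrite divr_gt0 // mulr_gt0.
have [||x1 x1N h1] := h (z0 + cR a *: z) _ _ _ ea.
- by apply: SD => //; apply: SZ.
- by rewrite addrC addKr rnZ ra /a divfK // gt_eqF.
have [||x2 x2N h2] := h z0 _ _ _ ea => //.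
  by rewrite subrr rn0 ltW.
exists ((cR a)^-1 *: (x1 - x2)).
  rewrite rnZ rnV ra /a invf_div; apply: le_trans (ler_wpM2l _ (rnBD _ _)) _.
    by rewrite divr_ge0 // ltW.
  rewrite [leRHS]mulrC mulrA -[leRHS]mulrAC; apply: ler_wpM2l; first by rewrite divr_ge0 // ltW.
  lra.
rewrite (clinZ ql) (clinB ql).
have -> : z - (cR a)^-1 *: (q x1 - q x2) =
   (cR a)^-1 *: ((z0 + cR a *: z - q x1) - (z0 - q x2)).
  by module_core (GRing.PzRing.sort (C : pzRingType)); field.
rewrite rnZ rnV ra mulrC ler_pdivrMr //; have := rnBD (z0 + cR a *: z - q x1) (z0 - q x2); lra.
Qed.

(** The range is a closed subspace [S] of [Z] given as a set, so that the same statement applies to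
    [q] and to [i] onto the kernel of [q]. The proof sums successive approximate preimages of the
    residuals. *)
Lemma open_mapping : exists2 K : RR, 0 < K & forall z, S z ->
  exists2 x, q x = z & rn x <= K * rn z.
Proof.
(* With this [d] a residual of size [d * hp n] has an approximate preimage of size [hp n.+1], and
   these sizes sum to 1. *)
have [K K0 h] := almost_open; pose d := (2 * K)^-1.
have d0 : 0 < d by rewrite invr_gt0; lra.
have Kd : K * d = 2^-1 by rewrite /d invfM mulrCA divff ?mulr1 // gt_eqF.
have unit z : S z -> rn z <= d -> exists2 x, q x = z & rn x <= 1.
  move=> Sz zd.
  have /choice [g hg] : forall a : nat * Z, exists x, S a.2 ->
      rn x <= K * rn a.2 /\ rn (a.2 - q x) <= d * hp a.1.+1.
    move=> [n w] /=; have [Sw|nS] := pselect (S w); last by exists 0 => /nS.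
    by have [x x1 x2] := h w Sw (d * hp n.+1) (mulr_gt0 d0 (hp_gt0 _)); exists x.
  pose w := fix w n := if n is m.+1 then w m - q (g (m, w m)) else z.
  have hw n : S (w n) /\ rn (w n) <= d * hp n.
    elim: n => [|n [h1 h2]]; first by rewrite hp0 mulr1.
    have [h3 h4] := hg (n, w n) h1; split=> //=; exact: SB.
  have gw n : rn (g (n, w n)) <= hp n.+1.
    have [h1 h2] := hw n; have [h3 _] := hg (n, w n) h1; apply: le_trans h3 _ => /=.
    rewrite hpS; have := ler_wpM2l (ltW K0) h2; rewrite mulrA Kd; lra.
  pose s n := \sum_(m < n) g (m : nat, w m).
  have qs n : q (s n) = z - w n.
    elim: n => [|n ih]; first by rewrite /s big_ord0 (clin0 ql) subrr.
    by rewrite /s big_ord_recr (clinD ql) -/(s n) ih /=; module.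
  have cs k e : rn (s (k + e)%N - s k) + hp (k + e)%N <= hp k.
    elim: e => [|e ih]; first by rewrite addn0 subrr rn0 add0r.
    rewrite addnS /s big_ord_recr /= -/(s (k + e)%N) -/(s k).
    have := gw (k + e)%N; have := rnD (s (k + e)%N - s k) (g ((k + e)%N, w (k + e)%N)).
    by rewrite addrAC hpS; lra.
  have [k j kj|l hl] := @cauchy_seq_lim X s.
    by have := cs k (j - k)%N; rewrite subnKC //; have := hp_gt0 j; lra.
  exists l; last by have := hl 0%N; rewrite /s big_ord0 sub0r rnN hp0.
  apply/eqP; rewrite -subr_eq0; apply/eqP; apply: rn_eps0 => e e0.
  have [L L0 hL] := clin_bdd ql qc.
  have Ld : 0 < L + d by lra.
  have [k hk] := hp_lt (divr_gt0 e0 Ld); have [_ wk] := hw k.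
  have h1 : rn (q l - q (s k)) <= L * hp k.
    by rewrite -(clinB ql); apply: le_trans (hL _) _; rewrite ler_pM2l // rnB.
  have := rn_tri (q (s k)) (q l) z; rewrite {2}qs.
  rewrite (_ : z - w k - z = - w k); last by module.
  rewrite rnN; move: hk; rewrite ltr_pdivlMr //; lra.
exists d^-1 => [|z Sz]; first by rewrite invr_gt0.
have [->|zn] := eqVneq z 0; first by exists 0; rewrite ?(clin0 ql) // !rn0 mulr0.
have rz := rn_gt0 zn; pose a := d / rn z; have a0 : 0 < a by rewrite divr_gt0.
have ra : rn (cR a) = a by rewrite rn_cR gtr0_norm.
have ane : cR a != 0 by rewrite cR_neq0 // gt_eqF.
have [||x qx x1] := unit (cR a *: z); first exact: SZ.
  by rewrite rnZ ra /a divfK // gt_eqF.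
exists ((cR a)^-1 *: x); first by rewrite (clinZ ql) qx scalerA mulVf // scale1r.
rewrite rnZ rnV ra /a invf_div [leRHS]mulrC; apply: ler_piMr => //.
by rewrite divr_ge0 // ltW.
Qed.
End OpenMapping.

(** * Finite nets, and lifting all combinations with bounded coefficients *)

Lemma real_net (B eta : RR) : 0 < eta -> exists N : nat, forall t : RR, `|t| <= B ->
  exists k : 'I_N, `|t - (k%:R * eta - B)| <= eta.
Proof.
move=> e0; exists (Num.truncn (2 * B / eta)).+1 => t tB.
have t0 : 0 <= (t + B) / eta by apply: divr_ge0; [move: tB; rewrite ler_norml; lra | exact: ltW].
have /andP[h1 h2] := Num.Theory.truncn_itv t0.
have kN : (Num.truncn ((t + B) / eta) < (Num.truncn (2 * B / eta)).+1)%N.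
  rewrite ltnS; apply: Num.Theory.le_truncn; rewrite ler_pM2r ?invr_gt0 //.
  by move: tB; rewrite ler_norml; lra.
exists (Ordinal kN) => /=; move: h1 h2; rewrite ler_pdivlMr // ltr_pdivrMr // => h1 h2.
rewrite ler_norml; move: h2; rewrite -natr1 mulrDl mul1r => h2.
by lra.
Qed.

Lemma complex_net (B eta : RR) : 0 < eta -> exists (J : finType) (c : J -> C),
  forall z : C, rn z <= B -> exists j, rn (z - c j) <= eta.
Proof.
move=> e0; have e2 : 0 < eta / 2 by lra.
have [N hN] := real_net B e2.
pose f (k : 'I_N) : RR := k%:R * (eta / 2) - B.
exists ('I_N * 'I_N)%type, (fun k => (f k.1 +i* f k.2)%C) => z zB.
have [h1 h2] := rn_ReIm z.
have [k1 hk1] := hN _ (le_trans h1 zB); have [k2 hk2] := hN _ (le_trans h2 zB).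
exists (k1, k2); case: z h1 h2 zB hk1 hk2 => a b /= h1 h2 zB hk1 hk2.
apply: le_trans (rn_le_ReIm _ _) _; move: hk1 hk2; by rewrite -/(f k1) -/(f k2); lra.
Qed.

Section BoxLift.
Variables (Y X Z : completeNormedModType C) (i : Y -> X) (q : X -> Z).
Hypothesis iq : short_exact i q.

Lemma quotient_open : exists2 K : RR, 0 < K & forall z, exists2 x, q x = z & rn x <= K * rn z.
Proof.
have [_ [ql qc] _ qs _] := iq.
have [||||K K0 h] := @open_mapping X Z q setT ql qc => //.
by exists K => // z; apply: h.
Qed.

Lemma kernel_bounded_below : exists2 K : RR, 0 < K & forall y, rn y <= K * rn (i y).
Proof.
have [[il ic] [ql qc] inji _ ker] := iq.
have [||||K K0 h] := @open_mapping Y X i [set x | q x = 0] il ic.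
- by move=> a x y /= hx hy; rewrite ql hx hy scaler0 addr0.
- move=> u l hu hl /=; have [L L0 hL] := clin_bdd ql qc; apply: rn_eps0 => e e0.
  have [k hk] := hp_lt (divr_gt0 e0 L0).
  have := hL (u k - l); rewrite (clinB ql) hu sub0r rnN => h; apply: le_trans h _.
  by move: hk; rewrite ltr_pdivlMr // => hk; have := ler_wpM2l (ltW L0) (hl k); lra.
- by move=> y /=; apply/ker; exists y.
- by move=> x /= /ker.
exists K => // y; have [|y' /inji -> //] := h (i y); by apply/ker; exists y.
Qed.

(* The preimages [v' l] are corrected by a retraction of a space containing good preimages of a
   fine net of combinations; their norms are bounded before that space is chosen. *)
Lemma box_lift : locally_splits i -> exists2 mu : RR, 0 < mu &
  forall m (v : 'I_m -> Z) (B del : RR), 0 < del -> exists v' : 'I_m -> X,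
    (forall l, q (v' l) = v l) /\
    forall d : 'I_m -> C, (forall l, rn (d l) <= B) ->
      rn (\sum_(l < m) d l *: v' l) <= mu * (rn (\sum_(l < m) d l *: v l) + del).
Proof.
have [[il ic] [ql qc] inji qs ker] := iq.
move=> /(locally_splits_retractions inji)[I [U [lam [UU [lam0 [R]]]]]].
have [K K0 hK] := quotient_open; have [N N0 hN] := clin_bdd il ic.
pose c := 1 + N * lam; have c1 : 1 <= c by rewrite lerDl mulr_ge0 ?ltW.
have c0 : 0 < c by lra.
exists (c * K) => [|m v B del d0]; first by rewrite mulr_gt0.
have /choice [x hx] : forall l, exists x, q x = v l by move=> l; exact: qs.
(* [eta] is the mesh at which replacing coefficients by net points, in [Z] and among the preimages,
   costs at most [K * del] altogether; the summand 1 keeps [W] positive. *)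
pose W := K * \sum_l rn (v l) + \sum_l rn (x l) + 1.
have sv : 0 <= \sum_l rn (v l) by apply: sumr_ge0 => l _; exact: rn_ge0.
have sx : 0 <= \sum_l rn (x l) by apply: sumr_ge0 => l _; exact: rn_ge0.
have Kv : 0 <= K * \sum_l rn (v l) by rewrite mulr_ge0 // ltW.
have W0 : 0 < W by rewrite /W; lra.
pose eta := K * del / W; have e0 : 0 < eta by rewrite divr_gt0 // mulr_gt0.
have [J [w hw]] := complex_net B e0.
have /choice [y hy] : forall f : {ffun 'I_m -> J}, exists y, q y = \sum_l w (f l) *: v l /\
    rn y <= K * rn (\sum_l w (f l) *: v l).
  by move=> f; have [y h1 h2] := hK (\sum_l w (f l) *: v l); exists y.
have [s [xD yD]] : exists s, (forall l, rdom R s (x l)) /\ (forall f, rdom R s (y f)).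
  apply: (filter_ex (F := U)); apply: filterI; first exact: rdom_all.
  by apply: filter_forall => f; exact: rdomU.
(* [P] annihilates the kernel of [q] within the domain, so it depends on [q u] alone: a combination
   of the [x l] may be replaced by the short preimage [y] of the same vector. *)
pose P u := u - i (retr R s u).
have Pb u : rdom R s u -> rn (P u) <= c * rn u.
  move=> uD; apply: le_trans (rnBD _ _) _; rewrite /c mulrDl mul1r lerD2l.
  by apply: le_trans (hN _) _; rewrite -mulrA ler_pM2l // retr_bound.
have qP u : q (P u) = q u.
  by rewrite (clinB ql) (_ : q (i _) = 0) ?subr0 //; apply/ker; exists (retr R s u).
have Plin (a : C) u u' : rdom R s u -> rdom R s u' -> P (a *: u + u') = a *: P u + P u'.
  by move=> uD uD'; rewrite /P retr_lin // il; module.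
have Pker u : rdom R s u -> q u = 0 -> P u = 0.
  by move=> uD /ker[z iz]; rewrite /P -iz retr_id ?subrr // iz.
have zD (d : 'I_m -> C) l : rdom R s (d l *: x l) by rewrite -[_ *: _]addr0; apply: rdom_lin => //; exact: rdom0.
have Psum (d : 'I_m -> C) : P (\sum_l d l *: x l) = \sum_l d l *: P (x l).
  rewrite /P (retr_sum _ _ (zD d)).2 (clin_sum il) -sumrB; apply: eq_bigr => l _.
  by rewrite retrZ // (clinZ il); module.
exists (fun l => P (x l)); split=> [l|d dB]; first by rewrite qP.
have /choice [f hf] : forall l, exists j, rn (d l - w j) <= eta by move=> l; apply: hw.
pose g : {ffun 'I_m -> J} := [ffun l => f l].
have wd (A : normedModType C) (a : 'I_m -> A) :
    rn (\sum_l w (g l) *: a l - \sum_l d l *: a l) <= eta * \sum_l rn (a l).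
  rewrite -sumrB; apply: le_trans (rn_sum _ _ _) _; rewrite mulr_sumr; apply: ler_sum => l _.
  by rewrite -scalerBl rnZ ler_wpM2r ?rn_ge0 // rnB /g ffunE.
have [hy1 hy2] := hy g.
have e1 : \sum_l w (g l) *: P (x l) = P (y g).
  have qe : q (\sum_l w (g l) *: x l - y g) = 0.
    rewrite (clinB ql) hy1 (clin_sum ql) -sumrB big1 // => l _.
    by rewrite (clinZ ql) hx subrr.
  rewrite -Psum; have [xgD _] := retr_sum (index_enum 'I_m) predT (zD (fun l => w (g l))).
  have e : \sum_l w (g l) *: x l = 1 *: (\sum_l w (g l) *: x l - y g) + y g.
    by rewrite scale1r subrK.
  have dD : rdom R s (\sum_l w (g l) *: x l - y g).
    by rewrite addrC -scaleN1r; apply: rdom_lin.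
  by rewrite e Plin // Pker // scaler0 add0r.
have h1 := wd X (fun l => P (x l)); rewrite e1 in h1.
have h2 : \sum_l rn (P (x l)) <= c * \sum_l rn (x l).
  by rewrite mulr_sumr; apply: ler_sum => l _; exact: Pb.
have h3 := wd Z v; have h4 := Pb _ (yD g).
have h5 : eta * (K * \sum_l rn (v l) + \sum_l rn (x l)) <= K * del.
  rewrite /eta mulrAC ler_pdivrMr //; apply: ler_wpM2l; last by rewrite /W lerDl.
  by rewrite mulr_ge0 // ltW.
have h6 := rn_leB (\sum_l d l *: P (x l)) (P (y g)).
rewrite rnB in h6; have h7 := rn_leB (\sum_l w (g l) *: v l) (\sum_l d l *: v l).
apply: (@le_trans _ _ (c * rn (y g) + eta * (c * \sum_l rn (x l)))).
  by move: h1 h4 h6 (ler_wpM2l (ltW e0) h2); clear; lra.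
rewrite -mulrA (_ : c * rn _ + _ = c * (rn (y g) + eta * \sum_l rn (x l))); last by ring.
rewrite ler_pM2l //; apply: le_trans (lerD hy2 (lexx _)) _.
move: h5 (ler_wpM2l (ltW K0) (le_trans h7 h3)); clear; lra.
Qed.
End BoxLift.

(** * Finite sums and their limits within the classes of maps *)

Lemma linear_differentiable_rn (X V : normedModType C) (g : X -> V) x : clinear g -> continuous g ->
  differentiable g x.
Proof.
move=> gl gc; apply/differentiable_rnP; exists g; split=> // e e0; exists 1 => // h _.
by rewrite (clinD gl) addrAC addrK subrr rn0 mulr_ge0 ?rn_ge0 // ltW.
Qed.

Lemma Hb_comp_linear (X V W : normedModType C) (f : X -> V) (g : V -> W) :
  Hb f -> clinear g -> continuous g -> Hb (g \o f).
Proof.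
move=> [fd /bddballs_C fb] gl gc; split.
  by move=> x; apply: differentiable_comp => //; exact: linear_differentiable_rn.
have [K K0 hK] := clin_bdd gl gc.
apply/bddballs_C => r; have [M hM] := fb r; exists (K * M) => x /hM h.
by apply: le_trans (hK _) _; rewrite ler_pM2l.
Qed.

Lemma scale_vector_bdd (V : normedModType C) (v : V) :
  clinear (fun z : (C : normedModType C) => z *: v) /\
  continuous (fun z : (C : normedModType C) => z *: v).
Proof.
have l : clinear (fun z : (C : normedModType C) => z *: v).
  by move=> a x y; rewrite scalerDl -scalerA.
by split=> //; apply: (clin_cont l (K := rn v)) => x; rewrite rnZ mulrC.
Qed.

Lemma psum_Hb (V Z : normedModType C) (P : set (V -> C)) (Q : V -> Z) :
  (forall p, P p -> Hb (p : V -> (C : normedModType C))) -> psum P Q -> Hb Q.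
Proof.
move=> hP [m [p [v [hp hQ]]]].
have -> : Q = fun x => \sum_(k < m) p k x *: v k by apply/funext.
have h k : Hb (fun x => p k x *: v k).
  by have [l c] := scale_vector_bdd (v k); exact: (Hb_comp_linear (hP _ (hp k)) l c).
split.
  move=> x; rewrite (_ : (fun x => _) = \sum_(k < m) (fun x => p k x *: v k)).
    by apply: differentiable_sum => k; have [] := h k.
  by apply/funext => y; rewrite fct_sumE.
apply/bddballs_C => r.
have /choice [M hM] : forall k, exists M : RR, forall x, rn x <= r -> rn (p k x *: v k) <= M.
  by move=> k; exact: Hb_bddballs (h k) r.
exists (\sum_k M k) => x xr; apply: le_trans (rn_sum _ _ _) _; apply: ler_sum => k _; exact: hM.
Qed.

Lemma Hb_uniform_limit (X : normedModType C) (V : completeNormedModType C) (F : X -> V) :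
  (forall r e : RR, 0 < e -> exists2 G, Hb G & forall x, rn x <= r -> rn (F x - G x) <= e) ->
  Hb F.
Proof.
move=> h; have Fb : bddballs F.
  move=> r; have [G /Hb_bddballs/(_ r)[M hM] FG] := h r 1 ltr01; exists (M + 1) => x xr.
  have := FG x xr; have := hM x xr; have := rn_leB (F x) (G x); lra.
apply: diff2_Hb => // r; have [M hM] := Fb (r + 2).
exists (`|M| + 1) => x k xr k1 b d b1 d1; apply/ler_addgt0Pr => e e0.
(* The bound 1 keeps [G] below [|M| + 1] on the circle; [e / 4] covers the four values of [F - G] in
   the second difference. *)
pose e' := Num.min 1 (e / 4); have e'0 : 0 < e' by rewrite lt_min ltr01 divr_gt0.
have e'1 : e' <= 1 by rewrite ge_min lexx.
have e'e : e' <= e / 4 by rewrite ge_min lexx orbT.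
have [G HG FG] := h (r + 2) e' e'0.
have := @cauchy_diff2 V (fun z => G (x + z *: k)) (`|M| + 1) b d (Hb_cdiff x k HG).
rewrite scale0r addr0 => hG.
have near (w : C) : rn w <= 2 -> rn (F (x + w *: k) - G (x + w *: k)) <= e' /\ rn (F (x + w *: k)) <= M.
  move=> w2; have kw : rn (x + w *: k) <= r + 2.
    apply: le_trans (rnD _ _) _; rewrite rnZ; have := rn_ge0 w; have := rn_ge0 k; nra.
  by split; [exact: FG | exact: hM].
have {}hG : rn (d *: (G (x + b *: k) - G x) - b *: (G (x + d *: k) - G x)) <=
    rn b * rn d * rn (b - d) * (`|M| + 1).
  apply: hG => // w w2.
  have [|h1 h2] := near w; first by rewrite w2.
  have := rn_leB (G (x + w *: k)) (F (x + w *: k)); rewrite rnB; have := ler_norm M; lra.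
have [|B1 _] := near b; first lra.
have [|D1 _] := near d; first lra.
have [|Z1 _] := near 0; first by rewrite rn0; lra.
rewrite scale0r addr0 in Z1.
have -> : d *: (F (x + b *: k) - F x) - b *: (F (x + d *: k) - F x) =
  (d *: (G (x + b *: k) - G x) - b *: (G (x + d *: k) - G x)) +
  ((d *: (F (x + b *: k) - G (x + b *: k)) - d *: (F x - G x)) -
   (b *: (F (x + d *: k) - G (x + d *: k)) - b *: (F x - G x))) by module.
apply: le_trans (rnD _ _) _; apply: lerD => //.
apply: le_trans (rnBD _ _) _; apply: le_trans (lerD (rnBD _ _) (rnBD _ _)) _.
have s1 (a : C) (y : V) : rn a <= 1 -> rn y <= e' -> rn (a *: y) <= e'.
  by move=> a1 ye; rewrite rnZ; have := rn_ge0 a; have := rn_ge0 y; nra.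
have := s1 _ _ d1 B1; have := s1 _ _ d1 Z1; have := s1 _ _ b1 D1; have := s1 _ _ b1 Z1.
lra.
Qed.

Lemma psum_hpoly n (V Z : normedModType C) (P : set (V -> C)) (Q : V -> Z) : (0 < n)%N ->
  (forall p, P p -> hpoly n (p : V -> (C : normedModType C))) -> psum P Q -> hpoly n Q.
Proof.
move=> n0 hP [m [p [v [hp hQ]]]].
have /choice [A hA] : forall k, exists A : ('I_n -> V) -> (C : normedModType C),
    multilinear A /\ forall x, p k x = A (fun=> x).
  by move=> k; have [_ h] := hP _ (hp k).
pose B x := \sum_(k < m) A k x *: v k.
have Bm : multilinear B.
  move=> k x a y z; rewrite /B scaler_sumr -big_split; apply: eq_bigr => l _ /=.
  by have [-> _] := hA l; rewrite scalerDl; congr (_ + _); rewrite scalerA.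
have QB x : Q x = B (fun=> x).
  by rewrite hQ; apply: eq_bigr => k _; have [_ ->] := hA k.
have -> : Q = fun x => B (fun=> x) by apply/funext.
apply: hpoly_of_polar; first exact: (polar_multilinear n0).
  by move=> x; exact: (polar_diag n0).
move=> r; have /choice [M hM] : forall k, exists M : RR, forall x, rn x <= r -> rn (p k x) <= M.
  by move=> k; exact: (hpoly_bounded n0 (hP _ (hp k)) r).
exists (\sum_(k < m) M k * rn (v k)) => x xr; rewrite -QB hQ.
apply: le_trans (rn_sum _ _ _) _; apply: ler_sum => k _; rewrite rnZ.
by apply: ler_wpM2r; [exact: rn_ge0 | exact: hM].
Qed.

Lemma hpoly_uniform_limit n (X V : normedModType C) (F : X -> V) : (0 < n)%N ->
  (forall r e : RR, 0 < e -> exists2 G, hpoly n G & forall x, rn x <= r -> rn (F x - G x) <= e) ->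
  hpoly n F.
Proof.
move=> n0 h; have /choice [u hu] : forall k : nat, exists G, hpoly n G /\
    forall x, rn x <= k%:R -> rn (F x - G x) <= hp k.
  by move=> k; have [G G1 G2] := h k%:R (hp k) (hp_gt0 k); exists G.
have uF x : Lim false \oo (fun k => u k x) (F x).
  move=> e e0; have [k hk] := hp_lt e0; exists (k + (Num.bound (rn x)))%N => // j /= kj.
  have [_ hj] := hu j; rewrite rnB; apply: le_trans (hj x _) _; last first.
    by apply: le_trans (ltW hk); apply: hp_anti; apply: leq_trans kj; exact: leq_addr.
  apply: le_trans (ltW (archi_boundP (rn_ge0 x))) _; rewrite ler_nat.
  by apply: leq_trans kj; exact: leq_addl.
apply: (hpoly_limit _ uF).
- move=> k x a y z; apply: filterE => s /=; have [hs _] := hu s.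
  by have [m _] := hpoly_polar n0 hs; rewrite m.
- by move=> x; apply: filterE => s /=; have [hs _] := hu s; have [_ ->] := hpoly_polar n0 hs.
- move=> r; have [G hG FG] := h r 1 ltr01; have [M hM] := hpoly_bounded n0 hG r.
  exists (M + 1) => x xr; have := FG x xr; have := hM x xr; have := rn_leB (F x) (G x); lra.
Qed.

Section LiftLimit.
Variables (Y X Z : completeNormedModType C) (i : Y -> X) (q : X -> Z).
Hypotheses (iq : short_exact i q) (ls : locally_splits i).

Definition psum_limit (V : normedModType C) (W : normedModType C) (P : set (V -> C)) (t : V -> W) :=
  forall r e : RR, 0 < e -> exists2 Q, psum P Q & forall x, rn x <= r -> rn (t x - Q x) <= e.

(** Lifting a finite sum only replaces its vectors, so the scalar functions remain in [P].
    Differences of consecutive approximants are lifted separately, with summable norms on growing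
    balls. *)
Lemma lift_psum_limit (V : normedModType C) (P : set (V -> C)) (t : V -> Z) :
  (forall p, P p -> bddballs (p : V -> (C : normedModType C))) -> psum_limit P t ->
  exists2 T : V -> X, q \o T = t & psum_limit P T.
Proof.
move=> hP ht; have [_ [ql qc] _ _ _] := iq; have [mu mu0 box] := box_lift iq ls.
have lift Q (r del : RR) : psum P Q -> 0 < del -> exists Q', [/\ psum P Q', forall x, q (Q' x) = Q x &
    forall x, rn x <= r -> rn (Q' x) <= mu * (rn (Q x) + del)].
  move=> [m [p [v [hp hQ]]]] d0.
  have /choice [B hB] : forall k, exists B : RR, forall x, rn x <= r -> rn (p k x) <= B.
    by move=> k; exact: hP (hp k) r.
  have [v' [qv hv]] := box m v (\sum_k `|B k|) del d0.
  exists (fun x => \sum_(k < m) p k x *: v' k); split.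
  - by exists m, p, v'.
  - by move=> x; rewrite hQ (clin_sum ql); apply: eq_bigr => k _; rewrite (clinZ ql) qv.
  - move=> x xr; rewrite hQ; apply: hv => l; apply: le_trans (hB l x xr) _.
    apply: le_trans (ler_norm _) _; rewrite (bigD1 l) //= lerDl; exact: sumr_ge0.
(* The k-th difference is at most [e k + e k.+1], so taking [e k] for the slack of [box_lift] makes
   its lift at most [mu * (3 * e k)], which is [hp k.+1]. *)
pose e k := hp k / (6 * mu).
have e0 k : 0 < e k by rewrite divr_gt0 ?hp_gt0 // mulr_gt0.
have eS k : e k.+1 = e k / 2 by rewrite /e hpS mulrAC.
have mue k : mu * (3 * e k) = hp k.+1.
  by rewrite /e hpS; field; rewrite gt_eqF.
have /choice [u hu] : forall k : nat, exists Q, psum P Q /\ forall x, rn x <= k%:R -> rn (t x - Q x) <= e k.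
  by move=> k; have [Q Q1 Q2] := ht k%:R (e k) (e0 k); exists Q.
have u'P k : psum P (fun x => u k.+1 x + (-1) *: u k x).
  by apply: psumD; [have [] := hu k.+1 | apply: psumZ; have [] := hu k].
have /choice [D hD] : forall k : nat, exists D, [/\ psum P D, forall x, q (D x) = u k.+1 x - u k x &
    forall x, rn x <= k%:R -> rn (D x) <= hp k.+1].
  move=> k; have [D [D1 D2 D3]] := lift _ k%:R (e k) (u'P k) (e0 k); exists D; split=> //.
    by move=> x; rewrite D2 scaleN1r.
  move=> x xk; apply: le_trans (D3 x xk) _; rewrite scaleN1r -mue ler_pM2l //.
  have h1 := (hu k).2 x xk; have h2 := (hu k.+1).2 x (le_trans xk _).
  have {}h2 : rn (t x - u k.+1 x) <= e k.+1 by apply: h2; rewrite ler_nat.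
  rewrite eS in h2; have := rn_tri (t x) (u k.+1 x) (u k x); rewrite (rnB (u k.+1 x) (t x)); have := e0 k; lra.
have [D0 [D01 D02 _]] := lift _ 0 1 (hu 0%N).1 ltr01.
pose T n x := D0 x + \sum_(k < n) D k x.
have TS n x : T n.+1 x = T n x + D n x by rewrite /T big_ord_recr addrA.
have TP n : psum P (T n).
  elim: n => [|n ih].
    by rewrite (_ : T 0%N = D0) //; apply/funext => x; rewrite /T big_ord0 addr0.
  rewrite (_ : T n.+1 = fun x => T n x + D n x); last by apply/funext => x; rewrite TS.
  by apply: psumD => //; have [] := hD n.
have qT n x : q (T n x) = u n x.
  elim: n => [|n ih]; first by rewrite /T big_ord0 addr0 D02.
  by rewrite TS (clinD ql) ih; have [_ -> _] := hD n; rewrite addrC subrK.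
have cau k n x : rn x <= k%:R -> rn (T (k + n)%N x - T k x) + hp (k + n) <= hp k.
  move=> xk; elim: n => [|n ih]; first by rewrite addn0 subrr rn0 add0r.
  rewrite addnS TS hpS; have [_ _ /(_ x)] := hD (k + n)%N => h.
  have {}h : rn (D (k + n)%N x) <= hp (k + n).+1.
    by apply: h; apply: le_trans xk _; rewrite ler_nat leq_addr.
  rewrite hpS in h; have := rnD (T (k + n)%N x - T k x) (D (k + n)%N x); rewrite addrAC; lra.
have cau' k j x : rn x <= k%:R -> (k <= j)%N -> rn (T j x - T k x) <= hp k.
  by move=> xk kj; have := cau k (j - k)%N x xk; rewrite subnKC //; have := hp_gt0 j; lra.
have /choice [L hL] : forall x, exists l, forall k : nat, rn x <= k%:R -> rn (T k x - l) <= hp k.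
  move=> x; pose k0 := Num.bound (rn x).
  have xk0 : rn x <= k0%:R by rewrite ltW // archi_boundP // rn_ge0.
  have xk k : rn x <= (k0 + k)%:R by apply: le_trans xk0 _; rewrite ler_nat leq_addr.
  have [k j kj|l hl] := @cauchy_seq_lim X (fun k => T (k0 + k)%N x).
    apply: le_trans (cau' _ _ x (xk k) _) _; first by rewrite leq_add2l.
    by apply: hp_anti; exact: leq_addl.
  exists l => k xk'; apply: (@hp_eps _ _ k) => j kj.
  have h1 := hl j; have h2 := cau' k (k0 + j)%N x xk' (leq_trans kj (leq_addl _ _)).
  have := rn_tri (T (k0 + j)%N x) (T k x) l; rewrite (rnB (T k x) (T (k0 + j)%N x)); lra.
exists L.
  have [K K0 hK] := clin_bdd ql qc.
  apply/funext => x; apply/eqP; rewrite -subr_eq0; apply/eqP; apply: rn_eps0 => ep ep0.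
  have m6 : 0 < (6 * mu)^-1 by rewrite invr_gt0 mulr_gt0.
  have K1 : 0 < K + (6 * mu)^-1 by lra.
  have [k1 hk1] := hp_lt (divr_gt0 ep0 K1); pose k := (k1 + Num.bound (rn x))%N.
  have xk : rn x <= k%:R.
    apply: le_trans (ltW (archi_boundP (rn_ge0 x))) _; rewrite ler_nat; exact: leq_addl.
  have h1 := hL x k xk; have h2 := (hu k).2 x xk.
  have h3 : rn (q (L x) - q (T k x)) <= K * hp k.
    by rewrite -(clinB ql); apply: le_trans (hK _) _; rewrite ler_pM2l // rnB.
  rewrite qT in h3; have := rn_tri (u k x) (q (L x)) (t x); rewrite (rnB (u k x) (t x)) /= => h4.
  have h5 : hp k <= hp k1 by apply: hp_anti; exact: leq_addr.
  move: hk1; rewrite ltr_pdivlMr // => hk1; have h6 := hp_gt0 k1.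
  have : K * hp k <= K * hp k1 by rewrite ler_pM2l.
  have : hp k * (6 * mu)^-1 <= hp k1 * (6 * mu)^-1 by rewrite ler_pM2r.
  move: h2; rewrite /e; lra.
move=> r ep ep0; have [k1 hk1] := hp_lt ep0; pose k := (k1 + Num.bound `|r|)%N.
exists (T k) => // x xr; rewrite rnB; apply: le_trans (hL x k _) _.
  apply: le_trans xr _; apply: le_trans (ler_norm r) _.
  by apply: le_trans (ltW (archi_boundP (normr_ge0 r))) _; rewrite ler_nat; exact: leq_addl.
by apply: le_trans (ltW hk1); apply: hp_anti; exact: leq_addr.
Qed.
End LiftLimit.

(** * From extensions and liftings to local splitting *)

(** A closed subspace of the functions from [I] to [W]; its bounded members form a Banach space. It
    will consist of families satisfying prescribed linear relations, or of sequences whose k-th term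
    lies in a prescribed subspace. *)
Record closed_space (I : Type) (W : completeNormedModType C) := ClosedSpace {
  cs_set :> set (I -> W);
  cs_zero : cs_set (fun=> 0);
  cs_lin : forall (a : C) f g, cs_set f -> cs_set g -> cs_set (fun i => a *: f i + g i);
  cs_lim : forall (u : nat -> I -> W) l, (forall k, cs_set (u k)) ->
    (forall k i, rn (u k i - l i) <= hp k) -> cs_set l }.

Record bfun (I : Type) (W : completeNormedModType C) (S : closed_space I W) := Bfun {
  bf :> I -> W;
  bf_in : cs_set S bf;
  bf_bdd : exists M : RR, forall i, rn (bf i) <= M }.

Section Bfun.
Variables (I : Type) (W : completeNormedModType C) (S : closed_space I W).
Implicit Types f g h : bfun S.

Lemma bf_ext f g : (forall i, f i = g i) -> f = g.
Proof.
case: f g => [f f1 f2] [g g1 g2] /= /funext e; case: g / e g1 g2 => g1 g2.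
by congr Bfun; exact: Prop_irrelevance.
Qed.

HB.instance Definition _ := gen_eqMixin (bfun S).
HB.instance Definition _ := gen_choiceMixin (bfun S).

Lemma bf_lin_bdd (a : C) f g : exists M : RR, forall i, rn (a *: f i + g i) <= M.
Proof.
have [[M hM] [N hN]] := (bf_bdd f, bf_bdd g); exists (rn a * M + N) => i.
by apply: le_trans (rnD _ _) _; rewrite rnZ lerD // ler_wpM2l // rn_ge0.
Qed.

Definition bf_comb (a : C) f g := Bfun (cs_lin a (bf_in f) (bf_in g)) (bf_lin_bdd a f g).

Lemma bf_zero_bdd : exists M : RR, forall i : I, rn (0 : W) <= M.
Proof. by exists 0 => i; rewrite rn0. Qed.
Definition bf0 := Bfun (cs_zero S) bf_zero_bdd.

Definition bf_add f g := bf_comb 1 f g.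
Definition bf_scale (a : C) f := bf_comb a f bf0.
Definition bf_opp f := bf_scale (-1) f.

Lemma bf_addA : associative bf_add.
Proof. by move=> f g h; apply: bf_ext => i /=; module. Qed.
Lemma bf_addC : commutative bf_add.
Proof. by move=> f g; apply: bf_ext => i /=; module. Qed.
Lemma bf_add0 : left_id bf0 bf_add.
Proof. by move=> f; apply: bf_ext => i /=; module. Qed.
Lemma bf_addN : left_inverse bf0 bf_opp bf_add.
Proof. by move=> f; apply: bf_ext => i /=; module. Qed.

HB.instance Definition _ := GRing.isZmodule.Build (bfun S) bf_addA bf_addC bf_add0 bf_addN.

Lemma bf_scaleA (a b : C) f : bf_scale a (bf_scale b f) = bf_scale (a * b) f.
Proof. by apply: bf_ext => i /=; module. Qed.
Lemma bf_scale1 : left_id 1 bf_scale.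
Proof. by move=> f; apply: bf_ext => i /=; module. Qed.
Lemma bf_scaleDr : right_distributive bf_scale +%R.
Proof. by move=> a f g; apply: bf_ext => i /=; module. Qed.
Lemma bf_scaleDl f : {morph bf_scale^~ f : a b / a + b}.
Proof. by move=> a b; apply: bf_ext => i /=; module. Qed.

HB.instance Definition _ := GRing.Zmodule_isLmodule.Build C (bfun S)
  bf_scaleA bf_scale1 bf_scaleDr bf_scaleDl.

Lemma bfD f g i : (f + g) i = f i + g i. Proof. by rewrite /= scale1r. Qed.
Lemma bfZ (a : C) f i : (a *: f) i = a *: f i. Proof. by rewrite /= addr0. Qed.
Lemma bfN f i : (- f) i = - f i. Proof. by rewrite /= addr0 scaleN1r. Qed.
Lemma bfB f g i : (f - g) i = f i - g i. Proof. by rewrite bfD bfN. Qed.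
Lemma bf_zero i : (0 : bfun S) i = 0. Proof. by []. Qed.
Lemma bf_sum (J : Type) (r : seq J) (F : J -> bfun S) i :
  (\sum_(j <- r) F j) i = \sum_(j <- r) F j i.
Proof. by elim: r => [|j r ih]; rewrite ?big_nil ?bf_zero // !big_cons bfD ih. Qed.

(** Adjoining 0 makes the supremum meaningful for empty [I]. *)
Definition bf_norm f : RR := sup ([set 0] `|` range (fun i => rn (f i))).

Lemma bf_has_sup f : has_sup ([set 0] `|` range (fun i => rn (f i))).
Proof.
split; first by exists 0; left.
have [M hM] := bf_bdd f; exists (Num.max 0 M) => _ [->|[i _ <-]].
  by rewrite le_max lexx.
by rewrite le_max hM orbT.
Qed.

Lemma bf_norm_ge f i : rn (f i) <= bf_norm f.
Proof. by apply: ub_le_sup; [have [] := bf_has_sup f | right; exists i]. Qed.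

Lemma bf_norm_ge0 f : 0 <= bf_norm f.
Proof. by apply: ub_le_sup; [have [] := bf_has_sup f | left]. Qed.

Lemma bf_norm_le f (M : RR) : 0 <= M -> (forall i, rn (f i) <= M) -> bf_norm f <= M.
Proof.
move=> M0 h; apply: ge_sup; first by have [] := bf_has_sup f.
by move=> _ [->|[i _ <-]].
Qed.

Lemma bf_normD f g : cR (bf_norm (f + g)) <= cR (bf_norm f) + cR (bf_norm g).
Proof.
rewrite -cRD cR_le; apply: bf_norm_le => [|i]; first by rewrite addr_ge0 ?bf_norm_ge0.
by rewrite bfD; apply: le_trans (rnD _ _) _; apply: lerD; exact: bf_norm_ge.
Qed.

Lemma bf_normZ (a : C) f : cR (bf_norm (a *: f)) = `|a| * cR (bf_norm f).
Proof.
rewrite -[`|a|]/(`|a : (C : normedModType C)|) rnE -cRM; congr cR.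
have le (b : C) h : bf_norm (b *: h) <= rn b * bf_norm h.
  apply: bf_norm_le => [|i]; first by rewrite mulr_ge0 ?rn_ge0 ?bf_norm_ge0.
  by rewrite bfZ rnZ; apply: ler_wpM2l; [exact: rn_ge0 | exact: bf_norm_ge].
apply/eqP; rewrite eq_le le /=; have [->|a0] := eqVneq a 0.
  by rewrite rn0 mul0r bf_norm_ge0.
have ra : 0 < rn (a : (C : normedModType C)) by exact: rn_gt0.
rewrite -ler_pdivlMl // -rnV; apply: le_trans (le _ _).
by rewrite scalerA mulVf // scale1r.
Qed.

Lemma bf_norm_eq0 f : cR (bf_norm f) = 0 -> f = 0.
Proof.
rewrite -cR0 => /cR_inj h; apply: bf_ext => i; apply: rn_le0; rewrite -h; exact: bf_norm_ge.
Qed.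

HB.instance Definition _ := @Lmodule_isNormed.Build C (bfun S)
  (fun f => cR (bf_norm f)) bf_normD bf_normZ bf_norm_eq0.

Lemma rn_bf f : rn f = bf_norm f. Proof. by apply: cR_inj; rewrite -rnE. Qed.

Lemma bf_cvg (F : set_system (bfun S)) : ProperFilter F -> cauchy F -> cvg F.
Proof.
move=> FF /cauchyP h.
have /choice [x hx] : forall k : nat, exists x, F [set f | rn (f - x) < hp k.+2].
  move=> k; have e0 : 0 < cR (hp k.+2) by rewrite -cR0 cR_lt hp_gt0.
  have [x hx] := h _ e0; exists x; apply: filterS hx => f /=.
  by rewrite -ball_normE /= rnE cR_lt rnB.
have xx k j : (k <= j)%N -> rn (x j - x k) <= hp k.+1.
  move=> kj; have [f [/= h1 h2]] := filter_ex (filterI (hx k) (hx j)).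
  have := rn_tri f (x j) (x k); rewrite (rnB (x j) f).
  have : hp j.+2 <= hp k.+2 by apply: hp_anti.
  by rewrite !hpS in h1 h2 *; lra.
have /choice [l hl] : forall i, exists l, forall k, rn (x k i - l) <= hp k.
  move=> i; apply: cauchy_seq_lim => k j kj; rewrite -bfB; apply: le_trans (bf_norm_ge _ _) _.
  by rewrite -rn_bf; apply: le_trans (xx k j kj) _; apply: hp_anti.
have lS : cs_set S l by apply: (cs_lim (u := fun k => x k)) => [k|k i] //; exact: bf_in.
have lb : exists M : RR, forall i, rn (l i) <= M.
  exists (rn (x 0%N) + 1) => i; have := hl i 0%N; rewrite hp0 rn_bf => h1.
  by have := rn_leB (l i) (x 0%N i); rewrite (rnB (l i)); have := bf_norm_ge (x 0%N) i; lra.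
pose L := Bfun lS lb.
apply/cvg_ex; exists L => A /rn_nbhs[e e0 hA].
have e2 : 0 < e / 2 by lra.
have [k hk] := hp_lt e2; apply: filterS (hx k) => f /= hf; apply: hA.
have : rn (x k - L) <= hp k by rewrite rn_bf; apply: bf_norm_le => [|i]; [exact: ltW (hp_gt0 _) | rewrite bfB].
have := rn_tri (x k) f L; have := hp_gt0 k; rewrite !hpS in hf; lra.
Qed.

HB.instance Definition _ := Uniform_isComplete.Build (bfun S) bf_cvg.

End Bfun.

(** The counterpart of [biorthogonal] for functionals. It presents a map factoring through the
    [phi j] as a sum of functionals times its own values at the [y l], hence with vectors inside its
    target. *)
Lemma dual_biorthogonal (Y : normedModType C) m (phi : 'I_m -> Y -> C) :
  (forall j, bfunctional (phi j)) ->
  exists (d : nat) (y : 'I_d -> Y) (psi : 'I_d -> Y -> C),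
    [/\ forall l, bfunctional (psi l), forall k l, psi k (y l) = (k == l)%:R &
        forall j u, phi j u = \sum_(l < d) phi j (y l) * psi l u].
Proof.
elim: m phi => [|m ih] phi pb.
  by exists 0%N, (fun=> 0), (fun _ _ => 0); split; case.
have [d [y [psi [psib psiy rep]]]] := ih (phi \o lift ord0) (fun j => pb _).
pose f := phi ord0; have fl := bfun_lin (pb ord0 : bfunctional f).
have pl l := bfun_lin (psib l).
pose w u := f u - \sum_(l < d) f (y l) * psi l u.
have wl : clinear (w : Y -> (C : normedModType C)).
  move=> a u v; rewrite /w fl.
  rewrite (eq_bigr (fun l => a * (f (y l) * psi l u) + f (y l) * psi l v)); last first.
    by move=> l _; rewrite [psi l _]pl /GRing.scale /=; ring.
  by rewrite big_split /= -mulr_sumr /GRing.scale /=; ring.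
have wb : bfunctional w.
  split=> //; have [K K0 hK] := clin_bdd fl (pb ord0).2.
  have /choice [L hL] : forall l, exists L : RR, forall u, rn (psi l u) <= L * rn u.
    by move=> l; have [L _ hL] := clin_bdd (pl l) (psib l).2; exists L.
  apply: (clin_cont wl (K := K + \sum_(l < d) rn (f (y l)) * L l)) => u.
  apply: le_trans (rnBD _ _) _; rewrite mulrDl; apply: lerD => //.
  rewrite mulr_suml; apply: le_trans (rn_sum _ _ _) _; apply: ler_sum => l _.
  by rewrite rnM -mulrA; apply: ler_wpM2l; rewrite ?rn_ge0.
have wy l : w (y l) = 0.
  rewrite /w (bigD1 l) //= psiy eqxx mulr1 big1 ?addr0 ?subrr // => k kl.
  by rewrite psiy (negPf kl) mulr0.
have [[u0 wu0]|w0] := pselect (exists u, w u != 0); last first.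
  exists d, y, psi; split=> // j u; case: (unliftP ord0 j) => [j' ->|->]; first exact: (rep j' u).
  apply/eqP; rewrite -subr_eq0; apply/eqP; apply: contrapT => /eqP h; apply: w0; by exists u.
pose y' := u0 - \sum_(l < d) psi l u0 *: y l.
have psiy' l : psi l y' = 0.
  rewrite /y' [LHS](clinB (pl l)) (clin_sum (pl l)) (bigD1 l) //= (clinZ (pl l)) psiy eqxx.
  rewrite big1 ?addr0; first by rewrite /GRing.scale /= mulr1 subrr.
  by move=> k kl; rewrite (clinZ (pl l)) psiy eq_sym (negPf kl) scaler0.
have wy' : w y' = w u0.
  rewrite /y' [LHS](clinB wl) (clin_sum wl) big1 ?subr0 // => l _.
  by rewrite (clinZ wl) wy scaler0.
pose psi' u := (w u0)^-1 * w u.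
have psi'b : bfunctional psi'.
  have psi'l : clinear (psi' : Y -> (C : normedModType C)).
    by move=> a u v; rewrite /psi' wl /GRing.scale /=; ring.
  split=> //; have [K K0 hK] := clin_bdd wl wb.2.
  apply: (clin_cont psi'l (K := rn (w u0)^-1 * K)) => u; rewrite /psi' rnM -mulrA.
  by apply: ler_wpM2l; rewrite ?rn_ge0.
exists d.+1, (fun l => if unlift ord0 l is Some k then y k else y'),
  (fun l => if unlift ord0 l is Some k then psi k else psi'); split.
- by move=> l; case: (unlift ord0 l).
- move=> k l; case: (unliftP ord0 k) => [k' ->|->]; case: (unliftP ord0 l) => [l' ->|->].
  + by rewrite psiy (inj_eq lift_inj).
  + by rewrite psiy' eq_sym (negPf (neq_lift _ _)).
  + by rewrite /psi' wy mulr0 (negPf (neq_lift _ _)).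
  + by rewrite /psi' wy' mulVf // eqxx.
- move=> j u; rewrite big_ord_recl unlift_none.
  under eq_bigr do rewrite liftK.
  case: (unliftP ord0 j) => [j' ->|->].
    have -> : phi (lift ord0 j') y' = 0.
      by rewrite [LHS](rep j') big1 // => l _; rewrite psiy' mulr0.
    by rewrite mul0r add0r; exact: (rep j').
  have -> : phi ord0 y' = w u0.
    by rewrite -wy' /w big1 ?subr0 // => l _; rewrite psiy' mulr0.
  by rewrite /psi' mulrA divff // mul1r /w subrK.
Qed.

Lemma psum_sum (V : Type) (Z : normedModType C) (P : set (V -> C)) N (Q : nat -> V -> Z) :
  (forall k, psum P (Q k)) -> psum P (fun x => \sum_(k < N) Q k x).
Proof.
move=> h; elim: N => [|N ih].
  exists 0%N, (fun _ _ => 0), (fun=> 0); split; first by case.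
  by move=> x; rewrite !big_ord0.
rewrite (_ : (fun x => _) = fun x => \sum_(k < N) Q k x + Q N x); first exact: psumD.
by apply/funext => x; rewrite big_ord_recr.
Qed.

Definition linear_extensions (Y X : completeNormedModType C) (i : Y -> X) : Prop :=
  forall (E : completeNormedModType C) (t : Y -> E), blinear t -> psum_limit (@bfunctional Y) t ->
    exists2 T : X -> E, blinear T & T \o i = t.

(* Gluing counterexamples for the constants [4^k] with weights [2^-k] contradicts boundedness. *)
Lemma uniform_extensions (Y X : completeNormedModType C) (i : Y -> X) (y0 : Y) :
  y0 != 0 -> linear_extensions i ->
  exists2 c : RR, 0 < c & forall m (phi : 'I_m -> Y -> C), (forall j, bfunctional (phi j)) ->
    (forall j y, rn (phi j y) <= rn y) ->
    exists psi : 'I_m -> X -> C, [/\ forall j, clinear (psi j : X -> (C : normedModType C)),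
      forall j y, psi j (i y) = phi j y, forall j x, rn (psi j x) <= c * rn x &
      forall a : 'I_m -> C, (forall y, \sum_j a j * phi j y = 0) ->
        forall x, \sum_j a j * psi j x = 0].
Proof.
move=> y00 ext; wlog y01 : y0 y00 / rn y0 = 1.
  move=> h; have r0 := rn_gt0 y00; have rne : cR (rn y0) != 0 by rewrite cR_neq0 // gt_eqF.
  apply: (h ((cR (rn y0))^-1 *: y0)); first by rewrite scaler_eq0 negb_or invr_eq0 rne.
  by rewrite rnZ rnV rn_cR gtr0_norm // mulVf // gt_eqF.
apply: contrapT => hn.
have /choice [p hp'] : forall k : nat, exists p : {m : nat & 'I_m -> Y -> C},
   [/\ forall j, bfunctional (projT2 p j), forall j y, rn (projT2 p j y) <= rn y &
   ~ exists psi : 'I_(projT1 p) -> X -> C, [/\ forall j, clinear (psi j : X -> (C : normedModType C)),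
      forall j y, psi j (i y) = projT2 p j y, forall j x, rn (psi j x) <= (hp k)^-1 ^+ 2 * rn x &
      forall a : 'I_(projT1 p) -> C, (forall y, \sum_j a j * projT2 p j y = 0) ->
        forall x, \sum_j a j * psi j x = 0]].
  move=> k; apply: contrapT => h; apply: hn; exists ((hp k)^-1 ^+ 2).
    by rewrite exprn_gt0 // invr_gt0 hp_gt0.
  move=> m phi pb p1; apply: contrapT => h2; apply: h; exists (existT _ m phi); split=> //.
pose m k := projT1 (p k); pose I := {k : nat & 'I_(m k)}.
pose phi (s : I) : Y -> C := projT2 (p (tag s)) (tagged s).
have phib s : bfunctional (phi s) by have [h _ _] := hp' (tag s); exact: h.
have phil s := bfun_lin (phib s).
have phi1 s y : rn (phi s y) <= rn y by have [_ h _] := hp' (tag s); exact: h.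
(* Members of the target satisfy, level by level, every linear relation between the functionals. The
   values of the extension lie there too, which yields the last clause of the conclusion. *)
pose rel (f : I -> Y) := forall k (a : 'I_(m k) -> C),
  (forall y, \sum_j a j * phi (Tagged (fun k => 'I_(m k)) j) y = 0) ->
  \sum_j a j *: f (Tagged (fun k => 'I_(m k)) j) = 0.
have rel0 : rel (fun=> 0) by move=> k a _; rewrite big1 // => j _; rewrite scaler0.
have rel_lin (a : C) f g : rel f -> rel g -> rel (fun s => a *: f s + g s).
  move=> hf hg k b hb; rewrite (eq_bigr (fun j => a *: (b j *: f (Tagged (fun k => 'I_(m k)) j)) +
    b j *: g (Tagged (fun k => 'I_(m k)) j))) => [|j _]; last by module.
  by rewrite big_split -scaler_sumr /= hf // hg // scaler0 addr0.
have rel_lim (u : nat -> I -> Y) l : (forall k, rel (u k)) ->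
    (forall k s, rn (u k s - l s) <= hp k) -> rel l.
  move=> hu hl k a ha; apply: rn_eps0 => e e0.
  have A0 : 0 <= \sum_j rn (a j) by apply: sumr_ge0 => j _; exact: rn_ge0.
  have A1 : 0 < \sum_j rn (a j) + 1 by lra.
  have [n hn'] := hp_lt (divr_gt0 e0 A1); move: hn'; rewrite ltr_pdivlMr // => hn'.
  have := hu n k a ha => h0.
  rewrite (_ : \sum_j _ = \sum_j a j *: l (Tagged (fun k => 'I_(m k)) j) - \sum_j a j *: u n (Tagged (fun k => 'I_(m k)) j));
    last by rewrite h0 subr0.
  rewrite -sumrB.
  apply: le_trans (rn_sum _ _ _) _.
  apply: (@le_trans _ _ (\sum_j rn (a j) * hp n)).
    by apply: ler_sum => j _; rewrite -scalerBr rnZ ler_wpM2l ?rn_ge0 // rnB.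
  by rewrite -mulr_suml; have := hp_gt0 n; lra.
pose S := @ClosedSpace I Y rel rel0 rel_lin rel_lim.
have relv (y : Y) (B : pred nat) :
    rel (fun s => (if B (tag s) then cR (hp (tag s)) * phi s y else 0) *: y0).
  move=> k a ha; rewrite (eq_bigr (fun j => ((if B k then cR (hp k) else 0) *
    (a j * phi (Tagged (fun k => 'I_(m k)) j) y)) *: y0)) => [|j _]; last first.
    by rewrite scalerA /=; congr (_ *: _); case: (B k); ring.
  by rewrite -scaler_suml -mulr_sumr ha mulr0 scale0r.
have bdv (y : Y) (B : pred nat) s :
    rn ((if B (tag s) then cR (hp (tag s)) * phi s y else 0) *: y0) <= rn y.
  rewrite rnZ y01 mulr1; case: (B _); last by rewrite rn0 rn_ge0.
  rewrite rnM rn_hp; have := phi1 s y; have := rn_ge0 (phi s y : (C : normedModType C)).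
  by have := hp_le1 (tag s); have := hp_gt0 (tag s); nra.
(* [B] selects levels: [xpredT] gives the glued map and [pred1 k] a single block, of finite rank.
   Scalars are carried by the line of [y0] and read off again by a norming functional. *)
pose vec (B : pred nat) (y : Y) : bfun S :=
  Bfun (relv y B : cs_set S _) (ex_intro _ (rn y) (bdv y B)).
pose t := vec xpredT.
have tl : clinear t.
  move=> a u v; apply: bf_ext => s; rewrite bfD bfZ /=.
  by rewrite (_ : phi s (a *: u + v) = a * phi s u + phi s v); [module | exact: phil].
have tb : blinear t.
  split=> //; apply: (clin_cont tl (K := 1)) => y; rewrite mul1r rn_bf.
  by apply: bf_norm_le => [|s]; [exact: rn_ge0 | exact: (bdv y xpredT s)].
have tA : psum_limit (@bfunctional Y) t.
  move=> r e e0.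
  pose R k y := vec (pred1 k) y.
  have Rp k : psum (@bfunctional Y) (R k).
    have [d [y [psi [psib _ rep]]]] := dual_biorthogonal
      (fun j : 'I_(m k) => phib (Tagged (fun k => 'I_(m k)) j)).
    exists d, psi, (fun l => R k (y l)); split=> // u; apply: bf_ext => s; rewrite bf_sum.
    under eq_bigr do rewrite bfZ /= scalerA.
    rewrite -scaler_suml /=; congr (_ *: _); case: eqP => [|_]; last first.
      by rewrite big1 // => l _; rewrite mulr0.
    case: s => k' j /= ek; move: j; rewrite ek => j.
    rewrite [phi _ u](rep j) mulr_sumr; apply: eq_bigr => l _; rewrite /phi /=; ring.
  pose M := `|r| + 1; have M0 : 0 < M by rewrite /M; have := normr_ge0 r; lra.
  have [N hN] := hp_lt (divr_gt0 e0 M0).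
  exists (fun y => \sum_(k < N) R k y); first exact: psum_sum.
  have Rs n y s : (\sum_(k < n) R k y) s = if (tag s < n)%N then t y s else 0.
    elim: n => [|n ih]; first by rewrite big_ord0.
    rewrite big_ord_recr bfD ih /= ltnS.
    by case: (ltngtP (tag s) n) => //= _; rewrite ?scale0r ?addr0 ?add0r.
  move=> y yr; rewrite rn_bf; apply: bf_norm_le => [|s]; first exact: ltW.
  rewrite bfB Rs; case: ltnP => [_|sN]; first by rewrite subrr rn0 ltW.
  rewrite subr0 /= rnZ y01 mulr1 rnM rn_hp.
  have h1 := phi1 s y; have h2 := hp_anti sN; have h3 := hp_gt0 (tag s).
  have h4 : rn y <= M by rewrite /M; have := ler_norm r; lra.
  have h5 := rn_ge0 (phi s y : (C : normedModType C)).
  move: hN; rewrite ltr_pdivlMr // => hN; apply: le_trans (ltW hN).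
  by apply: ler_pM => //; [exact: ltW | exact: le_trans h1 h4].
have [T [Tl Tc] Ti] := ext _ t tb tA.
have [K K0 hK] := clin_bdd Tl Tc.
have Ki : 0 < K^-1 by rewrite invr_gt0.
(* Removing the weight costs (hp k)^-1 and [T] at most [K], which is below (hp k)^-1: together
   within the bound denied to level [k]. *)
have [k hk] := hp_lt Ki.
have [chi [chib chi1 chiy]] := exists_functional y0; have chil := bfun_lin chib.
rewrite y01 cR1 in chiy.
have [_ _] := hp' k; apply.
have rh : rn (cR (hp k))^-1 = (hp k)^-1 by rewrite rnV rn_hp.
exists (fun j x => (cR (hp k))^-1 * chi (T x (Tagged (fun k => 'I_(m k)) j))); split.
- move=> j a x y; rewrite Tl bfD bfZ chil /GRing.scale /=; ring.
- move=> j y; rewrite -[T (i y)]/((T \o i) y) Ti /= (clinZ chil) chiy /GRing.scale /= mulr1.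
  by rewrite mulrA mulVf ?mul1r // hp_neq0.
- move=> j x; rewrite rnM rh expr2 -mulrA; apply: ler_wpM2l; first by rewrite invr_ge0 ltW // hp_gt0.
  apply: le_trans (chi1 _) _; apply: le_trans (bf_norm_ge _ _) _; rewrite -rn_bf.
  apply: le_trans (hK x) _; apply: ler_wpM2r; first exact: rn_ge0.
  by rewrite -[K]invrK; rewrite lef_pV2 ?posrE ?hp_gt0 // ltW.
- move=> a ha x.
  have h := (bf_in (T x) : rel _) k a ha.
  transitivity ((cR (hp k))^-1 * chi (\sum_j a j *: T x (Tagged (fun k => 'I_(m k)) j))).
    rewrite (clin_sum chil) mulr_sumr; apply: eq_bigr => j _.
    by rewrite (clinZ chil) /GRing.scale /=; ring.
  by rewrite h [chi 0](clin0 chil) mulr0.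
Qed.

(** * Finite-rank maps, and retractions without norm control *)

Lemma clin_lin_comp (X V W : normedModType C) (f : X -> V) (g : V -> W) :
  clinear f -> clinear g -> clinear (g \o f).
Proof. by move=> fl gl a x y; rewrite /= fl gl. Qed.

Lemma clin_finite_rank (X V : normedModType C) d (phi : 'I_d -> X -> C) (w : 'I_d -> V) :
  (forall l, clinear (phi l : X -> (C : normedModType C))) ->
  clinear (fun x => \sum_(l < d) phi l x *: w l).
Proof.
move=> hl a x y; rewrite scaler_sumr -big_split; apply: eq_bigr => l _ /=.
by rewrite (_ : phi l (a *: x + y) = a * phi l x + phi l y); [module | exact: hl].
Qed.

Lemma finite_rank_bdd (X V : normedModType C) d (phi : 'I_d -> X -> C) (w : 'I_d -> V) :
  (forall l, bfunctional (phi l)) ->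
  exists2 K : RR, 0 <= K & forall x, rn (\sum_(l < d) phi l x *: w l) <= K * rn x.
Proof.
move=> hp; have /choice [L hL] : forall l, exists L : RR, 0 <= L /\ forall x, rn (phi l x) <= L * rn x.
  by move=> l; have [L L0 hL] := clin_bdd (bfun_lin (hp l)) (hp l).2; exists L; split=> //; exact: ltW.
exists (\sum_(l < d) L l * rn (w l)).
  by apply: sumr_ge0 => l _; rewrite mulr_ge0 ?rn_ge0 //; have [] := hL l.
move=> x; apply: le_trans (rn_sum _ _ _) _; rewrite mulr_suml; apply: ler_sum => l _.
rewrite rnZ mulrAC; apply: ler_wpM2r; first exact: rn_ge0.
by have [_] := hL l.
Qed.

Lemma span_projection (X : normedModType C) m (s : 'I_m -> X) :
  exists2 Q : X -> X, clinear Q /\ exists2 K : RR, 0 < K & forall x, rn (Q x) <= K * rn x &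
    forall x, span_of s x <-> Q x = 0.
Proof.
have [d [e [phi [pb _ es sx]]]] := biorthogonal s.
have Pl := clin_finite_rank e (fun l => bfun_lin (pb l)).
have [K K0 hK] := finite_rank_bdd e pb.
exists (fun x => x - \sum_(l < d) phi l x *: e l).
  split; first by move=> a x y; rewrite Pl; module.
  exists (1 + K); first lra.
  move=> x; apply: le_trans (rnBD _ _) _; rewrite mulrDl mul1r lerD2l; exact: hK.
move=> x; split=> [/sx e1|/eqP]; first by rewrite -e1 subrr.
by rewrite subr_eq0 => /eqP ->; apply: span_of_sum.
Qed.

(** The part of the span inside the range of [i] comes without a spanning family, so induction runs
    over [s]: each further generator adds at most one dimension to that part. *)
Lemma finite_rank_retraction (X Y : normedModType C) (i : Y -> X) m (s : 'I_m -> X) :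
  clinear i -> injective i ->
  exists d (phi : 'I_d -> X -> C) (w : 'I_d -> Y), (forall l, bfunctional (phi l)) /\
    forall y, span_of s (i y) -> y = \sum_(l < d) phi l (i y) *: w l.
Proof.
move=> il inji; elim: m s => [|m ih] s.
  exists 0%N, (fun _ _ => 0), (fun=> 0); split; first by case.
  by move=> y [c]; rewrite !big_ord0 -(clin0 il) => /inji.
have [d [phi [w [pb hw]]]] := ih (s \o lift ord0).
have dec x : span_of s x -> exists c : C, exists2 x', span_of (s \o lift ord0) x' & x = c *: s ord0 + x'.
  move=> [c ->]; rewrite big_ord_recl; exists (c ord0); eexists; last reflexivity.
  by exists (fun k => c (lift ord0 k)).
have [[y1 y1s y1n]|hn] := pselect (exists2 y1, span_of s (i y1) & ~ span_of (s \o lift ord0) (i y1));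
  last first.
  exists d, phi, w; split=> // y ys; apply: hw; apply: contrapT => h; apply: hn; by exists y.
have [c1 [x1 x1s e1]] := dec _ y1s.
have c0 : c1 != 0.
  by apply: contra_notN y1n => /eqP c0; rewrite e1 c0 scale0r add0r.
have [Q [Ql [K K0 hK]] Qs] := span_projection (s \o lift ord0).
have Q1 : Q (i y1) != 0 by apply/eqP => /Qs.
have [th [thb th1 thQ]] := exists_functional (Q (i y1)).
have rQ : cR (rn (Q (i y1))) != 0 by rewrite cR_neq0 // gt_eqF // rn_gt0.
pose psi x := (cR (rn (Q (i y1))))^-1 * th (Q x).
have psil : clinear (psi : X -> (C : normedModType C)).
  by move=> a x y; rewrite /psi Ql (bfun_lin thb) /GRing.scale /=; ring.
have psib : bfunctional psi.
  split=> //; apply: (clin_cont psil (K := rn (cR (rn (Q (i y1))))^-1 * K)) => x.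
  rewrite /psi rnM -mulrA; apply: ler_wpM2l; first exact: rn_ge0.
  exact: le_trans (th1 _) (hK _).
have psi1 : psi (i y1) = 1 by rewrite /psi thQ mulVf.
have psi0 x : span_of (s \o lift ord0) x -> psi x = 0.
  by move=> /Qs Qx; rewrite /psi Qx [th 0](clin0 (bfun_lin thb)) mulr0.
pose T y := \sum_(l < d) phi l (i y) *: w l.
exists d.+1, (fun l => if unlift ord0 l is Some k then phi k else psi),
  (fun l => if unlift ord0 l is Some k then w k else y1 - T y1); split.
  by move=> l; case: (unlift ord0 l).
move=> y ys; rewrite big_ord_recl unlift_none; under eq_bigr do rewrite liftK.
have [b [x2 x2s e2]] := dec _ ys; set a := psi (i y).
have yas : span_of (s \o lift ord0) (i (y - (b / c1) *: y1)).
  rewrite (clinB il) (clinZ il) e1 e2 (_ : _ - _ = - (b / c1) *: x1 + x2).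
    exact: span_of_lin.
  by module_core (GRing.PzRing.sort (C : pzRingType)); field.
have ab : a = b / c1.
  have := psi0 _ yas; rewrite (clinB il) (clinZ il) (clinB psil) (clinZ psil) psi1 => /eqP.
  by rewrite subr_eq0 /GRing.scale /= mulr1 => /eqP.
have := hw _ yas; rewrite -ab -/(T (y - a *: y1)).
have Tl : clinear T := clin_lin_comp il (clin_finite_rank w (fun l => bfun_lin (pb l))).
rewrite (clinB Tl) (clinZ Tl) => h; rewrite -[LHS](subrK (a *: y1)) h -/(T y); module.
Qed.

(** * Tuples with the maximum norm and Helly's argument *)

Section Helly.
Variables (X Y : normedModType C) (m : nat).
Let V := {ffun 'I_m -> Y}.

Definition max_norm (v : V) : RR := \big[Num.max/0]_j rn (v j).

Lemma max_norm_ge (v : V) j : rn (v j) <= max_norm v.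
Proof. by rewrite /max_norm (bigD1 j) //= le_max lexx. Qed.

Lemma max_norm_ge0 (v : V) : 0 <= max_norm v. Proof. exact: bigmax_ge_id. Qed.

Lemma max_norm_le (v : V) (M : RR) : 0 <= M -> (forall j, rn (v j) <= M) -> max_norm v <= M.
Proof. by move=> M0 h; apply: bigmax_le. Qed.

Lemma seminorm_max_norm : seminorm max_norm.
Proof.
have le (a : C) v : max_norm (a *: v) <= rn a * max_norm v.
  apply: max_norm_le => [|j]; first by rewrite mulr_ge0 ?rn_ge0 ?max_norm_ge0.
  by rewrite ffunE rnZ; apply: ler_wpM2l; [exact: rn_ge0 | exact: max_norm_ge].
split=> [v w|a v].
  apply: max_norm_le => [|j]; first by rewrite addr_ge0 ?max_norm_ge0.
  by rewrite ffunE; apply: le_trans (rnD _ _) _; apply: lerD; exact: max_norm_ge.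
apply/eqP; rewrite eq_le le /=; have [->|a0] := eqVneq a 0.
  by rewrite rn0 mul0r max_norm_ge0.
have ra : 0 < rn (a : (C : normedModType C)) by exact: rn_gt0.
rewrite -ler_pdivlMl // -rnV; apply: le_trans (le _ _).
by rewrite scalerA mulVf // scale1r.
Qed.

Definition slot (j : 'I_m) (y : Y) : V := [ffun k => if k == j then y else 0].

Lemma slot_sum (v : V) : v = \sum_j slot j (v j).
Proof.
apply/ffunP => k; rewrite sum_ffunE (bigD1 k) //= ffunE eqxx big1 ?addr0 // => j jk.
by rewrite ffunE eq_sym (negPf jk).
Qed.

Lemma unit_phase (z : C) : exists2 u : C, rn u = 1 & u * z = cR (rn z).
Proof.
have [->|z0] := eqVneq z 0; first by exists 1; rewrite ?rn1 // mulr0 rn0 cR0.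
have rz : 0 < rn (z : (C : normedModType C)) by exact: rn_gt0.
exists (cR (rn z) / z); last by rewrite divfK.
by rewrite rnM rn_cR rnV gtr0_norm // divff // gt_eqF.
Qed.

(** A functional for the maximum norm has components whose norms sum to at most 1: vectors almost
    norming each component, turned by phases to make all values positive, form one tuple of norm at
    most 1. *)
Lemma dual_max_norm (F : V -> C) :
  (forall (a : C) v w, F (a *: v + w) = a * F v + F w) -> (forall v, rn (F v) <= max_norm v) ->
  exists n : 'I_m -> RR, [/\ forall j, 0 <= n j, \sum_j n j <= 1 &
    forall j y, rn (F (slot j y)) <= n j * rn y].
Proof.
move=> Fl Fb.
have F0 : F 0 = 0.
  by have := Fl (-1) 0 0; rewrite scaler0 addr0 mulN1r addNr.
have FZ (a : C) v : F (a *: v) = a * F v by have := Fl a v 0; rewrite !addr0 F0 addr0.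
have FD v w : F (v + w) = F v + F w by have := Fl 1 v w; rewrite scale1r mul1r.
have slotZ j (a : C) y : slot j (a *: y) = a *: slot j y.
  by apply/ffunP => k; rewrite !ffunE; case: eqP; rewrite ?scaler0.
have slot1 j y : rn (F (slot j y)) <= rn y.
  apply: le_trans (Fb _) _; apply: max_norm_le => [|k]; first exact: rn_ge0.
  by rewrite ffunE; case: eqP; rewrite ?rn0 ?rn_ge0.
pose A j : set RR := [set r | exists2 y, rn y <= 1 & r = rn (F (slot j y))].
have Asup j : has_sup (A j).
  split; first by exists (rn (F (slot j 0))), 0; rewrite ?rn0.
  by exists 1 => _ [y y1 ->]; apply: le_trans (slot1 _ _) y1.
have Aub j y : rn y <= 1 -> rn (F (slot j y)) <= sup (A j).
  by move=> y1; apply: ub_le_sup; [have [] := Asup j | exists y].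
exists (fun j => sup (A j)); split.
- by move=> j; apply: le_trans (Aub j 0 _); rewrite ?rn0 // rn_ge0.
- apply/ler_addgt0Pr => e e0.
  (* The error is shared among [m.+1] parts, so that [m = 0] divides by something nonzero. *)
  have m0 : 0 < (m.+1)%:R :> RR by rewrite ltr0n.
  have em : 0 < e / m.+1%:R by rewrite divr_gt0.
  have /choice [y hy] : forall j, exists y, rn y <= 1 /\ sup (A j) - e / m.+1%:R <= rn (F (slot j y)).
    move=> j; have [_ [y y1 ->] h] := sup_adherent em (Asup j).
    by exists y; split=> //; exact: ltW.
  have /choice [u hu] : forall j, exists u : C, rn u = 1 /\ u * F (slot j (y j)) = cR (rn (F (slot j (y j)))).
    by move=> j; have [u u1 u2] := unit_phase (F (slot j (y j))); exists u.
  have Fsum (v : V) : F v = \sum_j F (slot j (v j)).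
    rewrite {1}(slot_sum v); elim: (index_enum _) => [|j r ih]; first by rewrite !big_nil F0.
    by rewrite !big_cons FD ih.
  pose v : V := [ffun j => u j *: y j].
  have v1 : max_norm v <= 1.
    apply: max_norm_le => // j; rewrite ffunE rnZ; have [-> _] := hu j; rewrite mul1r.
    by have [] := hy j.
  have : rn (F v) <= 1 by apply: le_trans (Fb v) v1.
  rewrite Fsum (eq_bigr (fun j => cR (rn (F (slot j (y j)))))) => [|j _]; last first.
    by rewrite ffunE slotZ FZ; have [_ ->] := hu j.
  have -> : \sum_j cR (rn (F (slot j (y j)))) = cR (\sum_j rn (F (slot j (y j)))).
    by apply: (big_rec2 (fun a b => a = cR b)) => [|j a b _ ->]; rewrite ?cR0 ?cRD.
  rewrite rn_cR ger0_norm ?sumr_ge0 // => [h|j _]; last exact: rn_ge0.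
  apply: (@le_trans _ _ (\sum_j (rn (F (slot j (y j))) + e / m.+1%:R))).
    by apply: ler_sum => j _; have [_] := hy j; rewrite lerBlDr.
  rewrite big_split /= sumr_const card_ord; apply: lerD => //.
  rewrite -[_ *+ m]mulr_natr mulrAC ler_pdivrMr // ler_pM2l // ler_nat; exact: leqnSn.
- move=> j y; have [->|y0] := eqVneq y 0.
    by rewrite (_ : slot j 0 = 0) ?F0 ?rn0 ?mulr0 //; apply/ffunP => k; rewrite !ffunE; case: eqP.
  have ry := rn_gt0 y0; have yne : cR (rn y) != 0 by rewrite cR_neq0 // gt_eqF.
  rewrite -ler_pdivrMr //.
  have := Aub j ((cR (rn y))^-1 *: y); rewrite slotZ FZ rnM rnZ !rnV rn_cR gtr0_norm //.
  by rewrite mulVf ?gt_eqF // lexx mulrC; apply.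
Qed.
End Helly.

Section Converse.
Variables (Y X : completeNormedModType C) (i : Y -> X).
Hypotheses (il : clinear i) (ic : continuous i) (inji : injective i).

(* Helly's argument: by Hahn-Banach on the tuples of values, the absence of a good retraction
   would produce functionals on [Y] whose extensions to [X] violate the uniform bound. *)
Lemma retraction_on_points (c : RR) m (s : 'I_m -> X) n (x : 'I_n -> X) :
  0 < c ->
  (forall n (phi : 'I_n -> Y -> C), (forall j, bfunctional (phi j)) ->
    (forall j y, rn (phi j y) <= rn y) ->
    exists psi : 'I_n -> X -> C, [/\ forall j, clinear (psi j : X -> (C : normedModType C)),
      forall j y, psi j (i y) = phi j y, forall j x, rn (psi j x) <= c * rn x &
      forall a : 'I_n -> C, (forall y, \sum_j a j * phi j y = 0) ->
        forall x, \sum_j a j * psi j x = 0]) ->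
  (forall j, rn (x j) <= 2) ->
  exists T : X -> Y, [/\ clinear T, forall y, span_of s (i y) -> T (i y) = y &
    forall j, rn (T (x j)) <= 2 * c + 1].
Proof.
move=> c0 ext x2; set lam := 2 * c + 1; have lam0 : 0 < lam by rewrite /lam; lra.
have [d [phi [w [pb hw]]]] := finite_rank_retraction s il inji.
pose T0 x := \sum_(l < d) phi l x *: w l.
have T0l : clinear T0 := clin_finite_rank w (fun l => bfun_lin (pb l)).
pose V := {ffun 'I_n -> Y}.
(* The possible changes of the values at the [x j] when a retraction is altered by a linear map
   vanishing where retractions are prescribed. If no tuple in [a + M] is short, Hahn-Banach
   separates. *)
pose M : set V := [set v | exists S : X -> Y, [/\ clinear S, forall y, span_of s (i y) -> S (i y) = 0 &
  forall j, v j = S (x j)]].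
pose a : V := [ffun j => T0 (x j)].
have M0 : M 0.
  exists (fun=> 0); split=> [b u v|//|j]; last by rewrite ffunE.
  by rewrite scaler0 addr0.
have Ml (b : C) u v : M u -> M v -> M (b *: u + v).
  move=> [S1 [S1l S10 S1x]] [S2 [S2l S20 S2x]]; exists (fun x => b *: S1 x + S2 x); split.
  - by move=> b' u' v'; rewrite S1l S2l; module.
  - by move=> y ys; rewrite S10 // S20 // scaler0 addr0.
  - by move=> j; rewrite !ffunE S1x S2x.
apply: contrapT => hn.
have dist v : M v -> lam <= max_norm (a + v).
  move=> [S [Sl S0 Sx]]; rewrite leNgt; apply/negP => h; apply: hn.
  exists (fun x => T0 x + S x); split.
  - by move=> b u u'; rewrite T0l Sl; module.
  - by move=> y ys; rewrite S0 // addr0 /T0 -hw.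
  - move=> j; apply: ltW; apply: le_lt_trans h.
    by have := max_norm_ge (a + v) j; rewrite !ffunE Sx.
have [F [Fl Fb FM Fa]] := hahn_banach_dist (seminorm_max_norm Y n) M0 Ml lam0 dist.
have [N [N0 N1 hN]] := dual_max_norm Fl Fb.
have F0 : F 0 = 0.
  by have := Fl (-1) 0 0; rewrite scaler0 addr0 mulN1r addNr.
have FD v v' : F (v + v') = F v + F v' by have := Fl 1 v v'; rewrite scale1r mul1r.
have Fsum (v : V) : F v = \sum_j F (slot j (v j)).
  rewrite {1}(slot_sum v); elim: (index_enum _) => [|j r ih]; first by rewrite !big_nil F0.
  by rewrite !big_cons FD ih.
have slot_lin j (b : C) u v : F (slot j (b *: u + v)) = b * F (slot j u) + F (slot j v).
  rewrite -Fl; congr F; apply/ffunP => k; rewrite !ffunE; case: eqP => //.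
  by rewrite scaler0 addr0.
pose f j (y : Y) : C := cR (N j)^-1 * F (slot j y).
have fl j : clinear (f j : Y -> (C : normedModType C)).
  by move=> b u v; rewrite /f slot_lin /GRing.scale /=; ring.
have f1 j y : rn (f j y) <= rn y.
  rewrite /f rnM rn_cR ger0_norm ?invr_ge0 //.
  have [n0|n0] := eqVneq (N j) 0; first by rewrite n0 invr0 mul0r rn_ge0.
  by rewrite ler_pdivrMl; [exact: hN | rewrite lt_neqAle eq_sym n0 N0].
have Ff j y : F (slot j y) = cR (N j) * f j y.
  rewrite /f mulrA -cRM; have [n0|n0] := eqVneq (N j) 0.
    rewrite n0 mul0r cR0 mul0r; have := hN j y; rewrite n0 mul0r.
    by move/(rn_le0 (V := (C : normedModType C))).
  by rewrite divff // cR1 mul1r.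
have fb j : bfunctional (f j).
  by split; [exact: fl | apply: (clin_cont (fl j) (K := 1)) => y; rewrite mul1r].
have [psi [psil psii psib rel]] := ext n f fb f1.
pose R u := u - i (T0 u).
have Rl : clinear R by move=> b u v; rewrite /R T0l il; module.
have Ri y : span_of s (i y) -> R (i y) = 0 by move=> ys; rewrite /R /T0 -hw // subrr.
(* Expanding the [R (x j)] along a basis [g] with coordinates [chi] turns the sum into combinations
   of the [psi j (g k)]. For each [k] the same combination of the [f j] vanishes, because the
   rank-one map sending [u] to [chi k (R u) *: y] has its tuple of values in [M]; the relation then
   passes to the [psi j]. *)
have key : \sum_j cR (N j) * psi j (R (x j)) = 0.
  have [e [g [chi [chib _ _ gx]]]] := biorthogonal (fun j => R (x j)).
  have chil k := bfun_lin (chib k).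
  have rk k u : \sum_j (cR (N j) * chi k (R (x j))) * psi j u = 0.
    apply: rel => y; pose v : V := [ffun j => chi k (R (x j)) *: y].
    have /FM : M v.
      exists (fun u => chi k (R u) *: y); split=> [b u1 u2|y' ys|j]; last by rewrite ffunE.
        by rewrite Rl [chi k _](chil k) scalerDl -scalerA.
      by rewrite Ri // [chi k 0](clin0 (chil k)) scale0r.
    rewrite Fsum => h; rewrite -[RHS]h; apply: eq_bigr => j _; rewrite ffunE Ff [f j (_ *: _)](clinZ (fl j)).
    by rewrite -mulrA.
  transitivity (\sum_k \sum_j (cR (N j) * chi k (R (x j))) * psi j (g k)); last by rewrite big1.
  rewrite exchange_big; apply: eq_bigr => j _ /=.
  rewrite {1}(gx (R (x j)) (span_of_mem (fun j => R (x j)) j)) [psi j _](clin_sum (psil j)) mulr_sumr.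
  by apply: eq_bigr => k _; rewrite [psi j _](clinZ (psil j)) /GRing.scale /= mulrA.
(* Since [psi j] extends [f j], the value of [F] at [a] is a sum over [i (T0 (x j))]; by [key] these
   points may be replaced by the [x j]. The bound is then [2 * c], less than [lam]. *)
have lamE : cR lam = \sum_j cR (N j) * psi j (x j).
  rewrite -Fa Fsum; transitivity (\sum_j cR (N j) * psi j (i (T0 (x j)))).
    by apply: eq_bigr => j _; rewrite psii ffunE Ff.
  apply/eqP; rewrite eq_sym -subr_eq0 -sumrB -{2}key; apply/eqP; apply: eq_bigr => j _.
  by rewrite /R [psi j (_ - _)](clinB (psil j)); ring.
have : rn (cR lam) <= 2 * c.
  rewrite lamE; apply: le_trans (rn_sum _ _ _) _.
  apply: (@le_trans _ _ (\sum_j N j * (2 * c))).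
    apply: ler_sum => j _; rewrite rnM rn_cR ger0_norm //; apply: ler_wpM2l => //.
    by apply: le_trans (psib j _) _; rewrite mulrC ler_pM2r.
  by rewrite -mulr_suml; apply: ler_piMl => //; lra.
by rewrite rn_cR gtr0_norm // /lam; lra.
Qed.

Lemma span_net m (s : 'I_m -> X) : exists n (x : 'I_n -> X),
  (forall j, span_of s (x j) /\ rn (x j) <= 2) /\
  forall u, span_of s u -> rn u <= 1 -> exists j, rn (u - x j) <= 2^-1.
Proof.
have [d [e [phi [pb _ es sx]]]] := biorthogonal s.
have /choice [L hL] : forall l, exists L : RR, 0 < L /\ forall x, rn (phi l x) <= L * rn x.
  by move=> l; have [L L0 hL] := clin_bdd (bfun_lin (pb l)) (pb l).2; exists L.
pose B := \sum_l L l; pose E := \sum_l rn (e l) + 1.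
have E0 : 0 < E by rewrite ltr_pwDr // sumr_ge0 // => l _; exact: rn_ge0.
have eta0 : 0 < (2 * E)^-1 by rewrite invr_gt0; lra.
have [J [c hc]] := complex_net B eta0.
pose g (f : {ffun 'I_d -> J}) := \sum_l c (f l) *: e l.
(* Grid points of norm above 2 are replaced by 0; none of them is needed, as a point within 1/2 of
   the unit ball has norm at most 3/2. *)
pose x (j : 'I_#|{ffun 'I_d -> J}|) : X := if rn (g (enum_val j)) <= 2 then g (enum_val j) else 0.
exists _, x; split=> [j|u us u1].
  rewrite /x; case: ifP => h; last by rewrite rn0; split=> //; exact: span_of0.
  by split=> //; exact: span_of_sum.
have /choice [f hf] : forall l, exists j, rn (phi l u - c j) <= (2 * E)^-1.
  move=> l; apply: hc; have [L0 h] := hL l; apply: le_trans (h u) _.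
  apply: (@le_trans _ _ (L l)); first by rewrite ger_pMr.
  by rewrite /B (bigD1 l) //= lerDl; apply: sumr_ge0 => k _; have [/ltW] := hL k.
pose F : {ffun 'I_d -> J} := [ffun l => f l].
have h : rn (u - g F) <= 2^-1.
  rewrite {1}(sx u us) /g -sumrB; apply: le_trans (rn_sum _ _ _) _.
  apply: (@le_trans _ _ (\sum_l (2 * E)^-1 * rn (e l))).
    by apply: ler_sum => l _; rewrite -scalerBl rnZ ffunE ler_wpM2r ?rn_ge0.
  rewrite -mulr_sumr mulrC ler_pdivrMr; last lra.
  by rewrite mulrA mulVf ?mul1r // /E lerDl.
exists (enum_rank F); rewrite /x enum_rankK ifT //.
have := rn_leB (g F) u; rewrite rnB; lra.
Qed.

Lemma linear_extensions_locally_splits : linear_extensions i -> locally_splits i.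
Proof.
move=> ext; have [[y0 y00]|Y0] := pselect (exists y0 : Y, y0 != 0); last first.
  have Y0' y : y = 0 :> Y by apply/eqP; apply: contrapT => h; apply: Y0; exists y; apply/negP.
  exists 1; split=> // E _; exists (fun=> 0); split=> [a x y _ _|e _|e _ [y <-]].
  - by rewrite scaler0 addr0.
  - by rewrite normr0 mul1r.
  - by rewrite (Y0' y).
have [c c0 U] := uniform_extensions y00 ext.
have l0 : 0 < 2 * (2 * c + 1) by lra.
exists (cR (2 * (2 * c + 1))); split; first by rewrite -cR0 cR_lt.
move=> _ [m [s ->]]; have [n [x [hx net]]] := span_net s.
have [|T [Tl Ti Tx]] := retraction_on_points s c0 U (x := x); first by move=> j; have [] := hx j.
exists T; split=> [a e1 e2 _ _|e es|e es [y ey]]; first exact: Tl; last first.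
  by rewrite -ey Ti // ey.
rewrite !rnE -cRM cR_le; set lam := 2 * c + 1 in Tx *.
have [K K0 hK] : exists2 K : RR, 0 < K & forall u, span_of s u -> rn u <= 1 -> rn (T u) <= K.
  have [d [b [phi [pb _ _ sx]]]] := biorthogonal s.
  have [K K0 hK] := finite_rank_bdd (fun l => T (b l)) pb.
  exists (K + 1) => [|u us u1]; first lra.
  rewrite {1}(sx u us) (clin_sum Tl); under eq_bigr do rewrite (clinZ Tl).
  by apply: le_trans (hK u) _; nra.
(* Control on the net is turned into control on the unit ball: subtracting a net point and doubling
   halves the share of the crude bound [K], which disappears in the limit. *)
have step k u : span_of s u -> rn u <= 1 -> rn (T u) <= 2 * lam + hp k * K.
  elim: k u => [|k ih] u us u1.
    by rewrite hp0 mul1r; apply: le_trans (hK u us u1) _; rewrite lerDr; rewrite /lam; lra.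
  have [j hj] := net u us u1; have [xjs _] := hx j.
  have dus : span_of s (cR 2 *: (u - x j)).
    rewrite (_ : _ *: _ = (- cR 2) *: x j + cR 2 *: u); last by module.
    by apply: span_of_lin => //; rewrite -[_ *: u]addr0; apply: span_of_lin => //; exact: span_of0.
  have n2 : `|2 : RR| = 2 by rewrite ger0_norm.
  have := ih _ dus; rewrite (clinZ Tl) !rnZ rn_cR n2 => h.
  have {}h : 2 * rn (T (u - x j)) <= 2 * lam + hp k * K by apply: h; lra.
  have := rnD (T (u - x j)) (T (x j)); rewrite -(clinD Tl) subrK; have := Tx j.
  by rewrite hpS; lra.
have unit u : span_of s u -> rn u <= 1 -> rn (T u) <= 2 * lam.
  move=> us u1; apply/ler_addgt0Pr => ep ep0; have [k hk] := hp_lt (divr_gt0 ep0 K0).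
  by have := step k u us u1; move: hk; rewrite ltr_pdivlMr //; lra.
have [->|e0] := eqVneq e 0; first by rewrite (clin0 Tl) !rn0 mulr0.
have re := rn_gt0 e0.
have es' : span_of s ((cR (rn e))^-1 *: e).
  by rewrite -[_ *: e]addr0; apply: span_of_lin => //; exact: span_of0.
have := unit _ es'; rewrite (clinZ Tl) !rnZ !rnV rn_cR gtr0_norm // mulVf ?gt_eqF // lexx.
by move=> /(_ isT); rewrite ler_pdivrMl // mulrC.
Qed.
End Converse.

(** * Uniform liftings and the retractions they induce *)

Definition linear_lifts (X Z : completeNormedModType C) (q : X -> Z) : Prop :=
  forall (V : completeNormedModType C) (t : V -> Z), blinear t -> psum_limit (@bfunctional V) t ->
    exists2 T : V -> X, blinear T & q \o T = t.

(** Were there no common constant, subspaces [D k] defeating 4^k could be glued: on bounded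
    sequences with k-th term in [D k], the weighted sum with weights 2^-k is approximable, and a
    bounded lift of it restricts to a forbidden lift of one [D k]. *)
Lemma uniform_lifts (X Z : completeNormedModType C) (q : X -> Z) : clinear q -> linear_lifts q ->
  exists2 c : RR, 0 < c & forall m (v : 'I_m -> Z), exists s : Z -> X,
    [/\ forall (a : C) x y, span_of v x -> span_of v y -> s (a *: x + y) = a *: s x + s y,
        forall z, span_of v z -> q (s z) = z & forall z, span_of v z -> rn (s z) <= c * rn z].
Proof.
move=> ql lift; apply: contrapT => hn.
have /choice [p hp'] : forall k : nat, exists p : {m : nat & 'I_m -> Z}, ~ exists s : Z -> X,
    [/\ forall (a : C) x y, span_of (projT2 p) x -> span_of (projT2 p) y ->
          s (a *: x + y) = a *: s x + s y,
        forall z, span_of (projT2 p) z -> q (s z) = z &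
        forall z, span_of (projT2 p) z -> rn (s z) <= (hp k)^-1 ^+ 2 * rn z].
  move=> k; apply: contrapT => h; apply: hn; exists ((hp k)^-1 ^+ 2).
    by rewrite exprn_gt0 // invr_gt0 hp_gt0.
  by move=> m v; apply: contrapT => h2; apply: h; exists (existT _ m v).
pose D k : set Z := span_of (projT2 (p k)).
have D0 k : D k 0 by exact: span_of0.
have Dlin k (a : C) x y : D k x -> D k y -> D k (a *: x + y) by exact: span_of_lin.
pose rel (f : nat -> Z) := forall k, D k (f k).
have rel_lim (u : nat -> nat -> Z) l : (forall k, rel (u k)) ->
    (forall k s, rn (u k s - l s) <= hp k) -> rel l.
  move=> hu hl k; have [Q [Ql [K K0 hK]] Qs] := span_projection (projT2 (p k)).
  apply/Qs; apply: rn_eps0 => e e0; have [n] := hp_lt (divr_gt0 e0 K0).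
  rewrite ltr_pdivlMr // => hn'; have /Qs Q0 := hu n k.
  have := hK (u n k - l k); rewrite (clinB Ql) Q0 sub0r rnN => h; apply: le_trans h _.
  by have := ler_wpM2l (ltW K0) (hl n k); lra.
pose S := @ClosedSpace nat Z rel (fun k => D0 k) (fun a f g hf hg k => Dlin k a _ _ (hf k) (hg k)) rel_lim.
pose s n (f : bfun S) := \sum_(k < n) cR (hp k) *: f k.
have sS n f : s n.+1 f = s n f + cR (hp n) *: f n by rewrite /s big_ord_recr.
have sl n : clinear (s n).
  elim: n => [|n ih] a f g; first by rewrite /s !big_ord0 scaler0 addr0.
  by rewrite !sS ih bfD bfZ; module.
have ss f n d : rn (s (n + d)%N f - s n f) + 2 * hp (n + d) * rn f <= 2 * hp n * rn f.
  elim: d => [|d ih]; first by rewrite addn0 subrr rn0 add0r.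
  rewrite addnS sS hpS addrAC.
  have := rnD (s (n + d)%N f - s n f) (cR (hp (n + d)) *: f (n + d)%N); rewrite rnZ rn_hp => h.
  have := ler_wpM2l (ltW (hp_gt0 (n + d))) (bf_norm_ge f (n + d)%N); rewrite -rn_bf.
  lra.
have ss' f n j : (n <= j)%N -> rn (s j f - s n f) <= 2 * hp n * rn f.
  move=> nj; have := ss f n (j - n)%N; rewrite subnKC // => h; apply: le_trans h.
  by rewrite lerDl !mulr_ge0 ?rn_ge0 // ltW // hp_gt0.
have /choice [t ht] : forall f, exists l, Lim false \oo (fun n => s n f) l.
  move=> f; apply: Lim_complete => e e0.
  have f1 : 0 < 2 * (rn f + 1) by have := rn_ge0 f; lra.
  have [N] := hp_lt (divr_gt0 e0 f1); rewrite ltr_pdivlMr // => hN.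
  exists (fun=> s N f), (s N f); split; first exact: Lim_cst.
  exists N => // j /= Nj; apply: le_trans (ss' f N j Nj) _.
  by have := rn_ge0 f; have := hp_gt0 N; nra.
have tl : clinear t.
  move=> a f g; apply: (Lim_uniq (ht (a *: f + g))).
  by apply: Lim_ext (Lim_lin a (ht f) (ht g)); apply: filterE => n /=; rewrite sl.
have ts f n : rn (t f - s n f) <= 2 * hp n * rn f.
  apply: (Lim_bound _ (LimB (ht f) (Lim_cst false (s n f)))).
  by exists n => // j /= nj; exact: ss'.
have tb : blinear t.
  split=> //; apply: (clin_cont tl (K := 2)) => f.
  by have := ts f 0%N; rewrite /s big_ord0 subr0 hp0 mulr1.
have evb k (phi : Z -> C) : bfunctional phi -> bfunctional (fun f : bfun S => phi (f k)).
  move=> hb; have pl := bfun_lin hb; have [K K0 hK] := clin_bdd pl hb.2.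
  have l : clinear (fun f : bfun S => phi (f k) : (C : normedModType C)).
    by move=> a f g; rewrite bfD bfZ pl.
  split=> //; apply: (clin_cont l (K := K)) => f; apply: le_trans (hK _) _.
  by rewrite ler_pM2l // rn_bf; exact: bf_norm_ge.
have tA : psum_limit (@bfunctional (bfun S)) t.
  move=> r e e0; pose M := 2 * (`|r| + 1); have M0 : 0 < M by rewrite /M; have := normr_ge0 r; lra.
  have [N] := hp_lt (divr_gt0 e0 M0); rewrite ltr_pdivlMr // => hN.
  exists (s N).
    apply: (@psum_sum _ _ _ N (fun k (f : bfun S) => cR (hp k) *: f k)) => k.
    apply: (@psumZ _ _ _ (fun f : bfun S => f k)); have [d [b [phi [pb _ _ sx]]]] := biorthogonal (projT2 (p k)).
    exists d, (fun l f => phi l (f k)), b; split=> [l|f]; first exact: evb.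
    by apply: sx; exact: (bf_in f).
  move=> f fr; apply: le_trans (ts f N) _; apply: le_trans (ltW hN).
  rewrite -mulrA mulrCA; apply: ler_wpM2l; first exact: ltW (hp_gt0 _).
  by rewrite /M ler_pM2l //; have := ler_norm r; lra.
have [T [Tl Tc] qT] := lift _ t tb tA.
have [K K0 hK] := clin_bdd Tl Tc.
have Ki : 0 < K^-1 by rewrite invr_gt0.
have [k hk] := hp_lt Ki; apply: (hp' k).
have single z : D k z -> rel (fun j => if j == k then z else 0).
  by move=> zD j; case: eqP => [->|_].
have singleb (z : Z) : exists M : RR, forall j : nat, rn (if j == k then z else 0) <= M.
  by exists (rn z) => j; case: eqP => _; rewrite ?rn0 ?rn_ge0.
(* The sequence with [z] in place [k] and zeros elsewhere; outside [D k], where it would leave the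
   space, the default is 0. *)
pose g z : bfun S := if pselect (D k z) is left h then Bfun (single z h : cs_set S _) (singleb z) else 0.
have gE z j : D k z -> g z j = if j == k then z else 0.
  by move=> zD; rewrite /g; case: pselect.
have tg z : D k z -> t (g z) = cR (hp k) *: z.
  move=> zD; apply: (Lim_uniq (ht (g z))); apply: Lim_ext (Lim_cst false _).
  exists k.+1 => // n /= kn; rewrite /s (bigD1 (Ordinal kn)) //= gE // eqxx big1 ?addr0 // => j jk.
  by rewrite gE // ifF ?scaler0 //; apply/negbTE; apply: contra_neq jk => e; exact: val_inj.
have gn z : D k z -> rn (g z) <= rn z.
  move=> zD; rewrite rn_bf; apply: bf_norm_le => [|j]; first exact: rn_ge0.
  by rewrite gE //; case: eqP => _; rewrite ?rn0 ?rn_ge0.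
have rh : rn (cR (hp k))^-1 = (hp k)^-1 by rewrite rnV rn_hp.
exists (fun z => (cR (hp k))^-1 *: T (g z)); split.
- move=> a x y xD yD; have xyD := Dlin k a x y xD yD.
  rewrite (_ : g (a *: x + y) = a *: g x + g y); first by rewrite Tl; module.
  apply: bf_ext => j; rewrite bfD bfZ !gE //; case: eqP => // _.
  by rewrite scaler0 addr0.
- move=> z zD; rewrite (clinZ ql) -[q (T _)]/((q \o T) _) qT tg // scalerA mulVf ?scale1r //.
  exact: hp_neq0.
- move=> z zD; rewrite rnZ rh expr2 -mulrA; apply: ler_wpM2l; first by rewrite invr_ge0 ltW // hp_gt0.
  apply: le_trans (hK _) _; apply: ler_pM; rewrite ?rn_ge0 ?gn // ?ltW //.
  by rewrite -[K]invrK ltf_pV2 ?posrE ?hp_gt0.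
Qed.

Lemma linear_lifts_locally_splits (Y X Z : completeNormedModType C) (i : Y -> X) (q : X -> Z) :
  short_exact i q -> linear_lifts q -> locally_splits i.
Proof.
move=> iq lift; have [[il ic] [ql qc] inji _ ker] := iq.
have [c c0 U] := uniform_lifts ql lift.
have [K K0 hK] := kernel_bounded_below iq; have [L L0 hL] := clin_bdd ql qc.
have /choice [j hj] : forall x, exists y, q x = 0 -> i y = x.
  move=> x; have [/ker[y iy]|h] := pselect (q x = 0); first by exists y.
  by exists 0 => /h.
(* [1 + c * L] bounds the passage from [e] to [e - f (q e)], and [K] the inverse of [i] on the
   kernel of [q]. *)
have b0 : 0 < K * (1 + c * L) by rewrite mulr_gt0 // addr_gt0 // mulr_gt0.
exists (cR (K * (1 + c * L))); split; first by rewrite -cR0 cR_lt.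
move=> _ [m [s ->]]; have [f [fl qf fb]] := U m (q \o s).
have qs e : span_of s e -> span_of (q \o s) (q e).
  by move=> [a ->]; exists a; rewrite (clin_sum ql); apply: eq_bigr => k _; rewrite (clinZ ql).
have iT e : span_of s e -> i (j (e - f (q e))) = e - f (q e).
  by move=> es; apply: hj; rewrite (clinB ql) qf ?subrr //; exact: qs.
exists (fun e => j (e - f (q e))); split.
- move=> a e1 e2 s1 s2; apply: inji; rewrite iT; last exact: span_of_lin.
  by rewrite il !iT // ql fl; [module | exact: qs | exact: qs].
- move=> e es; rewrite !rnE -cRM cR_le -mulrA; apply: le_trans (hK _) _; rewrite ler_pM2l // iT //.
  apply: le_trans (rnBD _ _) _; rewrite mulrDl mul1r lerD2l; apply: le_trans (fb _ (qs _ es)) _.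
  by rewrite -mulrA ler_pM2l.
- move=> e es ey; rewrite iT // (_ : q e = 0); last exact/ker.
  have f0 : f 0 = 0 by have := fb 0 (span_of0 _); rewrite rn0 mulr0 => /rn_le0.
  by rewrite f0 subr0.
Qed.

(** * The equivalences *)

Lemma hpoly1_blinear (X V : normedModType C) (T : X -> V) : hpoly 1 T <-> blinear T.
Proof.
split=> [[Tc [A [Am TA]]]|[Tl Tc]]; split=> //.
  have e (x : X) : (fun=> x) = fupd (fun _ : 'I_1 => 0) ord0 x.
    by apply/funext => k; rewrite /fupd [k]ord1 eqxx.
  by move=> a x y; rewrite !TA (e (a *: x + y)) Am -!e.
exists (fun x => T (x ord0)); split=> // k x a y z.
by rewrite /fupd [k]ord1 eqxx Tl.
Qed.

Lemma hpoly_comp_linear n (X V W : normedModType C) (f : X -> V) (g : V -> W) :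
  hpoly n f -> blinear g -> hpoly n (g \o f).
Proof.
move=> [fc [A [Am fA]]] [gl gc]; split.
  by move=> x; apply: (continuous_comp (fc x) (gc (f x))).
exists (g \o A); split=> [k x a y z|x] /=; first by rewrite Am gl.
by rewrite fA.
Qed.

Lemma power_hpoly n (X : normedModType C) (phi : X -> C) : bfunctional phi ->
  hpoly n (fun x => phi x ^+ n : (C : normedModType C)).
Proof.
move=> [pl pc]; split; first by move=> x; apply: cvg_exprn; exact: pc.
exists (fun x => \prod_(j < n) phi (x j)); split=> [k x a y z|x]; last first.
  by rewrite prodr_const card_ord.
have e u : \prod_(j < n) phi (fupd x k u j) = phi u * \prod_(j < n | j != k) phi (x j).
  rewrite (bigD1 k) //= {1}/fupd eqxx; congr (_ * _).
  by apply: eq_bigr => j jk; rewrite /fupd (negPf jk).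
by rewrite !e pl /GRing.scale /=; ring.
Qed.

(* Differentiating at the origin replaces a holomorphic extension or lifting by a linear one. *)
Lemma linear_part (Y X V W : normedModType C) (i : Y -> X) (T : X -> V) (g : V -> W) :
  Hb T -> blinear i -> blinear g -> clinear (g \o T \o i) ->
  exists2 D : X -> V, blinear D & g \o D \o i = g \o T \o i.
Proof.
move=> [Td _] [il ic] [gl gc] gTi; have [D [Dl Dc hD]] := (differentiable_rnP T 0).1 (Td 0).
exists D => //; apply/funext => y /=.
have [L L0 hL] := clin_bdd gl gc.
apply/eqP; rewrite -subr_eq0; apply/eqP; apply: rn_eps0 => e e0.
have n0 : 0 < L * (rn (i y) + 1) by rewrite mulr_gt0 //; have := rn_ge0 (i y); lra.
have [d d0 hd] := hD _ (divr_gt0 e0 n0).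
have y1 : 0 < rn (i y) + 1 by have := rn_ge0 (i y); lra.
have [k] := hp_lt (divr_gt0 d0 y1); rewrite ltr_pdivlMr // => hk.
have k0 := hp_gt0 k; have := hd (cR (hp k) *: i y).
rewrite add0r (clinZ Dl) rnZ rn_hp => h.
have {}h : rn (T (cR (hp k) *: i y) - T 0 - cR (hp k) *: D (i y)) <=
    e / (L * (rn (i y) + 1)) * (hp k * rn (i y)) by apply: h; lra.
have := le_trans (hL _) (ler_wpM2l (ltW L0) h).
(* [T] may be nonzero at the origin; only its image under [g] is known to vanish there. *)
have gT0 : g (T 0) = 0 by have := clin0 gTi; rewrite /= (clin0 il).
have gTk : g (T (cR (hp k) *: i y)) = cR (hp k) *: g (T (i y)).
  by rewrite -(clinZ il); exact: (clinZ gTi).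
rewrite !(clinB gl) gT0 gTk subr0 (clinZ gl) -scalerBr rnZ rn_hp rnB => h1.
have h2 : L * (e / (L * (rn (i y) + 1)) * (hp k * rn (i y))) <= hp k * e.
  rewrite (_ : L * _ = hp k * e * (rn (i y) / (rn (i y) + 1))); last first.
    by field; rewrite !gt_eqF.
  by apply: ler_piMr; [rewrite mulr_ge0 // ltW | rewrite ler_pdivrMr //; lra].
by have := le_trans h1 h2; rewrite ler_pM2l.
Qed.

Lemma blinear_id (X : normedModType C) : blinear (id : X -> X).
Proof. by split=> // x; exact: cvg_id. Qed.

Section Approximable.
Variables (V W : completeNormedModType C) (t : V -> W).
Hypotheses (tb : blinear t) (tA : psum_limit (@bfunctional V) t).

Lemma approximable_relL b r : relL b (t @` [set x | rn x <= r]).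
Proof.
apply: (@psum_limit_relL _ _ _ (@bfunctional V)).
  move=> p hp; have [K K0 hK] := clin_bdd (bfun_lin hp) hp.2; exists (K * r) => x xr.
  by apply: le_trans (hK x) _; rewrite ler_pM2l.
by move=> e e0; exact: tA.
Qed.

Lemma approximable_uball b : relL b (t @` @uball V).
Proof. by apply: relL_sub (approximable_relL b 1) => _ [x /rn_uball x1 <-]; exists x. Qed.

Lemma approximable_PA : PA 1 t.
Proof.
split; first exact/hpoly1_blinear.
move=> _ /gt0_cR[e e0 ->]; have [Q [m [p [v [hp hQ]]]] tQ] := tA 1 e0.
exists Q; split.
  by exists m, p, v; split=> // x; rewrite hQ; apply: eq_bigr => k _; rewrite expr1.
by move=> x x1; rewrite rnE cR_le; apply: tQ; exact/rn_uball.
Qed.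

Lemma approximable_PK : PK 1 t.
Proof. by split; [exact/hpoly1_blinear | apply/rel_compactP; exact: approximable_uball]. Qed.

Lemma approximable_PW : PW 1 t.
Proof. by split; [exact/hpoly1_blinear | apply/rel_wcompactP; exact: approximable_uball]. Qed.

Lemma approximable_Hb : Hb t.
Proof.
have [tl tc] := tb; have [K K0 hK] := clin_bdd tl tc.
split; first by move=> x; exact: linear_differentiable_rn.
by apply/bddballs_C => r; exists (K * r) => x xr; apply: le_trans (hK x) _; rewrite ler_pM2l.
Qed.

Lemma approximable_HK : HK t.
Proof.
split; first exact: approximable_Hb.
by apply/(locally_relL_balls (@rel_compactP W) approximable_Hb); exact: approximable_relL.
Qed.

Lemma approximable_HW : HW t.
Proof.
split; first exact: approximable_Hb.
by apply/(locally_relL_balls (@rel_wcompactP W) approximable_Hb); exact: approximable_relL.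
Qed.
End Approximable.

Section Equivalences.
Variables (X Y Z : completeNormedModType C) (i : Y -> X) (q : X -> Z).
Hypothesis iq : short_exact i q.

Let ib : blinear i. Proof. by have [] := iq. Qed.
Let qb : blinear q. Proof. by have [] := iq. Qed.
Let inji : injective i. Proof. by have [] := iq. Qed.

(** All that matters is that in degree one the class lies between the approximable linear maps and
    the continuous linear maps. *)
Lemma poly_splits_locally_splits
    (cls : forall n (X V : normedModType C), (X -> V) -> Prop) :
  (forall (A B : normedModType C) (T : A -> B), cls 1 A B T -> hpoly 1 T) ->
  (forall (V W : completeNormedModType C) (t : V -> W), blinear t ->
     psum_limit (@bfunctional V) t -> cls 1 V W t) ->
  poly_splits cls i -> locally_splits i.
Proof.
move=> c1 c2 h; apply: (linear_extensions_locally_splits ib.1 inji) => E t tb tA.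
have [T [/c1/hpoly1_blinear Tb Ti]] := h 1%N isT E t (c2 _ _ _ tb tA).
by exists T.
Qed.

Lemma poly_lifts_locally_splits
    (cls : forall n (X V : normedModType C), (X -> V) -> Prop) :
  (forall (A B : normedModType C) (T : A -> B), cls 1 A B T -> hpoly 1 T) ->
  (forall (V W : completeNormedModType C) (t : V -> W), blinear t ->
     psum_limit (@bfunctional V) t -> cls 1 V W t) ->
  poly_lifts cls q -> locally_splits i.
Proof.
move=> c1 c2 h; apply: (linear_lifts_locally_splits iq) => V t tb tA.
have [T [/c1/hpoly1_blinear Tb Ti]] := h 1%N isT V t (c2 _ _ _ tb tA).
by exists T.
Qed.

Lemma hol_splits_locally_splits (cls : forall X V : normedModType C, (X -> V) -> Prop) :
  (forall (A B : normedModType C) (T : A -> B), cls A B T -> Hb T) ->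
  (forall (V W : completeNormedModType C) (t : V -> W), blinear t ->
     psum_limit (@bfunctional V) t -> cls V W t) ->
  hol_splits cls i -> locally_splits i.
Proof.
move=> c1 c2 h; apply: (linear_extensions_locally_splits ib.1 inji) => E t tb tA.
have [T [/c1 TH Ti]] := h E t (c2 _ _ _ tb tA).
have [|D Db Di] := linear_part TH ib (blinear_id E).
  by rewrite (_ : _ \o _ = t) //; exact: tb.1.
by exists D => //; rewrite -Ti.
Qed.

Lemma hol_lifts_locally_splits (cls : forall X V : normedModType C, (X -> V) -> Prop) :
  (forall (A B : normedModType C) (T : A -> B), cls A B T -> Hb T) ->
  (forall (V W : completeNormedModType C) (t : V -> W), blinear t ->
     psum_limit (@bfunctional V) t -> cls V W t) ->
  hol_lifts cls q -> locally_splits i.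
Proof.
move=> c1 c2 h; apply: (linear_lifts_locally_splits iq) => V t tb tA.
have [T [/c1 TH Ti]] := h V t (c2 _ _ _ tb tA).
have [|D Db Di] := linear_part TH (blinear_id V) qb.
  by rewrite (_ : _ \o _ = t) //; exact: tb.1.
by exists D => //; rewrite -Ti.
Qed.

Hypothesis ls : locally_splits i.

Lemma splits_PA : poly_splits PA i.
Proof.
have [I [U [lam [UU [lam0 [R]]]]]] := locally_splits_retractions inji ls.
by move=> n n0 E t tA; exact: (extend_PA R lam0 n0 tA).
Qed.

Lemma splits_PK : poly_splits PK i.
Proof.
have [I [U [lam [UU [lam0 [R]]]]]] := locally_splits_retractions inji ls.
move=> n n0 E t [tp /rel_compactP tK].
have [T [Tp TK Ti _]] := extend_hpoly R lam0 n0 tp tK.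
by exists T; split=> //; split=> //; exact/rel_compactP.
Qed.

Lemma splits_PW : poly_splits PW i.
Proof.
have [I [U [lam [UU [lam0 [R]]]]]] := locally_splits_retractions inji ls.
move=> n n0 E t [tp /rel_wcompactP tK].
have [T [Tp TK Ti _]] := extend_hpoly R lam0 n0 tp tK.
by exists T; split=> //; split=> //; exact/rel_wcompactP.
Qed.

Lemma splits_HK : hol_splits HK i.
Proof.
have [I [U [lam [UU [lam0 [R]]]]]] := locally_splits_retractions inji ls.
move=> E t [tH /(locally_relL_balls (@rel_compactP E) tH) tK].
have [T [TH TK Ti]] := extend_Hb R lam0 tH tK.
by exists T; split=> //; split=> //; exact/(locally_relL_balls (@rel_compactP E) TH).
Qed.

Lemma splits_HW : hol_splits HW i.
Proof.
have [I [U [lam [UU [lam0 [R]]]]]] := locally_splits_retractions inji ls.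
move=> E t [tH /(locally_relL_balls (@rel_wcompactP E) tH) tK].
have [T [TH TK Ti]] := extend_Hb R lam0 tH tK.
by exists T; split=> //; split=> //; exact/(locally_relL_balls (@rel_wcompactP E) TH).
Qed.

Lemma lifts_PA : poly_lifts PA q.
Proof.
move=> n n0 V t tA.
have bd p : powers_of_functionals n p -> bddballs (p : V -> (C : normedModType C)).
  by move=> hp r; exact: (powers_of_functionals_bdd r hp).
have [T qT TA] := lift_psum_limit iq ls bd (PA_approx tA).
exists T; split=> //; split.
  apply: (hpoly_uniform_limit n0) => r e e0; have [Q hQ TQ] := TA r e e0; exists Q => //.
  apply: (psum_hpoly n0 _ hQ) => _ [phi hp ->]; exact: power_hpoly.
move=> _ /gt0_cR[e e0 ->]; have [Q /finite_type_psum hQ TQ] := TA 1 e e0.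
by exists Q; split=> // x x1; rewrite rnE cR_le; apply: TQ; exact/rn_uball.
Qed.

Hypothesis bap : BAP Z.

(** A finite-rank map close to the identity on the image of a ball makes [t] a limit of sums with
    these scalar functions, which inherit from [t] that they are polynomial or holomorphic. *)
Definition functionals_of (V : Type) (t : V -> Z) : set (V -> C) :=
  [set p | exists2 phi, bfunctional phi & p = phi \o t].

Lemma BAP_approx (V : normedModType C) (t : V -> Z) :
  (forall r, relL false (t @` [set x | rn x <= r])) -> psum_limit (functionals_of t) t.
Proof.
move=> tK r e e0; have [c0 [c00 h]] := bap.
have /rel_compactP K := tK r.
have [|S [Sb [_ [[m [s ->]] SE]] _ Sz]] := h (cR e) _ _ K; first by rewrite -cR0 cR_lt.
have [d [b [phi [pb _ _ sx]]]] := biorthogonal s.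
exists (fun x => S (t x)).
  exists d, (fun k => (phi k \o S) \o t), b; split=> [k|x].
    exists (phi k \o S) => //; have [Sl Sc] := Sb; have [pl pc] := pb k; split.
      by move=> a x y /=; rewrite Sl pl.
    by move=> x; apply: (continuous_comp (Sc x) (pc (S x))).
  by apply: sx; apply: SE; exists (t x).
move=> x xr; rewrite rnB -cR_le -rnE; apply: Sz; apply: subset_closure.
by exists x.
Qed.

Lemma functionals_of_bdd (V : normedModType C) (t : V -> Z) p : bddballs t ->
  functionals_of t p -> bddballs (p : V -> (C : normedModType C)).
Proof.
move=> tb [phi hp ->] r; have [M hM] := tb r; have [K K0 hK] := clin_bdd (bfun_lin hp) hp.2.
by exists (K * M) => x xr; apply: le_trans (hK _) _; rewrite ler_pM2l // hM.
Qed.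

Lemma lifts_PK : poly_lifts PK q.
Proof.
move=> n n0 V t [tp /rel_compactP tK].
have tb : bddballs t by exact: (hpoly_bounded n0 tp).
have [T qT TA] := lift_psum_limit iq ls (fun p => @functionals_of_bdd V t p tb)
  (BAP_approx (hpoly_relL tp tK)).
exists T; split=> //; split.
  apply: (hpoly_uniform_limit n0) => r e e0; have [Q hQ TQ] := TA r e e0; exists Q => //.
  apply: (psum_hpoly n0 _ hQ) => _ [phi hp ->]; apply: (hpoly_comp_linear tp).
  by rewrite -bfunctionalE.
apply/rel_compactP; apply: (@psum_limit_relL _ _ _ (functionals_of t)).
  move=> p /(functionals_of_bdd tb)/(_ 1)[B hB]; exists B => x /rn_uball; exact: hB.
by move=> e e0; have [Q hQ TQ] := TA 1 e e0; exists Q => // x /rn_uball; exact: TQ.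
Qed.

Lemma lifts_HK : hol_lifts HK q.
Proof.
move=> V t [tH /(locally_relL_balls (@rel_compactP Z) tH) tK].
have tb := Hb_bddballs tH.
have [T qT TA] := lift_psum_limit iq ls (fun p => @functionals_of_bdd V t p tb) (BAP_approx tK).
have TH : Hb T.
  apply: Hb_uniform_limit => r e e0; have [Q hQ TQ] := TA r e e0; exists Q => //.
  apply: (psum_Hb _ hQ) => _ [phi hp ->].
  by have [pl pc] := hp; exact: (Hb_comp_linear tH (bfun_lin hp) pc).
exists T; split=> //; split=> //; apply/(locally_relL_balls (@rel_compactP X) TH) => r.
apply: (@psum_limit_relL _ _ _ (functionals_of t)).
  by move=> p /(functionals_of_bdd tb)/(_ r).
by move=> e e0; exact: TA.
Qed.
End Equivalences.

Theorem theorem2 (X Y Z : completeNormedModType C)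
  (i : Y -> X) (q : X -> Z) :
  short_exact i q ->
  [<-> locally_splits i;
       poly_splits PA i;
       poly_lifts PA q;
       poly_splits PK i;
       hol_splits HK i;
       poly_splits PW i;
       hol_splits HW i]
  /\
  (BAP Z ->
     (locally_splits i <-> poly_lifts PK q) /\
     (locally_splits i <-> hol_lifts HK q)).
Proof.
move=> iq; split.
  (* Every implication of the cycle passes through local splitting. *)
  tfae.
  - exact: (splits_PA iq).
  - move=> h; apply: (lifts_PA iq); apply: (poly_splits_locally_splits iq _ _ h).
      by move=> A B T [].
    by move=> V W t; exact: approximable_PA.
  - move=> h; apply: (splits_PK iq); apply: (poly_lifts_locally_splits iq _ _ h).
      by move=> A B T [].
    by move=> V W t; exact: approximable_PA.
  - move=> h; apply: (splits_HK iq); apply: (poly_splits_locally_splits iq _ _ h).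
      by move=> A B T [].
    by move=> V W t; exact: approximable_PK.
  - move=> h; apply: (splits_PW iq); apply: (hol_splits_locally_splits iq _ _ h).
      by move=> A B T [].
    by move=> V W t; exact: approximable_HK.
  - move=> h; apply: (splits_HW iq); apply: (poly_splits_locally_splits iq _ _ h).
      by move=> A B T [].
    by move=> V W t; exact: approximable_PW.
  - move=> h; apply: (hol_splits_locally_splits iq _ _ h).
      by move=> A B T [].
    by move=> V W t; exact: approximable_HW.
move=> bap; split; split.
- by move=> ls; exact: (lifts_PK iq ls bap).
- move=> h; apply: (poly_lifts_locally_splits iq _ _ h).
    by move=> A B T [].
  by move=> V W t; exact: approximable_PK.
- by move=> ls; exact: (lifts_HK iq ls bap).
- move=> h; apply: (hol_lifts_locally_splits iq _ _ h).
    by move=> A B T [].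
  by move=> V W t; exact: approximable_HK.
Qed.
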